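(* In the setting described in the context, let $\mathbf U_h=(\mathbf u_h,\varphi_h)\in C^2([0,T];\mathbf V_h^e)\times C^2([0,T];V_h^a)$ be the solution of the semi-discrete problem: for all $t\in(0,T]$ and all $(\mathbf v_h,\psi_h)\in\mathbf V_h^e\times V_h^a$, $$\begin{aligned} &(\rho_e\ddot{\mathbf u}_h(t),\mathbf v_h)_{\Omega_e}+(c^{-2}\rho_a\ddot\varphi_h(t),\psi_h)_{\Omega_a}+(2\rho_e\zeta\dot{\mathbf u}_h(t),\mathbf v_h)_{\Omega_e}+(\rho_e\zeta^2\mathbf u_h(t),\mathbf v_h)_{\Omega_e}\\ &\quad+\mathcal A_h^e(\mathbf u_h(t),\mathbf v_h)+\mathcal A_h^a(\varphi_h(t),\psi_h)+\mathcal I_h^e(\dot\varphi_h(t),\mathbf v_h)+\mathcal I_h^a(\dot{\mathbf u}_h(t),\psi_h)\\ &=(\mathbf f_e(t),\mathbf v_h)_{\Omega_e}+(\rho_af_a(t),\psi_h)_{\Omega_a}, \end{aligned}$$ with initial conditions $(\mathbf u_h(0),\dot{\mathbf u}_h(0),\varphi_h(0),\dot\varphi_h(0))\in\mathbf V_h^e\times\mathbf V_h^e\times V_h^a\times V_h^a$. Then, for sufficiently large penalty parameters $\alpha$ and $\beta$ (entering the definitions of $\eta$ and $\chi$, respectively), $$\|\mathbf U_h(t)\|_{\mathcal E}\lesssim\|\mathbf U_h(0)\|_{\mathcal E}+\int_0^t\big(\|\mathbf f_e(\tau)\|_{\Omega_e}+\|f_a(\tau)\|_{\Omega_a}\big)\,\mathrm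 d\tau,\qquad t\in(0,T].$$
   Context: Domains. $d\in\{2,3\}$; $\Omega\subset\mathbb R^d$ is an open bounded convex Lipschitz domain, $\overline\Omega=\overline\Omega_e\cup\overline\Omega_a$ with $\Omega_e$ (elastic), $\Omega_a$ (acoustic) open, disjoint, bounded, convex and polygonal/polyhedral. $\Gamma_{\mathrm I}=\partial\Omega_e\cap\partial\Omega_a$ is Lipschitz with positive surface measure; $\partial\Omega_e=\Gamma_{eD}\cup\Gamma_{\mathrm I}$, $\partial\Omega_a=\Gamma_{aD}\cup\Gamma_{\mathrm I}$, with $\Gamma_{eD},\Gamma_{aD}$ of positive measure and disjoint from $\Gamma_{\mathrm I}$. $\mathbf n_e,\mathbf n_a$ are the outer unit normals, $\mathbf n_e=-\mathbf n_a$ on $\Gamma_{\mathrm I}$. $T>0$. $(\cdot,\cdot)_X$ and $\|\cdot\|_X$ are the $L^2(X)$ scalar product and norm (also for vectors/tensors). Dots denote time derivatives. Data. $0<\rho_e^-\le\rho_e\le\rho_e^+<\infty$ a.e. in $\Omega_e$; $0<\rho_a^-\le\rho_a\le\rho_a^+<\infty$ a.e. in $\Omega_a$; $c>0$; $\zeta\ge0$, $\zeta\in L^\infty(\Omega)$; $\mathbb C$ is a fourth-order symmetric uniformly elliptic elasticity tensor; $\mathbf f_e\in C^1([0,T];L^2(\Omega_e)^d)$, $f_a\in C^1([0,T];L^2(\Omega_a))$. $\mathbb C$ and $\rho_a$ are element-wise constant on the mesh below. Mesh. $\mathcal T_h$ is a polytopic mesh of $\Omega$ with $\mathcal T_h=\mathcal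 T_h^e\cup\mathcal T_h^a$, where $\mathcal T_h^e$ (resp. $\mathcal T_h^a$) consists of the elements contained in $\overline\Omega_e$ (resp. $\overline\Omega_a$); $h_\kappa$ is the diameter of $\kappa$. An interface of $\mathcal T_h$ is the intersection of the boundaries of two neighboring elements (hanging nodes/edges allowed); it is subdivided into $(d-1)$-dimensional simplices called faces; boundary faces lie on $\partial\Omega$. $\mathcal F_h^e=\mathcal F_h^{e,\mathrm i}\cup\mathcal F_h^{e,\mathrm b}$ (resp. $\mathcal F_h^a=\mathcal F_h^{a,\mathrm i}\cup\mathcal F_h^{a,\mathrm b}$) is the set of internal and boundary faces of $\mathcal T_h^e$ (resp. $\mathcal T_h^a$) not lying on $\Gamma_{\mathrm I}$. Mesh assumption: for every $\kappa\in\mathcal T_h$ there is a set of nonoverlapping (not necessarily shape-regular) $d$-simplices $\{\kappa_\flat^F\}_{F\subset\partial\kappa}$ contained in $\kappa$, $\kappa_\flat^F$ having $F$ as a face, such that for every face $F\subset\partial\kappa$, $h_\kappa\lesssim d|\kappa_\flat^F|/|F|$, and $\bigcup_{F\subset\partial\kappa}\overline{\kappa_\flat^F}\subseteq\overline\kappa$, with hidden constant independent of the discretization parameters, the number of faces of $\kappa$, the measure of $F$ and material properties. Convention. $x\lesssim y$ means $x\le Cy$ with $C>0$ independent of the discretization parameters (polynomial degrees and meshsizes) and of the number of faces of mesh elements, but possibly depending on material properties such as $\mathbb C,\rho_e,c,\rho_a$. ''Sufficiently large'' means larger than thresholds with the same independence. Discrete spaces. $p_{e,\kappa},p_{a,\kappa}\ge1$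 are polynomial degrees; $\mathscr P_p(\kappa)$ is the space of polynomials of total degree at most $p$; $\mathbf V_h^e=\{\mathbf v\in L^2(\Omega_e)^d:\mathbf v_{|\kappa}\in[\mathscr P_{p_{e,\kappa}}(\kappa)]^d\ \forall\kappa\in\mathcal T_h^e\}$, $V_h^a=\{\psi\in L^2(\Omega_a):\psi_{|\kappa}\in\mathscr P_{p_{a,\kappa}}(\kappa)\ \forall\kappa\in\mathcal T_h^a\}$. Jumps and averages. On an internal face shared by $\kappa^\pm$ with outer normals $\mathbf n^\pm$: $[\![\psi]\!]=\psi^+\mathbf n^++\psi^-\mathbf n^-$ for scalars, $[\![\mathbf v]\!]=\mathbf v^+\otimes\mathbf n^++\mathbf v^-\otimes\mathbf n^-$ for vectors, and $\{\!\{\cdot\}\!\}$ is the arithmetic mean of the two traces. On a boundary face: $[\![\psi]\!]=\psi\mathbf n$, $[\![\mathbf v]\!]=\mathbf v\otimes\mathbf n$, $\{\!\{\cdot\}\!\}$ is the trace. For a set of faces $\mathcal F$: $\langle\Phi,\Psi\rangle_{\mathcal F}=\sum_{F\in\mathcal F}(\Phi,\Psi)_F$, $\|\Phi\|_{\mathcal F}=\langle\Phi,\Phi\rangle_{\mathcal F}^{1/2}$. Forms. $\nabla_h$ is the broken gradient, $\boldsymbol\varepsilon_h(\mathbf v)=\frac12(\nabla_h\mathbf v+\nabla_h\mathbf v^T)$, $\boldsymbol\sigma_h(\mathbf v)=\mathbb C\boldsymbol\varepsilon_h(\mathbf v)$, and $\mathcal A_h^e(\mathbf u,\mathbf v)=(\boldsymbol\sigma_h(\mathbf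 u),\boldsymbol\varepsilon_h(\mathbf v))_{\Omega_e}-\langle\{\!\{\boldsymbol\sigma_h(\mathbf u)\}\!\},[\![\mathbf v]\!]\rangle_{\mathcal F_h^e}-\langle[\![\mathbf u]\!],\{\!\{\boldsymbol\sigma_h(\mathbf v)\}\!\}\rangle_{\mathcal F_h^e}+\langle\eta[\![\mathbf u]\!],[\![\mathbf v]\!]\rangle_{\mathcal F_h^e}$, $\mathcal A_h^a(\varphi,\psi)=(\rho_a\nabla_h\varphi,\nabla_h\psi)_{\Omega_a}-\langle\{\!\{\rho_a\nabla_h\varphi\}\!\},[\![\psi]\!]\rangle_{\mathcal F_h^a}-\langle[\![\varphi]\!],\{\!\{\rho_a\nabla_h\psi\}\!\}\rangle_{\mathcal F_h^a}+\langle\chi[\![\varphi]\!],[\![\psi]\!]\rangle_{\mathcal F_h^a}$, $\mathcal I_h^e(\psi,\mathbf v)=(\rho_a\psi\mathbf n_e,\mathbf v)_{\Gamma_{\mathrm I}}$, $\mathcal I_h^a(\mathbf v,\psi)=(\rho_a\mathbf v\cdot\mathbf n_a,\psi)_{\Gamma_{\mathrm I}}=-\mathcal I_h^e(\psi,\mathbf v)$. Here, with $\overline{\mathbb C}_\kappa=(|\mathbb C^{1/2}|_2^2)_{|\kappa}$ ($|\cdot|_2$ the operator norm induced by the $\ell^2$ norm on symmetric tensors) and $\overline\rho_{a,\kappa}=\rho_{a|\kappa}$: $\eta_{|F}=\alpha\max_{\kappa\in\{\kappa^+,\kappa^-\}}(\overline{\mathbb C}_\kappa p_{e,\kappa}^2/h_\kappa)$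 for $F\in\mathcal F_h^{e,\mathrm i}$, $F\subseteq\partial\kappa^+\cap\partial\kappa^-$; $\eta_{|F}=\alpha\,\overline{\mathbb C}_\kappa p_{e,\kappa}^2/h_\kappa$ for $F\in\mathcal F_h^{e,\mathrm b}$, $F\subseteq\partial\kappa$; $\chi_{|F}=\beta\max_{\kappa\in\{\kappa^+,\kappa^-\}}(\overline\rho_{a,\kappa}p_{a,\kappa}^2/h_\kappa)$ for $F\in\mathcal F_h^{a,\mathrm i}$; $\chi_{|F}=\beta\,\overline\rho_{a,\kappa}p_{a,\kappa}^2/h_\kappa$ for $F\in\mathcal F_h^{a,\mathrm b}$; $\alpha,\beta>0$ constants. Norms. $\|\mathbf v\|_{\mathrm{dG},e}^2=\|\mathbb C^{1/2}\boldsymbol\varepsilon_h(\mathbf v)\|_{\Omega_e}^2+\|\eta^{1/2}[\![\mathbf v]\!]\|_{\mathcal F_h^e}^2$, $\|\psi\|_{\mathrm{dG},a}^2=\|\rho_a^{1/2}\nabla_h\psi\|_{\Omega_a}^2+\|\chi^{1/2}[\![\psi]\!]\|_{\mathcal F_h^a}^2$. For $\mathbf W=(\mathbf v,\psi)$ depending on time, $\|\mathbf W(t)\|_{\mathcal E}^2=\|\mathbf v(t)\|_{\mathcal E_e}^2+\|\psi(t)\|_{\mathcal E_a}^2$, with $\|\mathbf v(t)\|_{\mathcal E_e}^2=\|\rho_e^{1/2}\dot{\mathbf v}(t)\|_{\Omega_e}^2+\|\rho_e^{1/2}\zeta\mathbf v(t)\|_{\Omega_e}^2+\|\mathbf v(t)\|_{\mathrm{dG},e}^2$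 and $\|\psi(t)\|_{\mathcal E_a}^2=\|c^{-1}\rho_a^{1/2}\dot\psi(t)\|_{\Omega_a}^2+\|\psi(t)\|_{\mathrm{dG},a}^2$. *)

(* Defs.v *)
From HB Require Import structures.
From mathcomp Require Import all_boot all_order all_algebra.
From mathcomp Require Import all_classical all_reals all_analysis.
From mathcomp.multinomials Require mpoly.

Set Implicit Arguments.
Unset Strict Implicit.
Unset Printing Implicit Defensive.
Import Order.TTheory GRing.Theory Num.Theory.
Import numFieldNormedType.Exports.
Local Open Scope classical_set_scope.
Local Open Scope ring_scope.

(* Borel sigma-algebra and Lebesgue measure on 'rV[R]_n. The sigma-algebra is
   generated by the coordinates; the measure is the n-fold product of the
   one-dimensional Lebesgue measure, transported by (a, x) |-> row_mx a x. *)

Definition rV_display : measure_display -> measure_display.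
Proof. exact. Qed.

Section measurable_rV.
Context {d} {T : measurableType d}.
Variable n : nat.

Let coord (i : 'I_n) (x : 'rV[T]_n) : T := x ord0 i.

Let rV_set0 : g_sigma_preimage coord set0.
Proof. exact: sigma_algebra0. Qed.

Let rV_setC A : g_sigma_preimage coord A -> g_sigma_preimage coord (~` A).
Proof. exact: sigma_algebraC. Qed.

Let rV_bigcup (F : _^nat) : (forall i, g_sigma_preimage coord (F i)) ->
  g_sigma_preimage coord (\bigcup_i (F i)).
Proof. exact: sigma_algebra_bigcup. Qed.

HB.instance Definition _ := @isMeasurable.Build (rV_display d)
  'rV[T]_n (g_sigma_preimage coord) rV_set0 rV_setC rV_bigcup.

End measurable_rV.

Lemma measurable_coord d (T : measurableType d) n (i : 'I_n) :
  measurable_fun [set: 'rV[T]_n] (fun x : 'rV[T]_n => x ord0 i).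
Proof.
move=> _ Y mY; rewrite setTI; apply: sub_sigma_algebra => /=.
rewrite -bigcup_seq/=; exists i => /=; first by rewrite mem_index_enum.
by exists Y => //; rewrite setTI.
Qed.

Lemma measurable_fun_coordP d1 d2 (T1 : measurableType d1)
    (T2 : measurableType d2) n (f : T1 -> 'rV[T2]_n) :
  (forall i, measurable_fun [set: T1] (fun x => f x ord0 i)) ->
  measurable_fun [set: T1] f.
Proof.
move=> mf _ A mA; rewrite setTI.
have : (preimage_set_system [set: T1] f
   (g_sigma_preimage (fun (i : 'I_n) (x : 'rV[T2]_n) => x ord0 i))) (f @^-1` A).
  by exists A => //; rewrite setTI.
rewrite -g_sigma_preimage_comp.
move: (f @^-1` A); apply: smallest_sub; first exact: sigma_algebra_measurable.
case: n => [|n] in f mf {A mA} *; first by rewrite big_ord0.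
rewrite -bigcup_mkord_ord; apply: bigcup_sub => i Ii.
by move=> A [B mB <-]; exact: mf.
Qed.

Definition rV_cons (R : realType) n (p : R * 'rV[R]_n) : 'rV[R]_n.+1 :=
  row_mx p.1%:M p.2.

Definition rV_uncons (R : realType) n (x : 'rV[R]_n.+1) : R * 'rV[R]_n :=
  (x ord0 ord0, \row_i x ord0 (lift ord0 i)).

Lemma rV_consK (R : realType) n : cancel (@rV_cons R n) (@rV_uncons R n).
Proof.
move=> [a x]; rewrite /rV_uncons /rV_cons; congr pair.
  transitivity ((row_mx a%:M x : 'rV[R]_(1 + n)) ord0 (lshift n (ord0 : 'I_1))).
    by congr (_ _ _); exact/val_inj.
  by rewrite row_mxEl mxE eqxx mulr1n.
apply/rowP => i; rewrite mxE.
transitivity ((row_mx a%:M x : 'rV[R]_(1 + n)) ord0 (rshift 1 i)).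
  by congr (_ _ _); exact/val_inj.
by rewrite row_mxEr.
Qed.

Lemma rV_unconsK (R : realType) n : cancel (@rV_uncons R n) (@rV_cons R n).
Proof.
move=> x; apply/rowP => i; rewrite /rV_cons/= mxE.
case: splitP => j; rewrite ?mxE => ij.
  rewrite !ord1/= mulr1n; congr (x _ _).
  by apply/val_inj; rewrite /= ij ord1.
by congr (x _ _); apply/val_inj => /=; rewrite ij.
Qed.

Lemma measurable_rV_cons (R : realType) n :
  measurable_fun [set: R * 'rV[R]_n] (@rV_cons R n).
Proof.
apply: measurable_fun_coordP => i.
have [->|[j ->]] : i = ord0 \/ exists j, i = lift ord0 j.
  by case: (unliftP ord0 i) => [j|] ->; [right; exists j|left].
- rewrite (_ : (fun x => _) = fst); first exact: measurable_fst.
  by apply/funext => p; have := rV_consK p; case: p => a x [].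
rewrite (_ : (fun x => _) = (fun x : 'rV[R]_n => x ord0 j) \o snd).
  by apply: measurableT_comp; [exact: measurable_coord|exact: measurable_snd].
apply/funext => p; have := rV_consK p; case: p => a x [_ /rowP/(_ j)].
by rewrite mxE.
Qed.

Lemma measurable_rV_uncons (R : realType) n :
  measurable_fun [set: 'rV[R]_n.+1] (@rV_uncons R n).
Proof.
apply: measurable_fun_pair; first exact: measurable_coord.
apply: measurable_fun_coordP => i.
rewrite (_ : (fun x => _) = (fun x : 'rV[R]_n.+1 => x ord0 (lift ord0 i))).
  exact: measurable_coord.
by apply/funext => x; rewrite mxE.
Qed.

Section leb_cons.
Context (R : realType) (n : nat).
Variable m : {sigma_finite_measure set 'rV[R]_n -> \bar R}.

Definition leb_cons : set 'rV[R]_n.+1 -> \bar R :=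
  pushforward (@lebesgue_measure R \x m)%E (@rV_cons R n).

Let leb_cons0 : leb_cons set0 = 0%E.
Proof. by rewrite /leb_cons /pushforward preimage_set0 measure0. Qed.

Let leb_cons_ge0 A : (0 <= leb_cons A)%E.
Proof. by rewrite /leb_cons /pushforward; exact: measure_ge0. Qed.

Let leb_cons_sigma_additive : semi_sigma_additive leb_cons.
Proof.
move=> F mF tF mUF; rewrite /leb_cons /pushforward preimage_bigcup.
have mc := @measurable_rV_cons R n.
apply: measure_semi_sigma_additive.
- by move=> k; rewrite -[X in measurable X]setTI; exact: mc.
- apply/trivIsetP => /= i j _ _ ij; rewrite -preimage_setI.
  by move/trivIsetP : tF => /(_ _ _ _ _ ij) ->//; rewrite preimage_set0.
- by rewrite -preimage_bigcup -[X in measurable X]setTI; exact: mc.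
Qed.

HB.instance Definition _ := isMeasure.Build _ _ _ leb_cons
  leb_cons0 leb_cons_ge0 leb_cons_sigma_additive.

Let leb_cons_sigma_finite : sigma_finite setT leb_cons.
Proof.
have /sigma_finiteP[F [TF ndF Foo]] := sigma_finiteT (@lebesgue_measure R).
have /sigma_finiteP[G [TG ndG Goo]] := sigma_finiteT m.
exists (fun k => @rV_uncons R n @^-1` (F k `*` G k)).
  rewrite -preimage_bigcup predeqE => z; split => // _ /=.
  have [i _ Fi] : (\bigcup_i F i) (rV_uncons z).1 by rewrite -TF.
  have [j _ Gj] : (\bigcup_i G i) (rV_uncons z).2 by rewrite -TG.
  exists (maxn i j) => //; split.
    by move: Fi; exact/subsetPset/ndF/leq_maxl.
  by move: Gj; exact/subsetPset/ndG/leq_maxr.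
move=> k; have [mF Fk] := Foo k; have [mG Gk] := Goo k; split.
  rewrite -[X in measurable X]setTI; apply: measurable_rV_uncons => //.
  exact: measurableX.
rewrite /leb_cons /pushforward -comp_preimage.
rewrite (_ : rV_uncons (n:=n) \o _ = id) ?preimage_id; last first.
  by apply/funext => p /=; rewrite rV_consK.
by rewrite product_measure1E// lte_mul_pinfty// ge0_fin_numE.
Qed.

HB.instance Definition _ := Measure_isSigmaFinite.Build _ _ _ leb_cons
  leb_cons_sigma_finite.

End leb_cons.

Fixpoint leb (R : realType) (n : nat) :
    {sigma_finite_measure set 'rV[R]_n -> \bar R} :=
  if n is n'.+1 then leb_cons (leb R n') else @dirac _ 'rV[R]_0 0 R.
Arguments leb : clear implicits.

(* Euclidean structure: [frob] is the dot product of row vectors and the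
   contraction A : B of tensors. (The library norm on matrices is the sup
   norm; it is only used for its topology.) *)
Section euclidean.
Context (R : realType).

Definition frob p q (A B : 'M[R]_(p, q)) : R := \sum_i \sum_j A i j * B i j.

Definition fnorm p q (A : 'M[R]_(p, q)) : R := Num.sqrt (frob A A).

Definition boundary n (A : set 'rV[R]_n) : set 'rV[R]_n :=
  closure A `\` interior A.

Definition diam n (A : set 'rV[R]_n) : R :=
  sup [set fnorm (x - y) | x in A & y in A].

Definition csimplex k n (V : 'I_k.+1 -> 'rV[R]_n) : set 'rV[R]_n :=
  [set x | exists w : 'I_k.+1 -> R,
    [/\ forall i, 0 <= w i, \sum_i w i = 1 & x = \sum_i w i *: V i]].

Definition osimplex k n (V : 'I_k.+1 -> 'rV[R]_n) : set 'rV[R]_n :=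
  [set x | exists w : 'I_k.+1 -> R,
    [/\ forall i, 0 < w i, \sum_i w i = 1 & x = \sum_i w i *: V i]].

Definition edges k n (V : 'I_k.+1 -> 'rV[R]_n) : 'M[R]_(k, n) :=
  \matrix_(i < k) (V (lift ord0 i) - V ord0).

Definition affine_free k n (V : 'I_k.+1 -> 'rV[R]_n) : bool :=
  row_free (edges V).

Definition ref_simplex k : set 'rV[R]_k :=
  [set s | (forall i, 0 <= s ord0 i) /\ \sum_i s ord0 i <= 1].

(* Surface integral over the simplex with vertices V: the affine
   parametrization s |-> V 0 + s E, with E the matrix of the edge vectors,
   has area element sqrt (det (E E^T)). *)
Definition face_int k n (V : 'I_k.+1 -> 'rV[R]_n) (g : 'rV[R]_n -> R) : R :=
  Num.sqrt (\det (edges V *m (edges V)^T)) *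
  \int[leb R k]_(s in @ref_simplex k) g (V ord0 + s *m edges V).

Definition face_area k n (V : 'I_k.+1 -> 'rV[R]_n) : R :=
  face_int V (fun=> 1).

(* k-dimensional Hausdorff measure, up to a positive normalization factor
   (only its positivity is used); r i bounds the diameter of U i. *)
Definition hausdorff_pre k n (delta : R) (A : set 'rV[R]_n) : \bar R :=
  ereal_inf [set z | exists (U : nat -> set 'rV[R]_n) (r : nat -> R),
    [/\ A `<=` \bigcup_i U i,
        forall i, 0 <= r i <= delta,
        forall i x y, U i x -> U i y -> fnorm (x - y) <= r i &
        z = (\sum_(i <oo) (r i ^+ k)%:E)%E]].

Definition hausdorff k n (A : set 'rV[R]_n) : \bar R :=
  ereal_sup [set hausdorff_pre k delta A | delta in [set delta | 0 < delta]].

(* Charts: after a translation and an orthogonal change of coordinates Q, the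
   first coordinate is compared with a Lipschitz function of the others. *)
Definition lipschitz_fun n (g : 'rV[R]_n -> R) : Prop :=
  exists L : R, forall y z, `|g y - g z| <= L * fnorm (y - z).

Definition lipschitz_domain n (A : set 'rV[R]_n.+1) : Prop :=
  forall x, boundary A x -> exists (Q : 'M[R]_n.+1) (g : 'rV[R]_n -> R),
    [/\ Q *m Q^T = 1%:M, lipschitz_fun g &
        \forall y \near x, let z := rV_uncons ((y - x) *m Q) in
          A y <-> g z.2 < z.1].

Definition lipschitz_surface n (S : set 'rV[R]_n.+1) : Prop :=
  forall x, S x -> exists (Q : 'M[R]_n.+1) (g : 'rV[R]_n -> R),
    [/\ Q *m Q^T = 1%:M, lipschitz_fun g &
        \forall y \near x, let z := rV_uncons ((y - x) *m Q) in
          S y -> z.1 = g z.2].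

Definition polyhedral n (A : set 'rV[R]_n) : Prop :=
  exists (I : finType) (a : I -> 'rV[R]_n) (b : I -> R),
    A = [set x | forall i, frob (a i) x < b i].

End euclidean.

Section L2.
Context (R : realType) (n : nat).
Implicit Types A : set 'rV[R]_n.

Definition L2norm A (g : 'rV[R]_n -> R) : R :=
  Num.sqrt (\int[leb R n]_(x in A) (g x ^+ 2)).

Definition L2vnorm p q A (v : 'rV[R]_n -> 'M[R]_(p, q)) : R :=
  L2norm A (fun x => fnorm (v x)).

Definition inL2 A (g : 'rV[R]_n -> R) : Prop :=
  measurable_fun A g /\ (leb R n).-integrable A (fun x => (g x ^+ 2)%:E).

Definition inL2v p q A (v : 'rV[R]_n -> 'M[R]_(p, q)) : Prop :=
  forall i j, inL2 A (fun x => v x i j).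

Definition Linfty A (g : 'rV[R]_n -> R) : Prop :=
  measurable_fun A g /\
  exists B : R, {ae leb R n, forall x, A x -> `|g x| <= B}.

(* u belongs to C^1([0,T]; X), with derivative u', where X is a space of
   functions 'rV[R]_n -> W equipped with the (semi)norm N. *)
Definition isC1 (W : lmodType R) (X : ('rV[R]_n -> W) -> Prop)
    (N : ('rV[R]_n -> W) -> R) (T : R) (u u' : R -> 'rV[R]_n -> W) : Prop :=
  forall t : R, 0 <= t <= T ->
  [/\ X (u t), X (u' t),
      N (fun x => (s - t)^-1 *: (u s x - u t x) - u' t x)
        @[s --> within `[0, T] t^'] --> 0 &
      N (fun x => u' s x - u' t x) @[s --> within `[0, T] (nbhs t)] --> 0].

End L2.

Section tensors.
Context (R : realType) (d : nat).

Definition tensor4 : Type := 'I_d -> 'I_d -> 'I_d -> 'I_d -> R.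

Definition tapply (C : tensor4) (A : 'M[R]_d) : 'M[R]_d :=
  \matrix_(i, j) \sum_k \sum_l C i j k l * A k l.

Definition tsymmetric (C : tensor4) : Prop :=
  forall i j k l, C i j k l = C j i k l /\ C i j k l = C k l i j.

(* S is the square root of C as a nonnegative self-adjoint operator on
   symmetric second-order tensors; this determines S. *)
Definition is_tsqrt (S C : tensor4) : Prop :=
  [/\ tsymmetric S,
      forall A : 'M[R]_d, A^T = A -> 0 <= frob (tapply S A) A &
      forall A : 'M[R]_d, A^T = A -> tapply S (tapply S A) = tapply C A].

Definition topnorm (S : tensor4) : R :=
  sup [set fnorm (tapply S A) | A in [set A | A^T = A /\ fnorm A <= 1]].

End tensors.

(* Geometry and material data; the space dimension is n.+1. [CCh] stands for
   the square root of the elasticity tensor [CC]. *)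
Record problem (R : realType) (n : nat) := Problem {
  Om : set 'rV[R]_n.+1;
  Ome : set 'rV[R]_n.+1;
  Oma : set 'rV[R]_n.+1;
  rhoe : 'rV[R]_n.+1 -> R;
  rhoa : 'rV[R]_n.+1 -> R;
  cs : R;
  zeta : 'rV[R]_n.+1 -> R;
  CC : 'rV[R]_n.+1 -> tensor4 R n.+1;
  CCh : 'rV[R]_n.+1 -> tensor4 R n.+1
}.

Section assumptions.
Context (R : realType) (n : nat) (P : problem R n).

Definition GammaI : set 'rV[R]_n.+1 := boundary (Ome P) `&` boundary (Oma P).
Definition GammaeD : set 'rV[R]_n.+1 := boundary (Ome P) `\` GammaI.
Definition GammaaD : set 'rV[R]_n.+1 := boundary (Oma P) `\` GammaI.

Definition convex_domain (A : set 'rV[R]_n.+1) : Prop :=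
  [/\ open A, A !=set0, bounded_set A & convex_set A].

Record geometry : Prop := Geometry {
  Om_convex : convex_domain (Om P);
  Om_lipschitz : lipschitz_domain (Om P);
  Om_split : closure (Om P) = closure (Ome P) `|` closure (Oma P);
  Ome_convex : convex_domain (Ome P);
  Ome_poly : polyhedral (Ome P);
  Oma_convex : convex_domain (Oma P);
  Oma_poly : polyhedral (Oma P);
  Om_disjoint : Ome P `&` Oma P = set0;
  GammaI_lipschitz : lipschitz_surface GammaI;
  GammaI_pos : (0 < hausdorff n GammaI)%E;
  GammaeD_pos : (0 < hausdorff n GammaeD)%E;
  GammaaD_pos : (0 < hausdorff n GammaaD)%E
}.

Definition density (A : set 'rV[R]_n.+1) (rho : 'rV[R]_n.+1 -> R) : Prop :=
  measurable_fun A rho /\ exists lo hi : R,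
    0 < lo /\ {ae leb R n.+1, forall x, A x -> lo <= rho x <= hi}.

Record materials : Prop := Materials {
  rhoe_density : density (Ome P) (rhoe P);
  rhoa_density : density (Oma P) (rhoa P);
  cs_gt0 : 0 < cs P;
  zeta_Linfty : Linfty (Om P) (zeta P);
  zeta_ge0 : {ae leb R n.+1, forall x, Om P x -> 0 <= zeta P x};
  CC_sym : forall x, Ome P x -> tsymmetric (CC P x);
  CC_elliptic : exists2 gamma : R, 0 < gamma &
    forall x (A : 'M[R]_n.+1), Ome P x -> A^T = A ->
      gamma * fnorm A ^+ 2 <= frob (tapply (CC P x) A) A;
  CCh_sqrt : forall x, Ome P x -> is_tsqrt (CCh P x) (CC P x)
}.

End assumptions.

(* Elements [cell k] are open sets (an element may be nonconvex); faces are given by their vertices;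
   [nrm k F] is the outer unit normal of [cell k] on the face F; [pe] and
   [pa] are the polynomial degrees. *)
Record discretization (R : realType) (n : nat) := Discretization {
  cells : finType;
  cell : cells -> set 'rV[R]_n.+1;
  faces : finType;
  vtx : faces -> 'I_n.+1 -> 'rV[R]_n.+1;
  nrm : cells -> faces -> 'rV[R]_n.+1;
  pe : cells -> nat;
  pa : cells -> nat
}.

Section mesh.
Context (R : realType) (n : nat) (P : problem R n) (D : discretization R n).

Definition elastic : pred (cells D) :=
  fun k => `[< cell k `<=` closure (Ome P) >].
Definition acoustic : pred (cells D) :=
  fun k => `[< cell k `<=` closure (Oma P) >].

Definition face (F : faces D) : set 'rV[R]_n.+1 := csimplex (vtx F).

Definition owner (F : faces D) : pred (cells D) :=
  fun k => `[< face F `<=` boundary (cell k) >].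

Definition polytope (A : set 'rV[R]_n.+1) : Prop :=
  exists (I : finType) (V : I -> 'I_n.+2 -> 'rV[R]_n.+1),
    (forall i, affine_free (V i)) /\ closure A = \bigcup_i csimplex (V i).

(* At a point x of the face through which no other face passes, the element is
   locally the half space lying on the side of F opposite to its outer normal;
   other faces may touch F in lower-dimensional sets. *)
Definition outer_normal (k : cells D) (F : faces D) (nu : 'rV[R]_n.+1) : Prop :=
  fnorm nu = 1 /\
  forall x, osimplex (vtx F) x -> (forall F', F' != F -> ~ face F' x) ->
    \forall y \near x, cell k y <-> frob (y - x) nu < 0.

Record is_mesh : Prop := IsMesh {
  cell_open : forall k, open (cell (d:=D) k);
  cell_neq0 : forall k, cell (d:=D) k !=set0;
  cell_connected : forall k, connected (cell (d:=D) k);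
  cell_regular : forall k, interior (closure (cell (d:=D) k)) = cell k;
  cell_polytope : forall k, polytope (cell (d:=D) k);
  cell_disjoint : forall k k' : cells D, k != k' -> cell k `&` cell k' = set0;
  cell_cover : closure (Om P) = \bigcup_k closure (cell (d:=D) k);
  cell_kind : forall k, elastic k || acoustic k;
  face_simplex : forall F : faces D, affine_free (vtx F);
  face_kind : forall F : faces D,
    (exists k k', [/\ k != k', owner F k & owner F k']) \/
    (face F `<=` boundary (Om P) /\ exists k, owner F k);
  face_disjoint : forall F F' : faces D, F != F' ->
    osimplex (vtx F) `&` osimplex (vtx F') = set0;
  face_cover : forall k,
    boundary (cell k) = \bigcup_(F in [set F | owner F k]) face F;
  nrm_outer : forall k F, owner F k -> outer_normal k F (nrm k F);
  pe_ge1 : forall k, elastic k -> (1 <= pe k)%N;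
  pa_ge1 : forall k, acoustic k -> (1 <= pa k)%N
}.

Definition cone (F : faces D) (a : 'rV[R]_n.+1) : 'I_n.+2 -> 'rV[R]_n.+1 :=
  fun i => oapp (vtx F) a (unlift ord0 i).

Definition mesh_regular (cT : R) : Prop :=
  forall k : cells D, exists a : faces D -> 'rV[R]_n.+1,
  [/\ forall F, owner F k -> affine_free (cone F (a F)) /\
        osimplex (cone F (a F)) `<=` cell k,
      forall F F', owner F k -> owner F' k -> F != F' ->
        osimplex (cone F (a F)) `&` osimplex (cone F' (a F')) = set0,
      \bigcup_(F in [set F | owner F k]) csimplex (cone F (a F))
        `<=` closure (cell k) &
      forall F, owner F k ->
        diam (cell k) <= cT * (n.+1%:R *
          fine (leb R n.+1 (csimplex (cone F (a F)))) / face_area (vtx F))].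

Definition elementwise_constant : Prop :=
  (forall k : cells D, elastic k -> forall x y, cell k x -> cell k y ->
     CC P x = CC P y) /\
  (forall k : cells D, acoustic k -> forall x y, cell k x -> cell k y ->
     rhoa P x = rhoa P y).

Definition on_GammaI : pred (faces D) := fun F => `[< face F `<=` GammaI P >].
Definition faces_e : pred (faces D) :=
  fun F => [exists k, owner F k && elastic k] && ~~ on_GammaI F.
Definition faces_a : pred (faces D) :=
  fun F => [exists k, owner F k && acoustic k] && ~~ on_GammaI F.

End mesh.

Section discrete_spaces.
Context (R : realType) (n : nat) (P : problem R n) (D : discretization R n).

Definition poly_on (A : set 'rV[R]_n.+1) (p : nat) (g : 'rV[R]_n.+1 -> R) :=
  exists q : mpoly.mpoly n.+1 R,
    all (fun m => (mpoly.mdeg m <= p)%N) (mpoly.msupp q) /\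
    forall x, A x -> g x = mpoly.meval (fun i => x ord0 i) q.

Definition Vhe (v : 'rV[R]_n.+1 -> 'rV[R]_n.+1) : Prop :=
  inL2v (Ome P) v /\
  forall k : cells D, elastic P k ->
    forall j, poly_on (cell k) (pe k) (fun x => v x ord0 j).

Definition Vha (psi : 'rV[R]_n.+1 -> R) : Prop :=
  inL2 (Oma P) psi /\
  forall k : cells D, acoustic P k -> poly_on (cell k) (pa k) psi.

End discrete_spaces.

Section forms.
Context (R : realType) (n : nat) (P : problem R n) (D : discretization R n).
Variables alpha beta : R.
Implicit Types (k : cells D) (F : faces D) (x : 'rV[R]_n.+1).
Implicit Types (u v : 'rV[R]_n.+1 -> 'rV[R]_n.+1).
Implicit Types (phi psi : 'rV[R]_n.+1 -> R).

(* Traces on the boundary are limits from inside the element k. *)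
Definition strc k (g : 'rV[R]_n.+1 -> R) x : R :=
  lim (g y @[y --> within (cell k) (nbhs x)]).
Definition mtrc p q k (g : 'rV[R]_n.+1 -> 'M[R]_(p, q)) x : 'M[R]_(p, q) :=
  \matrix_(i, j) strc k (fun y => g y i j) x.

(* Jumps and averages; a face has two owners if it is internal, and one if it
   is a boundary face. *)
Definition sjump F phi x : 'rV[R]_n.+1 :=
  \sum_(k : cells D | owner F k) strc k phi x *: nrm k F.
Definition vjump F v x : 'M[R]_n.+1 :=
  \sum_(k : cells D | owner F k) (mtrc k v x)^T *m nrm k F.
Definition avg p q F (g : 'rV[R]_n.+1 -> 'M[R]_(p, q)) x : 'M[R]_(p, q) :=
  #|owner F|%:R^-1 *: \sum_(k : cells D | owner F k) mtrc k g x.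

Definition sgrad phi x : 'rV[R]_n.+1 := \row_j 'D_(delta_mx ord0 j) phi x.
Definition vgrad v x : 'M[R]_n.+1 :=
  \matrix_(i, j) 'D_(delta_mx ord0 j) (fun y => v y ord0 i) x.
Definition eps v x : 'M[R]_n.+1 := 2^-1 *: (vgrad v x + (vgrad v x)^T).
Definition sigma v x : 'M[R]_n.+1 := tapply (CC P x) (eps v x).
Definition sflux phi x : 'rV[R]_n.+1 := rhoa P x *: sgrad phi x.

(* Values on an element of fields that are constant on it; [xget 0 (cell k)]
   is a point of the element. *)
Definition Cbar k : R := topnorm (CCh P (xget 0 (cell k))) ^+ 2.
Definition rhobar k : R := rhoa P (xget 0 (cell k)).

Definition eta F : R :=
  alpha * \big[Num.max/0]_(k : cells D | owner F k)
            (Cbar k * (pe k)%:R ^+ 2 / diam (cell k)).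
Definition chi F : R :=
  beta * \big[Num.max/0]_(k : cells D | owner F k)
           (rhobar k * (pa k)%:R ^+ 2 / diam (cell k)).

(* Integrals of broken quantities are sums over the (open) elements, in which
   the derivatives are taken. *)
Definition Ae u v : R :=
  \sum_(k : cells D | elastic P k)
     \int[leb R n.+1]_(x in cell k) frob (sigma u x) (eps v x)
  - \sum_(F : faces D | faces_e P F)
     face_int (vtx F) (fun x => frob (avg F (sigma u) x) (vjump F v x))
  - \sum_(F : faces D | faces_e P F)
     face_int (vtx F) (fun x => frob (vjump F u x) (avg F (sigma v) x))
  + \sum_(F : faces D | faces_e P F)
     face_int (vtx F) (fun x => frob (eta F *: vjump F u x) (vjump F v x)).

Definition Aa phi psi : R :=
  \sum_(k : cells D | acoustic P k)
     \int[leb R n.+1]_(x in cell k) frob (sflux phi x) (sgrad psi x)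
  - \sum_(F : faces D | faces_a P F)
     face_int (vtx F) (fun x => frob (avg F (sflux phi) x) (sjump F psi x))
  - \sum_(F : faces D | faces_a P F)
     face_int (vtx F) (fun x => frob (sjump F phi x) (avg F (sflux psi) x))
  + \sum_(F : faces D | faces_a P F)
     face_int (vtx F) (fun x => frob (chi F *: sjump F phi x) (sjump F psi x)).

(* On GammaI, elastic fields are traced from the elastic owner ke and acoustic
   fields from the acoustic owner ka. *)
Definition Ie psi v : R :=
  \sum_(F : faces D | on_GammaI P F)
  \sum_(ke : cells D | owner F ke && elastic P ke) \sum_(ka : cells D | owner F ka && acoustic P ka)
    face_int (vtx F) (fun x =>
      frob ((strc ka (rhoa P) x * strc ka psi x) *: nrm ke F)
           (mtrc ke v x)).

Definition Ia v psi : R :=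
  \sum_(F : faces D | on_GammaI P F)
  \sum_(ke : cells D | owner F ke && elastic P ke) \sum_(ka : cells D | owner F ka && acoustic P ka)
    face_int (vtx F) (fun x =>
      strc ka (rhoa P) x * frob (mtrc ke v x) (nrm ka F) * strc ka psi x).

Definition dGe v : R := Num.sqrt
  (\sum_(k : cells D | elastic P k)
      L2vnorm (cell k) (fun x => tapply (CCh P x) (eps v x)) ^+ 2
   + \sum_(F : faces D | faces_e P F)
       face_int (vtx F) (fun x => fnorm (Num.sqrt (eta F) *: vjump F v x) ^+ 2)).

Definition dGa psi : R := Num.sqrt
  (\sum_(k : cells D | acoustic P k)
      L2vnorm (cell k) (fun x => Num.sqrt (rhoa P x) *: sgrad psi x) ^+ 2
   + \sum_(F : faces D | faces_a P F)
       face_int (vtx F) (fun x => fnorm (Num.sqrt (chi F) *: sjump F psi x) ^+ 2)).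

(* Energy norm of (v, psi) at a given time; v' and psi' are the values of the
   time derivatives. *)
Definition Enorm v v' psi psi' : R := Num.sqrt
  (L2vnorm (Ome P) (fun x => Num.sqrt (rhoe P x) *: v' x) ^+ 2
   + L2vnorm (Ome P) (fun x => (Num.sqrt (rhoe P x) * zeta P x) *: v x) ^+ 2
   + dGe v ^+ 2
   + L2norm (Oma P) (fun x => (cs P)^-1 * Num.sqrt (rhoa P x) * psi' x) ^+ 2
   + dGa psi ^+ 2).

Definition semidiscrete_eq (u u1 u2 : 'rV[R]_n.+1 -> 'rV[R]_n.+1)
    (phi phi1 phi2 : 'rV[R]_n.+1 -> R) (fe : 'rV[R]_n.+1 -> 'rV[R]_n.+1)
    (fa : 'rV[R]_n.+1 -> R) v psi : Prop :=
  \int[leb R n.+1]_(x in Ome P) frob (rhoe P x *: u2 x) (v x)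
  + \int[leb R n.+1]_(x in Oma P) ((cs P)^-2 * rhoa P x * phi2 x * psi x)
  + \int[leb R n.+1]_(x in Ome P) frob ((2 * rhoe P x * zeta P x) *: u1 x) (v x)
  + \int[leb R n.+1]_(x in Ome P) frob ((rhoe P x * zeta P x ^+ 2) *: u x) (v x)
  + Ae u v + Aa phi psi + Ie phi1 v + Ia u1 psi
  = \int[leb R n.+1]_(x in Ome P) frob (fe x) (v x)
  + \int[leb R n.+1]_(x in Oma P) (rhoa P x * fa x * psi x).

End forms.

(* Main.v *)
(* The energy
     E = |rho_e^(1/2) u'|^2 + |rho_e^(1/2) zeta u|^2 + A_e(u, u)
         + |c^-1 rho_a^(1/2) phi'|^2 + A_a(phi, phi)
   is equivalent to the squared energy norm once the penalties dominate the constant of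
   the discrete trace inequality: the flux terms of A_e and A_a are then absorbed by
   half of the gradient and jump terms. Testing the equation with (u', phi'), the two
   interface terms cancel (the normals are opposite), the zeta term is dissipative, and
   the loads are estimated by Cauchy-Schwarz, so that
     E' <= 2 C (|f_e| + |f_a|) E^(1/2);
   integrating the inequality for E^(1/2) gives the result.

   The trace inequality sum_F |q|_F^2 <= C (p^2 / h) |q|_kappa^2, with C independent of
   the shape and the number of faces, reduces to the simplices attached to the faces, and
   by an affine map to the reference simplex. The latter is cut according to which
   barycentric coordinate is at least 1/(n+1); each piece is swept by segments of
   fixed length on which q is a polynomial in one variable, and r(0)^2 is bounded by
   ((p+1)^2 / d) int_0^d r^2 by means of the reproducing kernel of evaluation at 0. *)
Require Import Defs.
From HB Require Import structures.
From mathcomp Require Import all_boot all_order all_algebra.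
From mathcomp Require Import all_classical all_reals all_analysis.
From mathcomp Require Import measurable_realfun ring lra zify.
From mathcomp.multinomials Require mpoly.

Set Implicit Arguments.
Unset Strict Implicit.
Unset Printing Implicit Defensive.
Import Order.TTheory GRing.Theory Num.Theory.
Import numFieldNormedType.Exports.
Local Open Scope classical_set_scope.
Local Open Scope ring_scope.


(** * Invariance properties of the Lebesgue measure on row vectors *)

(** The curves are differentiable only in the L2 norm, whereas the energy contains gradients and
    face traces. This is reconciled by polynomials: on each element the coefficients are bounded by
    the L2 norm, so every form is continuous for it. That continuity constant depends on mesh and
    degrees, but it serves only to differentiate the energy; the quantitative estimate rests on the
    trace inequality. There each penalty carries the local bound of its coefficient and the
    inequality is applied to the square root of the energy density, so the penalty threshold depends
    on [n] and [cT] alone. Opposite normals have to be proved: [nrm_outer] speaks only at points of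
    a face met by no other face, and such points are found by a measure argument. The root of the
    energy is not differentiable where the energy vanishes, hence a regularization by [e ^+ 2].
    Finally, volumes are compared through an unspecified scaling factor that cancels, so that no
    determinant formula for the measure is used. *)

Section leb_basic.
Context (R : realType).

Lemma preimage_measurable d1 d2 (T1 : measurableType d1) (T2 : measurableType d2)
    (f : T1 -> T2) (A : set T2) :
  measurable_fun [set: T1] f -> measurable A -> measurable (f @^-1` A).
Proof. by move=> mf mA; rewrite -[X in measurable X]setTI; exact: mf. Qed.

Lemma leb_consE n A : leb R n.+1 A =
  ((@lebesgue_measure R \x leb R n) (@rV_cons R n @^-1` A))%E.
Proof. by []. Qed.

Lemma measurable_addrV n (a : 'rV[R]_n) :
  measurable_fun [set: 'rV[R]_n] (fun x : 'rV[R]_n => x + a).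
Proof.
apply: measurable_fun_coordP => i.
under eq_fun do rewrite mxE.
by apply: measurable_funD; [exact: measurable_coord|exact: measurable_cst].
Qed.

Lemma measurable_mulrV n m (M : 'M[R]_(n, m)) :
  measurable_fun [set: 'rV[R]_n] (fun x : 'rV[R]_n => x *m M).
Proof.
apply: measurable_fun_coordP => i.
under eq_fun do rewrite mxE.
apply: measurable_sum => j.
by apply: measurable_funM; [exact: measurable_coord|exact: measurable_cst].
Qed.

Lemma lebesgue_measure_translate (a : R) (A : set R) : measurable A ->
  lebesgue_measure ((fun x : R => x + a) @^-1` A) = lebesgue_measure A.
Proof.
move=> mA; apply/esym.
have mf : measurable_fun [set: measurableTypeR R]
    ((fun x : R => x + a) : measurableTypeR R -> measurableTypeR R).
  by apply: measurable_funD; [exact: measurable_id|exact: measurable_cst].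
apply: (@lebesgue_measure_unique R (pushforward lebesgue_measure _)) => //.
move=> _ [[x y]] _ <-; rewrite /pushforward /=.
rewrite [X in _ = lebesgue_measure X](_ : _ = `]x - a, y - a]%classic).
  rewrite !lebesgue_measure_itv/= !lte_fin.
  by rewrite ltrD2r; case: ifP => // _; rewrite -!EFinD opprB addrA subrK.
by apply/seteqP; split => z; rewrite /= !in_itv/= ltrBlDr lerBrDr.
Qed.

(** Through [rV_cons] a translation splits into translations of the two factors, so uniqueness of
    the product measure gives the induction on the dimension. *)
Lemma leb_translate n (a : 'rV[R]_n) (A : set 'rV[R]_n) : measurable A ->
  leb R n ((fun x => x + a) @^-1` A) = leb R n A.
Proof.
elim: n => [|n IHn] in a A *.
  move=> mA; congr (leb R 0 _).
  by apply/seteqP; split => x /=; rewrite [a](_ : _ = 0) ?addr0//; apply/rowP; case.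
move=> mA; rewrite !leb_consE.
pose b := rV_uncons a.
pose f (p : measurableTypeR R * 'rV[R]_n) : measurableTypeR R * 'rV[R]_n :=
  (p.1 + b.1, p.2 + b.2).
have mf : measurable_fun setT f.
  apply: measurable_fun_pair.
    by apply: measurable_funD; [exact: measurable_fst|exact: measurable_cst].
  by apply: (measurableT_comp (measurable_addrV _)); exact: measurable_snd.
have fE p : rV_cons p + a = rV_cons (f p).
  rewrite -{1}(rV_unconsK a) -/b /rV_cons /f/=.
  by rewrite (add_row_mx _ _ b.1%:M b.2) raddfD.
have mA' := preimage_measurable (@measurable_rV_cons R n) mA.
rewrite (_ : _ @^-1` (_ @^-1` A) = f @^-1` (@rV_cons R n @^-1` A)); last first.
  by apply/seteqP; split => p /=; rewrite fE.
apply/esym.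
apply/esym.
have := @product_measure_unique _ _ _ _ _ (@lebesgue_measure R) (leb R n)
  (measure_function_pushforward__canonical__measure_function_Measure
    (lebesgue_measure \x leb R n)%E mf).
move=> /(_ _ (@rV_cons R n @^-1` A)) ->//.
move=> B C mB mC.
transitivity ((lebesgue_measure \x leb R n)%E (f @^-1` (B `*` C))) => //.
rewrite (_ : f @^-1` _ = ((fun x : R => x + b.1) @^-1` B) `*`
  ((fun x => x + b.2) @^-1` C)); last by apply/seteqP; split => -[].
rewrite product_measure1E//; first last.
- exact: preimage_measurable (measurable_addrV _) mC.
- apply: (@preimage_measurable _ _ (measurableTypeR R) (measurableTypeR R)) => //.
  by apply: measurable_funD; [exact: measurable_id|exact: measurable_cst].
by congr (_ * _)%E; [exact: lebesgue_measure_translate|exact: IHn].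
Qed.

End leb_basic.

(** * Changes of variables with an unspecified scaling factor *)

Section leb_transform.
Context (R : realType).
Local Open Scope ereal_scope.

Lemma indic_preimage (T U : Type) (f : T -> U) (A : set U) x :
  \1_(f @^-1` A) x = \1_A (f x) :> R.
Proof. by rewrite !indicE; congr (nat_of_bool _)%:R; apply/idP/idP; rewrite !inE. Qed.

(** The factor [c] stays abstract: in the trace inequality the same factor relates the volumes of
    the two simplices, and it cancels there. *)
Lemma ge0_integral_leb_transform m n (phi : 'rV[R]_m -> 'rV[R]_n)
    (c : {nonneg R}) (f : 'rV[R]_n -> \bar R) (nu : {measure set 'rV[R]_n -> \bar R})
    (mu : {measure set 'rV[R]_m -> \bar R}) :
  measurable_fun [set: 'rV[R]_m] phi ->
  (forall A, measurable A -> mu (phi @^-1` A) = c%:num%:E * nu A) ->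
  measurable_fun [set: 'rV[R]_n] f -> (forall x, 0 <= f x) ->
  \int[mu]_x f (phi x) = c%:num%:E * \int[nu]_x f x.
Proof.
move=> mphi phic mf f0.
rewrite -ge0_integral_mscale//.
have -> : \int[mu]_x f (phi x) = \int[pushforward mu phi]_x f x.
  by rewrite (ge0_integral_pushforward mphi)// => y _; exact: f0.
have := @eq_measure_integral _ _ R setT (mscale c nu)
  (measure_function_pushforward__canonical__measure_function_Measure mu mphi) f.
apply => A mA _; exact: phic.
Qed.

Lemma ge0_integral_translate n (a : 'rV[R]_n) (f : 'rV[R]_n -> \bar R) :
  measurable_fun [set: 'rV[R]_n] f -> (forall x, 0 <= f x) ->
  \int[leb R n]_x f (x + a)%R = \int[leb R n]_x f x.
Proof.
move=> mf f0.
rewrite (ge0_integral_leb_transform (phi := fun x => (x + a)%R)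
   (nu := leb R n) (c := 1%:nng%R))//=.
- by rewrite mul1e.
- exact: measurable_addrV.
- by move=> A mA; rewrite mul1e; exact: leb_translate.
Qed.

Lemma ge0_integral_lebS n (f : 'rV[R]_n.+1 -> \bar R) :
  measurable_fun [set: 'rV[R]_n.+1] f -> (forall x, 0 <= f x) ->
  \int[leb R n.+1]_x f x =
  \int[@lebesgue_measure R]_t \int[leb R n]_s f (rV_cons (t, s)).
Proof.
move=> mf f0.
transitivity (\int[pushforward (@lebesgue_measure R \x leb R n) (@rV_cons R n)]_x f x) => //.
have mc : measurable_fun [set: (measurableTypeR R * 'rV[R]_n)%type] (@rV_cons R n).
  exact: measurable_rV_cons.
rewrite (ge0_integral_pushforward mc)// preimage_setT fubini_tonelli1//.
  exact: (measurableT_comp mf).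
by move=> p; exact: f0.
Qed.

Lemma ge0_integral_lebS_swap n (f : 'rV[R]_n.+1 -> \bar R) :
  measurable_fun [set: 'rV[R]_n.+1] f -> (forall x, 0 <= f x) ->
  \int[leb R n.+1]_x f x =
  \int[leb R n]_s \int[@lebesgue_measure R]_t f (rV_cons (t, s)).
Proof.
move=> mf f0; rewrite ge0_integral_lebS//.
rewrite (@fubini_tonelli _ _ _ _ _ _ _
  (fun p : measurableTypeR R * 'rV[R]_n => f (rV_cons p)))//.
by apply: (measurableT_comp mf); exact: measurable_rV_cons.
Qed.

Lemma fubini_tonelli_leb m n (F : 'rV[R]_m -> 'rV[R]_n -> \bar R) :
  measurable_fun [set: 'rV[R]_m * 'rV[R]_n] (fun p => F p.1 p.2) ->
  (forall x y, 0 <= F x y) ->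
  \int[leb R m]_x \int[leb R n]_y F x y = \int[leb R n]_y \int[leb R m]_x F x y.
Proof.
move=> mF F0; exact: (@fubini_tonelli _ _ _ _ _ (leb R m) (leb R n)
  (fun p => F p.1 p.2) mF (fun p => F0 p.1 p.2)).
Qed.

(* The translations [x + yM^-1] and [y - xM] turn the double integral of
   1_A(xM) 1_B(y) into that of 1_A(y) 1_B(-xM). *)
Lemma leb_mulmx n (M : 'M[R]_n) (A B : set 'rV[R]_n) :
  M \in unitmx -> measurable A -> measurable B ->
  leb R n ((fun x => x *m M)%R @^-1` A) * leb R n B =
  leb R n A * leb R n ((fun x => - (x *m M))%R @^-1` B).
Proof.
move=> uM mA mB.
pose mT := measurable_mulrV (R := R) M.
have mN : measurable_fun setT (fun x : 'rV[R]_n => - (x *m M))%R.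
  rewrite (_ : (fun x => _) = fun x => x *m (- M))%R; first exact: measurable_mulrV.
  by apply/funext => x; rewrite mulmxN.
have mI C : measurable C -> measurable_fun setT (fun x : 'rV[R]_n => (\1_C x : R)%:E).
  by move=> mC; exact/measurable_EFinP/measurable_indic.
have lebE C : measurable C -> leb R n C = \int[leb R n]_x (\1_C x)%:E.
  by move=> mC; rewrite integral_indic// setIT.
have i0 C (x : 'rV[R]_n) : 0 <= (\1_C x : R)%:E by rewrite lee_fin.
have mfst C : measurable C ->
    measurable_fun [set: 'rV[R]_n * 'rV[R]_n] (fun p => (\1_C p.1 : R)%:E).
  by move=> mC; apply: (measurableT_comp (mI _ mC)); exact: measurable_fst.
have msnd C : measurable C ->
    measurable_fun [set: 'rV[R]_n * 'rV[R]_n] (fun p => (\1_C p.2 : R)%:E).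
  by move=> mC; apply: (measurableT_comp (mI _ mC)); exact: measurable_snd.
have mlin (a b : R) : measurable_fun [set: 'rV[R]_n * 'rV[R]_n]
    (fun p => a *: p.2 + b *: (p.1 *m M))%R.
  apply: measurable_fun_coordP => i.
  under eq_fun do rewrite !mxE.
  apply: measurable_funD; apply: measurable_funM => //.
    by apply: (measurableT_comp (measurable_coord i)); exact: measurable_snd.
  apply: measurable_sum => j; apply: measurable_funM => //.
  by apply: (measurableT_comp (measurable_coord j)); exact: measurable_fst.
have mC1 C (a b : R) : measurable C -> measurable_fun [set: 'rV[R]_n * 'rV[R]_n]
    (fun p => (\1_C (a *: p.2 + b *: (p.1 *m M))%R : R)%:E).
  by move=> mC; apply: (measurableT_comp (mI _ mC)); exact: mlin.
transitivity (\int[leb R n]_y \int[leb R n]_x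
    ((\1_A (y + x *m M)%R : R)%:E * (\1_B y)%:E)).
  rewrite [X in X * _]lebE; last exact: preimage_measurable mT mA.
  rewrite [X in _ * X]lebE// muleC -ge0_integralZr//=; last 2 first.
  - exact: mI.
  - by apply: integral_ge0 => x _; exact: i0.
  apply: eq_integral => y _.
  rewrite ge0_integralZr//=; first last.
  - by apply: (measurableT_comp (mI _ mA)) => //;
      rewrite (_ : (fun x => _) = (fun x => x + y)%R \o (fun x => x *m M)%R);
      [apply: (measurableT_comp (measurable_addrV y)); exact: mT
      |apply/funext => x /=; rewrite addrC].
  rewrite muleC; congr (_ * _).
  rewrite -(ge0_integral_translate (y *m invmx M)%R)//=.
    apply: eq_integral => x _.
    by rewrite indic_preimage mulmxDl mulmxKV// addrC.
  by apply: mI; exact: preimage_measurable mT mA.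
transitivity (\int[leb R n]_x \int[leb R n]_y
    ((\1_A y : R)%:E * (\1_B (y - x *m M)%R)%:E)).
  rewrite (fubini_tonelli_leb (F := fun y x =>
    (\1_A (y + x *m M)%R : R)%:E * (\1_B y : R)%:E)); last 2 first.
  - apply: emeasurable_funM; last exact: mfst.
    have := measurableT_comp (mC1 A 1%R 1%R mA) (@measurable_swap _ _ 'rV[R]_n 'rV[R]_n).
    by apply: eq_measurable_fun => -[x y] _ /=; rewrite !scale1r.
  - by move=> y x; rewrite mule_ge0.
  apply: eq_integral => x _.
  rewrite -(ge0_integral_translate (- (x *m M))%R)//=.
  - by apply: eq_integral => y _; rewrite subrK.
  - apply: emeasurable_funM; last exact: mI.
    by apply: (measurableT_comp (mI _ mA)); exact: measurable_addrV.
rewrite (fubini_tonelli_leb (F := fun x y =>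
    (\1_A y : R)%:E * (\1_B (y - x *m M)%R : R)%:E)); last 2 first.
- apply: emeasurable_funM; first exact: msnd.
  have := mC1 B 1%R (-1)%R mB.
  by apply: eq_measurable_fun => -[x y] _ /=; rewrite scale1r scaleN1r.
- by move=> x y; rewrite mule_ge0.
rewrite [X in _ = X * _]lebE// -ge0_integralZr//=; last exact: mI.
apply: eq_integral => y _.
rewrite ge0_integralZl//=; last first.
  apply: (measurableT_comp (mI _ mB)).
  rewrite (_ : (fun x => _) = (fun x => x + y)%R \o (fun x => - (x *m M))%R).
    by apply: (measurableT_comp (measurable_addrV y)); exact: mN.
  by apply/funext => x /=; rewrite addrC.
congr (_ * _); rewrite lebE; last exact: preimage_measurable mN mB.
rewrite -[RHS](ge0_integral_translate (- (y *m invmx M))%R)//=.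
  apply: eq_integral => x _.
  by rewrite indic_preimage mulmxBl mulmxKV// opprB.
by apply: mI; exact: preimage_measurable mN mB.
Qed.

End leb_transform.

(** * Null hyperplanes, measurability and positive measure of open sets *)

Section leb_sets.
Context (R : realType).
Implicit Types (n : nat).

Lemma rV_cons0 n (t : R) (s : 'rV[R]_n) : rV_cons (t, s) ord0 ord0 = t.
Proof. by have := rV_consK (t, s) => -[]. Qed.

Lemma rV_consS n (t : R) (s : 'rV[R]_n) j :
  rV_cons (t, s) ord0 (lift ord0 j) = s ord0 j.
Proof. by have := rV_consK (t, s) => -[] _ /rowP/(_ j); rewrite mxE. Qed.

Definition box n (a b : R) : set 'rV[R]_n := [set x | forall i, a <= x ord0 i <= b].

Lemma box_cons n a b : @rV_cons R n @^-1` box a b = `[a, b]%classic `*` box a b.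
Proof.
apply/seteqP; split => -[t s]; rewrite /box /= in_itv/=.
  move=> H; split; first by have := H ord0; rewrite rV_cons0.
  by move=> i; have := H (lift ord0 i); rewrite rV_consS.
move=> [t0 s0] i; case: (unliftP ord0 i) => [j|] ->; first by rewrite rV_consS.
by rewrite rV_cons0.
Qed.

Lemma measurable_forall_coord n (B : 'I_n -> set R) :
  (forall i, measurable (B i)) ->
  measurable [set x : 'rV[R]_n | forall i, B i (x ord0 i)].
Proof.
move=> mB; rewrite (_ : [set x | _] =
    \bigcap_(i in [set: 'I_n]) ((fun x : 'rV[R]_n => x ord0 i) @^-1` B i)).
  apply: fin_bigcap_measurable => // i _.
  by apply: preimage_measurable => //; exact: measurable_coord.
by apply/seteqP; split => x /= H i; [move=> _; exact: H|exact: (H i I)].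
Qed.

Lemma measurable_box n a b : measurable (@box n a b).
Proof.
have -> : @box n a b = [set x : 'rV[R]_n | forall i, `[a, b]%classic (x ord0 i)].
  by apply/seteqP; split => x H i; have := H i; rewrite /= in_itv.
by apply: (measurable_forall_coord (B := fun=> `[a, b]%classic)) => i; exact: measurable_itv.
Qed.

Lemma leb_box n a b : a <= b -> leb R n (box a b) = ((b - a) ^+ n)%:E.
Proof.
move=> ab; elim: n => [|n IHn].
  by rewrite /= diracE mem_set// => -[].
have L : lebesgue_measure (`[a, b]%classic : set R) = (b - a)%:E.
  rewrite lebesgue_measure_itv/= lte_fin; case: ltP => //.
  by move=> ba; rewrite (@le_anti _ _ a b) ?ab// subrr.
rewrite leb_consE box_cons product_measure1E//; last exact: measurable_box.
rewrite exprS EFinM -IHn; congr (_ * _)%E.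
exact: L.
Qed.

Definition coord_bounded n (A : set 'rV[R]_n) :=
  exists M : R, forall x, A x -> forall i, `|x ord0 i| <= M.

Lemma leb_bounded_lty n (A : set 'rV[R]_n) : measurable A -> coord_bounded A ->
  (leb R n A < +oo)%E.
Proof.
move=> mA [M AM]; pose N := Num.max M 0.
apply: (@le_lt_trans _ _ (leb R n (box (- N) N))); last first.
  by rewrite leb_box ?ltry// ge0_cp// le_max lexx orbT.
apply: le_measure; rewrite ?inE//; first exact: measurable_box.
by move=> x Ax i; rewrite -ler_norml (le_trans (AM x Ax i))// le_max lexx.
Qed.

Lemma measurable_linear_form n (w : 'cV[R]_n) :
  measurable_fun [set: 'rV[R]_n] (fun x : 'rV[R]_n => (x *m w) ord0 ord0).
Proof. exact: (measurableT_comp (measurable_coord _) (measurable_mulrV w)). Qed.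

Lemma measurable_hyperplane n (w : 'cV[R]_n) (b : R) :
  measurable [set x : 'rV[R]_n | (x *m w) ord0 ord0 = b].
Proof.
exact: (preimage_measurable (measurable_linear_form w) (measurable_set1 b)).
Qed.

(** Fubini in the first coordinate: if its coefficient vanishes, the slices are hyperplanes one
    dimension lower; otherwise each line in that direction meets the set in the single point [t0].
    The alternative [b != 0] covers the empty set given by [w = 0], the only case left in dimension
    0. *)
Lemma leb_hyperplane n (w : 'cV[R]_n) (b : R) : (w != 0) || (b != 0) ->
  leb R n [set x | (x *m w) ord0 ord0 = b] = 0%E.
Proof.
elim: n => [|n IHn] in w b *.
  rewrite (_ : w = 0) ?eqxx/=; last by apply/colP; case.
  move=> b0; rewrite (_ : [set _ | _] = set0) ?measure0//.
  by apply/seteqP; split => x //=; rewrite mulmx0 mxE => /esym/eqP; rewrite (negbTE b0).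
move=> wb; set H := [set x | _].
pose w' : 'cV[R]_n := \col_j w (lift ord0 j) ord0.
have mH : measurable H by exact: measurable_hyperplane.
have mI : measurable_fun setT (fun x : 'rV[R]_n.+1 => (\1_H x : R)%:E).
  exact/measurable_EFinP/measurable_indic.
have I0 (x : 'rV[R]_n.+1) : (0 <= (\1_H x : R)%:E)%E by rewrite lee_fin.
have HE t s : H (rV_cons (t, s)) = (t * w ord0 ord0 + (s *m w') ord0 ord0 = b).
  rewrite /H/=; congr (_ = _); rewrite mxE big_ord_recl rV_cons0; congr (_ + _).
  by rewrite mxE; apply: eq_bigr => j _; rewrite rV_consS mxE.
have lebE : leb R n.+1 H = (\int[leb R n.+1]_x (\1_H x)%:E)%E.
  by rewrite integral_indic// setIT.
have [w0|w0] := eqVneq (w ord0 ord0) 0.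
  rewrite lebE ge0_integral_lebS//; apply: integral0_eq => t _.
  pose H' := [set s : 'rV[R]_n | (s *m w') ord0 ord0 = b].
  rewrite (eq_integral (fun s => (\1_H' s)%:E)); last first.
    move=> s _; rewrite !indicE; congr (nat_of_bool _)%:R%:E.
    by apply/idP/idP; rewrite !inE HE /H'/= w0 mulr0 add0r.
  rewrite integral_indic//; last exact: measurable_hyperplane.
  rewrite setIT; apply: IHn; case/orP : wb => [wn0|->]; last by rewrite orbT.
  apply/orP; left; apply: contra wn0 => /eqP w'0; apply/eqP/colP => i.
  rewrite mxE; case: (unliftP ord0 i) => [j|] -> //.
  by have /colP/(_ j) := w'0; rewrite !mxE.
rewrite lebE ge0_integral_lebS_swap//; apply: integral0_eq => s _.
pose t0 := (b - (s *m w') ord0 ord0) / w ord0 ord0.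
transitivity (\int[@lebesgue_measure R]_t (\1_[set t0] t : R)%:E)%E.
  apply: eq_integral => t _; rewrite !indicE; congr (nat_of_bool _)%:R%:E.
  apply/idP/idP; rewrite !inE HE /=.
    by rewrite /t0 => <-; rewrite addrK mulfK.
  by move=> ->; rewrite /t0 mulfVK// subrK.
by rewrite integral_indic// setIT; exact: lebesgue_measure_set1.
Qed.

Lemma leb_null_hyperplanes n (I : finType) (w : I -> 'cV[R]_n) (b : I -> R) :
  (forall i, (w i != 0) || (b i != 0)) ->
  (leb R n).-negligible [set x | exists i, (x *m w i) ord0 ord0 = b i].
Proof.
move=> wb; suff H (s : seq I) : (leb R n).-negligible
    [set x | exists2 i, i \in s & (x *m w i) ord0 ord0 = b i].
  apply: negligibleS (H (enum I)) => x [i xi]; exists i => //.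
  by rewrite mem_enum.
elim: s => [|i s IHs].
  by apply: negligibleS (negligible_set0 _) => x [].
apply: negligibleS (negligibleU (A := [set x | (x *m w i) ord0 ord0 = b i]) _ IHs).
  move=> x [k]; rewrite inE => /predU1P[->|ks xk]; first by left.
  by right; exists k.
by apply/negligibleP; [exact: measurable_hyperplane|exact: leb_hyperplane].
Qed.

Lemma rV_ballP n (x y : 'rV[R]_n) (e : R) : 0 < e ->
  ball x e y <-> forall i, `|x ord0 i - y ord0 i| < e.
Proof.
move=> e0; split=> [[_ H] i|H]; first exact: H.
by split=> // i j; rewrite ord1; exact: H.
Qed.

Lemma rV_nbhsP n (x : 'rV[R]_n) (A : set 'rV[R]_n) : nbhs x A <->
  exists2 e : R, 0 < e & forall y : 'rV[R]_n, (forall i, `|x ord0 i - y ord0 i| < e) -> A y.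
Proof.
split.
  move/nbhs_ballP => [e /= e0 H]; exists e => // y xy; apply: H.
  exact/(rV_ballP _ _ e0).
move=> [e e0 H]; apply/nbhs_ballP; exists e => //= y /(rV_ballP _ _ e0).
exact: H.
Qed.

(** The sigma-algebra is generated by the coordinates, not by the topology; an open set is recovered
    as the countable union of the cubes with rational centre and radius that it contains. *)
Lemma open_measurable_rV n (A : set 'rV[R]_n) : open A -> measurable A.
Proof.
move=> oA.
pose B (p : 'rV[rat]_n * rat) := [set x : 'rV[R]_n |
  forall i, ball (ratr (p.1 ord0 i) : R) (ratr p.2) (x ord0 i)].
have -> : A = \bigcup_(p in [set p | B p `<=` A]) B p.
  apply/seteqP; split => [x Ax|x [p /= pA Bx]]; last exact: pA.
  have /rV_nbhsP[e e0 xe] : nbhs x A by apply: open_nbhs_nbhs.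
  (* With a radius below [e / 2], a cube that contains [x] stays within distance [e] of it. *)
  have [r] := rat_in_itvoo (divr_gt0 e0 (ltr0n _ 2)).
  rewrite in_itv/= => /andP[r0 re].
  have H i : {q : rat | `|ratr q - x ord0 i| < ratr r}.
    have /rat_in_itvoo/cid[q] : x ord0 i - ratr r < x ord0 i + ratr r.
      by rewrite ltrBlDr -addrA ltrDl addr_gt0.
    rewrite in_itv/= => qx; exists q.
    by rewrite ltr_distl.
  exists (\row_i (projT1 (H i)), r) => /=.
    move=> y By; apply: xe => i; have := By i; rewrite /= mxE.
    rewrite -ball_normE/= => qy.
    have qx := projT2 (H i).
    rewrite (splitr e).
    rewrite (_ : _ - _ = - (ratr (projT1 (H i)) - x ord0 i) + (ratr (projT1 (H i)) - y ord0 i)).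
      rewrite (le_lt_trans (ler_normD _ _))// normrN ltrD//.
        exact: (lt_trans qx).
      exact: (lt_trans qy).
    by rewrite opprB addrA subrK.
  by move=> i /=; rewrite mxE -ball_normE/=; exact: (projT2 (H i)).
rewrite (_ : \bigcup_(p in _) B p = \bigcup_k
    (oapp B set0 (pickle_inv k) `&` [set x | oapp B set0 (pickle_inv k) `<=` A])).
  apply: bigcup_measurable => k _.
  have [kA|kA] := pselect (oapp B set0 (pickle_inv k) `<=` A).
    rewrite (_ : _ `&` _ = oapp B set0 (pickle_inv k)); last first.
      by apply/seteqP; split => x // [].
    case: (pickle_inv k) => [p|]//=.
    apply: (measurable_forall_coord (B := fun i => ball (ratr (p.1 ord0 i) : R) (ratr p.2))).
    by move=> i; exact: measurable_ball.
  by rewrite (_ : _ `&` _ = set0)//; apply/seteqP; split => x // [].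
apply/seteqP; split => [x [p pA Bx]|x [k _ []]].
  by exists (pickle p) => //; rewrite pickleK_inv.
by case: (pickle_inv k) => [p|]//= Bx pA; exists p.
Qed.

Lemma leb_open_gt0 n (A : set 'rV[R]_n) : open A -> A !=set0 -> (0 < leb R n A)%E.
Proof.
move=> oA [c Ac].
have /rV_nbhsP[e e0 ce] : nbhs c A by apply: open_nbhs_nbhs.
have h0 : 0 < e / 2 by exact: divr_gt0.
pose B := (fun x => x - c) @^-1` @box n (- (e / 2)) (e / 2).
have mB : measurable B.
  by apply: preimage_measurable; [exact: measurable_addrV|exact: measurable_box].
apply: (@lt_le_trans _ _ (leb R n B)).
  rewrite leb_translate; last exact: measurable_box.
  by rewrite leb_box ?ge0_cp ?(ltW h0)// opprK lte_fin exprn_gt0// addr_gt0.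
apply: le_measure; rewrite ?inE//; first exact: open_measurable_rV.
move=> x Bx; apply: ce => i; have := Bx i; rewrite !mxE -ler_norml distrC.
by move=> /le_lt_trans; apply; rewrite ltr_pdivrMr// ltr_pMr// ltr1n.
Qed.

End leb_sets.

(** * Trace inequality for polynomials in one variable *)

(** Common source of the Cauchy-Schwarz inequalities below, for polynomials, square integrable
    functions, tensors and finite sums. For [c > 0] the minimizer [t = - b / c] is inserted; for
    [c = 0] a nonzero slope [b] would produce the negative value [- a - 2]. *)
Lemma quadratic_ge0_discr (R : realType) (a b c : R) : 0 <= a -> 0 <= c ->
  (forall t, 0 <= a + t * b *+ 2 + t ^+ 2 * c) -> b ^+ 2 <= a * c.
Proof.
move=> a0; rewrite le_eqVlt => /predU1P[<-|c0] H.
  rewrite mulr0; have [->|b0] := eqVneq b 0; first by rewrite expr0n.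
  by have := H (- (a + 1) / b); rewrite mulr0 addr0 mulfVK//; lra.
rewrite -subr_ge0; have := mulr_ge0 (ltW c0) (H (- b / c)).
by congr (_ <= _); field; rewrite gt_eqF.
Qed.

Section alternating_sums.
Context (R : realType).

Lemma size_poly_shift_sub (q : {poly R}) n : (size q <= n.+1)%N ->
  (size (q - (q \Po ('X + 1%:P)))%R <= n)%N.
Proof.
move=> qn; have s2 : size ('X + 1%:P : {poly R}) = 2%N by rewrite size_XaddC.
have [s0|s0] := posnP (size q).
  move: (s0) => /eqP; rewrite size_poly_eq0 => /eqP q0.
  by rewrite q0 sub0r size_polyN size_comp_poly2 ?size_poly0.
apply/leq_sizeP => j nj; rewrite coefB.
have [jq|jq] := leqP (size q) j.
  by rewrite !nth_default ?subrr// size_comp_poly2.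
have jE : j = (size q).-1 by apply/eqP; rewrite eqn_leq -ltnS prednK// jq/= (leq_trans _ nj)// -ltnS prednK.
have := @lead_coef_comp _ q ('X + 1%:P).
rewrite s2 => /(_ isT); rewrite lead_coefXaddC expr1n mulr1 !lead_coefE.
by rewrite size_comp_poly2// -jE => ->; rewrite subrr.
Qed.

(** The sum is, up to sign, the finite difference of order [p] of [q] at 0. Pascal's rule turns the
    sum of order [p + 1] for [q] into the sum of order [p] for [q - q(X + 1)], whose degree is
    smaller. *)
Lemma alternating_binomial_poly p (q : {poly R}) : (size q <= p)%N ->
  \sum_(j < p.+1) (-1) ^+ j * 'C(p, j)%:R * q.[j%:R] = 0.
Proof.
elim: p => [|p IHp] in q *.
  by rewrite leqn0 size_poly_eq0 => /eqP->; rewrite big1// => i _; rewrite horner0 mulr0.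
move=> /size_poly_shift_sub/IHp.
under eq_bigr do rewrite hornerD hornerN horner_comp hornerD hornerX hornerC mulrBr.
rewrite sumrB => /eqP; rewrite subr_eq0 => /eqP H.
rewrite big_ord_recl bin0 !expr0 !mul1r.
under eq_bigr => i _ do rewrite lift0 binS natrD mulrDr mulrDl.
rewrite big_split/= addrA [X in _ + X + _]big_ord_recr/= bin_small//= mulr0 mul0r addr0.
rewrite big_ord_recl bin0 !expr0 !mul1r in H.
rewrite H -big_split/= big1// => i _.
by rewrite exprS mulN1r !mulNr -natr1 subrr.
Qed.

(** At an integer [j] this is [(j + p + 1)! / (j + 1)!], the factor that differentiating
    [t^(p + 1 + j)] [p] times produces in the kernel below. *)
Definition rising p (x : R) : R := \prod_(k < p) (x + k.+2%:R).

(** These are the moments of the evaluation kernel. For [1 <= i <= p] the denominator [i + j + 1] is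
    one of the factors of [rising p j], so the quotient is a polynomial of degree [p - 1] in [j] and
    its difference of order [p] vanishes. For [i = 0] the denominator [j + 1] is not a factor, and a
    remainder survives. *)
Lemma alternating_rising_div p i : (i <= p)%N ->
  \sum_(j < p.+1) (-1) ^+ j * 'C(p, j)%:R * rising p j%:R / (i + j).+1%:R =
  if i == 0%N then p`!%:R / p.+1%:R else 0.
Proof.
case: i => [|i] ip /=; last first.
  pose q : {poly R} := \prod_(k < p | k != Ordinal ip) ('X + k.+2%:R%:P).
  rewrite -[RHS](@alternating_binomial_poly p q); last first.
    rewrite /q (leq_trans (size_poly_prod_leq _ _))//.
    rewrite (eq_bigr (fun=> 2%N)) => [|k _]; last by rewrite size_XaddC.
    have c1 : (#|(fun k : 'I_p => k != Ordinal ip)| + 1 = p)%N.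
      by have := cardC1 (Ordinal ip); rewrite card_ord => ->; rewrite addn1 prednK// (leq_ltn_trans _ ip).
    by rewrite sum_nat_const; move: c1; move: #|_| => m; lia.
  apply: eq_bigr => j _; rewrite -mulrA; congr (_ * _).
  rewrite /rising (bigD1 (Ordinal ip))//= mulrC mulrA -natrD.
  rewrite (_ : (i.+1 + j).+1 = (j + i.+2)%N); last by lia.
  rewrite mulVf ?pnatr_eq0 ?addnS// mul1r horner_prod.
  by apply: eq_bigr => k _; rewrite !hornerE.
pose q : {poly R} := \prod_(k < p) ('X + k.+2%:R%:P).
have qE x : q.[x] = rising p x by rewrite horner_prod; apply: eq_bigr => k _; rewrite !hornerE.
(* Division by [X + 1]: the remainder is the value at -1, namely [p!], and the quotient [g] is
   annihilated by the difference of order [p]. *)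
have /factor_theorem[g qg] : root (q - q.[-1]%:P) (-1) by rewrite rootE !hornerE subrr.
have qm1 : q.[-1] = p`!%:R.
  rewrite qE /rising fact_prod big_add1/= big_mkord natr_prod.
  by apply: eq_bigr => k _; rewrite -natr1 addrC addrK.
have sq : size q = p.+1.
  rewrite /q (eq_bigr (fun k : 'I_p => 'X - (- k.+2%:R)%:P)); last first.
    by move=> k _; rewrite polyCN opprK.
  by rewrite size_prod_XsubC -(sum1_size (index_enum _)) sum_nat_const card_ord muln1.
have sg : (size g <= p)%N.
  have [->|g0] := eqVneq g 0; first by rewrite size_poly0.
  have : (size (g * ('X - (-1)%:P))%R <= p.+1)%N.
    rewrite -qg (leq_trans (size_polyD _ _))// size_polyN geq_max sq leqnn/=.
    by rewrite (leq_trans (size_polyC_leq1 _)).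
  by rewrite size_Mmonic ?monicXsubC// size_XsubC addn2.
have rE j : rising p j%:R / j.+1%:R = p`!%:R / j.+1%:R + g.[j%:R] :> R.
  have := congr1 (fun h => h.[j%:R]) qg.
  rewrite hornerD hornerN hornerC hornerM hornerXsubC qm1 qE opprK natr1.
  move=> /(canRL (subrK _)) ->; rewrite mulrDl mulfK ?pnatr_eq0// addrC//.
under eq_bigr do rewrite add0n -mulrA rE mulrDr.
rewrite big_split/= alternating_binomial_poly// addr0.
apply: (@mulIf _ p.+1%:R); first by rewrite pnatr_eq0.
rewrite mulfVK ?pnatr_eq0// mulr_suml.
(* The absorption identity for binomials replaces [1 / (j + 1)] by a binomial of order [p + 1]; what
   remains is the vanishing alternating sum of order [p + 1] without its first term, hence 1. *)
rewrite (eq_bigr (fun j : 'I_p.+1 => p`!%:R * ((-1) ^+ j * 'C(p.+1, j.+1)%:R))); last first.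
  move=> j _; have H : 'C(p, j)%:R * p.+1%:R = 'C(p.+1, j.+1)%:R * j.+1%:R :> R.
    by rewrite -!natrM mulnC mul_bin_diag mulnC.
  have -> : 'C(p.+1, j.+1)%:R = 'C(p, j)%:R * p.+1%:R / j.+1%:R :> R.
    by rewrite H mulfK ?pnatr_eq0.
  by set a := j.+1%:R^-1; set b := p.+1%:R; ring.
rewrite -mulr_sumr.
have := @alternating_binomial_poly p.+1 1.
rewrite size_poly1 => /(_ isT); under eq_bigr do rewrite hornerE mulr1.
rewrite big_ord_recl bin0 expr0 mul1r.
under eq_bigr do rewrite lift0 exprS mulN1r mulNr.
by rewrite sumrN => /eqP; rewrite subr_eq0 => /eqP <-; rewrite mulr1.
Qed.

End alternating_sums.

Section poly_trace.
Context (R : realType).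
Notation mu := (@lebesgue_measure R).

Lemma horner_continuous (r : {poly R}) : continuous (fun t => r.[t]).
Proof.
elim/poly_ind: r => [|r c IHr] x.
  by under eq_fun do rewrite horner0; exact: cvg_cst.
under eq_fun do rewrite hornerMXaddC.
by apply: cvgD; [apply: cvgM; [exact: IHr|exact: cvg_id]|exact: cvg_cst].
Qed.

Variable d : R.
Hypothesis d0 : 0 < d.

Lemma integrable_horner (r : {poly R}) :
  mu.-integrable `[0, d] (EFin \o (fun t => r.[t])).
Proof.
apply: continuous_compact_integrable; first exact: segment_compact.
by apply: continuous_subspaceT; exact: horner_continuous.
Qed.

Definition poly_int (r : {poly R}) : R := \int[mu]_(t in `[0, d]) r.[t].

Lemma poly_intD (r s : {poly R}) : poly_int (r + s) = poly_int r + poly_int s.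
Proof.
rewrite /poly_int -RintegralD//; try exact: integrable_horner.
by apply: eq_Rintegral => t _; rewrite hornerD.
Qed.

Lemma poly_intZ c (r : {poly R}) : poly_int (c *: r) = c * poly_int r.
Proof.
rewrite /poly_int -RintegralZl//; last exact: integrable_horner.
by apply: eq_Rintegral => t _; rewrite hornerZ.
Qed.

Lemma poly_int_sum (I : Type) (s : seq I) (F : I -> {poly R}) :
  poly_int (\sum_(i <- s) F i) = \sum_(i <- s) poly_int (F i).
Proof.
elim: s => [|i s IHs]; last by rewrite !big_cons poly_intD IHs.
by rewrite !big_nil -(scale0r 0) poly_intZ mul0r.
Qed.

Lemma poly_int_Xn n : poly_int 'X^n = d ^+ n.+1 / n.+1%:R.
Proof.
rewrite /poly_int /Rintegral.
under eq_integral do rewrite hornerXn.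
rewrite (@continuous_FTC2 _ (fun t => t ^+ n) (fun t => t ^+ n.+1 / n.+1%:R))//=.
- by rewrite expr0n mul0r subr0.
- by apply: continuous_subspaceT; exact: exprn_continuous.
- split.
  + by move=> x _; apply: derivableM => //; exact: exprn_derivable.
  + apply: cvg_at_right_filter; apply: cvgM; last exact: cvg_cst.
    exact: exprn_continuous.
  + apply: cvg_at_left_filter; apply: cvgM; last exact: cvg_cst.
    exact: exprn_continuous.
- move=> x _; rewrite derive1Mr; last exact: exprn_derivable.
  by rewrite exp_derive1/= /GRing.scale/= mulrAC divff ?pnatr_eq0// mul1r.
Qed.

Lemma poly_int_ge0 (r : {poly R}) : 0 <= poly_int (r ^+ 2).
Proof. by apply: Rintegral_ge0 => t _; rewrite horner_exp sqr_ge0. Qed.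

Lemma poly_int_CauchySchwarz (r s : {poly R}) :
  poly_int (r * s) ^+ 2 <= poly_int (r ^+ 2) * poly_int (s ^+ 2).
Proof.
apply: quadratic_ge0_discr; try exact: poly_int_ge0.
move=> c; suff <- : poly_int ((r + c *: s) ^+ 2) = poly_int (r ^+ 2) +
  c * poly_int (r * s) *+ 2 + c ^+ 2 * poly_int (s ^+ 2) by exact: poly_int_ge0.
by rewrite sqrrD exprZn -scalerAr mulr2n !poly_intD !poly_intZ; ring.
Qed.

(* The kernel representing evaluation at 0 on polynomials of degree at most p,
   up to a factor: it is proportional to t^-1 D^p[t^(p+1) (d - t)^p]. *)
Definition eval_kernel p : {poly R} :=
  \sum_(j < p.+1) ((-1) ^+ j * 'C(p, j)%:R * rising p (j%:R : R) / d ^+ j) *: 'X^j.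

(** Integration against [X^i] gives [d^(i+1)] times the moment of index [i]; only the constant
    coefficient of [r] survives. *)
Lemma eval_kernelP p (r : {poly R}) : (size r <= p.+1)%N ->
  poly_int (eval_kernel p * r) = d * (p`!%:R / p.+1%:R) * r.[0].
Proof.
move=> sr; rewrite -{1}(coefK r) poly_def mulr_sumr poly_int_sum.
rewrite (eq_bigr (fun i : 'I_(size r) => r`_i * d ^+ i.+1 *
   (if val i == 0%N then p`!%:R / p.+1%:R else 0))); last first.
  move=> i _; rewrite -scalerAr poly_intZ -mulrA; congr (_ * _).
  rewrite -(@alternating_rising_div R p); last by rewrite -ltnS; exact: leq_trans (ltn_ord i) sr.
  rewrite mulr_suml poly_int_sum mulr_sumr; apply: eq_bigr => j _.
  rewrite -scalerAl poly_intZ -exprD poly_int_Xn addnC.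
  rewrite -addSn exprD /=; set a := _ * rising _ _.
  by field; rewrite expf_neq0 ?gt_eqF//= -natr1 gt_eqF// addr_gt0// ltr0n.
rewrite horner_coef0.
case E : (size r) => [|s]; first by rewrite big_ord0 nth_default ?E// mulr0.
rewrite big_ord_recl big1/= ?addr0 ?expr1 => [|i _]; last by rewrite mulr0.
by rewrite /=; move: (_ / _) => c; ring.
Qed.

(** Let [c = d p! / (p + 1)] and let [K] be the kernel. Cauchy-Schwarz for [K] and [r], with the
    reproducing property used for both [r] and [K] itself, gives [c^2 r(0)^2 <= c K(0)] times the
    integral of [r^2]. Since [K(0) = (p + 1)!], the ratio [K(0) / c] is [(p + 1)^2 / d]. *)
Lemma poly_trace_ineq p (r : {poly R}) : (size r <= p.+1)%N ->
  r.[0] ^+ 2 <= p.+1%:R ^+ 2 / d * poly_int (r ^+ 2).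
Proof.
move=> sr.
have sK : (size (eval_kernel p) <= p.+1)%N.
  rewrite /eval_kernel (leq_trans (size_sum _ _ _))//; apply/bigmax_leqP => j _.
  by rewrite (leq_trans (size_scale_leq _ _))// size_polyXn.
have := poly_int_CauchySchwarz (eval_kernel p) r.
have := eval_kernelP sK; rewrite -expr2 => ->.
rewrite eval_kernelP//.
have -> : (eval_kernel p).[0] = p.+1`!%:R.
  rewrite horner_coef0 /eval_kernel big_ord_recl coefD coefZ coefXn/= coef_sum big1.
    rewrite bin0 !expr0 divr1 !mul1r mulr1 addr0 /rising.
    rewrite fact_prod big_add1/= big_mkord natr_prod big_ord_recl mul1r.
    by apply: eq_bigr => k _; rewrite add0r.
  by move=> i _; rewrite coefZ coefXn mulr0.
rewrite factS natrM; set I := poly_int _.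
set N := p`!%:R / p.+1%:R; have N0 : 0 < N by rewrite divr_gt0 ?ltr0n ?fact_gt0.
have -> : p.+1%:R * p`!%:R = p.+1%:R ^+ 2 * N.
  by rewrite /N expr2 -mulrA; congr (_ * _); rewrite mulrC mulfVK// pnatr_eq0.
move=> CS; rewrite -(ler_pM2l (exprn_gt0 2 (mulr_gt0 d0 N0))) -exprMn (le_trans CS)//.
rewrite le_eqVlt; apply/orP; left; apply/eqP; field.
by rewrite gt_eqF.
Qed.

End poly_trace.

(** * Trace inequality on simplices *)

Section reference_trace.
Context (R : realType).
Implicit Types n : nat.

(** Degree is measured along lines because this notion is preserved by affine maps and is all that
    the inequality in one variable sees. *)
Definition line_poly n d (G : 'rV[R]_n -> R) := forall x w : 'rV[R]_n,
  exists2 r : {poly R}, (size r <= d.+1)%N & forall t, G (x + t *: w) = r.[t].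

Definition oref_simplex n : set 'rV[R]_n :=
  [set s | (forall i, 0 < s ord0 i) /\ \sum_i s ord0 i < 1].

Lemma sum_coordE n (s : 'rV[R]_n) :
  \sum_i s ord0 i = (s *m (const_mx 1 : 'cV_n)) ord0 ord0.
Proof. by rewrite mxE; apply: eq_bigr => i _; rewrite mxE mulr1. Qed.

Lemma measurable_ref_simplex n : measurable (@ref_simplex R n).
Proof.
rewrite (_ : @ref_simplex R n = [set s : 'rV[R]_n | forall i, `[0, +oo[%classic (s ord0 i)] `&`
  ((fun s : 'rV[R]_n => (s *m (const_mx 1 : 'cV_n)) ord0 ord0) @^-1` `]-oo, 1])).
  apply: measurableI.
    by apply: (measurable_forall_coord (B := fun=> `[0, +oo[%classic)).
  by apply: preimage_measurable => //; exact: measurable_linear_form.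
apply/seteqP; split => s; rewrite /ref_simplex /preimage /= in_itv/= -sum_coordE.
  by move=> [s0 s1]; split => // i; rewrite in_itv/= s0.
by move=> [s0 s1]; split => // i; have := s0 i; rewrite in_itv/= andbT.
Qed.

Lemma measurable_oref_simplex n : measurable (@oref_simplex n).
Proof.
rewrite (_ : @oref_simplex n = [set s : 'rV[R]_n | forall i, `]0, +oo[%classic (s ord0 i)] `&`
  ((fun s : 'rV[R]_n => (s *m (const_mx 1 : 'cV_n)) ord0 ord0) @^-1` `]-oo, 1[)).
  apply: measurableI.
    by apply: (measurable_forall_coord (B := fun=> `]0, +oo[%classic)).
  by apply: preimage_measurable => //; exact: measurable_linear_form.
apply/seteqP; split => s; rewrite /oref_simplex /preimage /= in_itv/= -sum_coordE.
  by move=> [s0 s1]; split => // i; rewrite in_itv/= s0.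
by move=> [s0 s1]; split => // i; have := s0 i; rewrite in_itv/= andbT.
Qed.

Lemma ref_simplex_bounded n : coord_bounded (@ref_simplex R n).
Proof.
exists 1 => s [s0 s1] i; rewrite ger0_norm// (le_trans _ s1)//.
by rewrite (bigD1 i)//= lerDl sumr_ge0.
Qed.

Lemma negligible_ref_boundary n :
  (leb R n).-negligible (@ref_simplex R n `\` @oref_simplex n).
Proof.
pose w (o : option 'I_n) : 'cV[R]_n :=
  oapp (fun i => delta_mx i ord0) (const_mx 1) o.
pose b (o : option 'I_n) : R := oapp (fun=> 0) 1 o.
apply: negligibleS (leb_null_hyperplanes (w := w) (b := b) _); last first.
  move=> [i|] /=; last by rewrite oner_eq0 orbT.
  by apply/orP; left; apply/eqP => /colP/(_ i)/eqP; rewrite !mxE !eqxx/= oner_eq0.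
move=> s [[s0 s1] ns]; have [/forallP sp|/forallPn[i]] := boolP [forall i, 0 < s ord0 i].
  exists None; rewrite /= -sum_coordE; apply/eqP; rewrite eq_le s1/= leNgt.
  by apply/negP => s1'; apply: ns.
rewrite -leNgt => si; exists (Some i); rewrite /= mxE (bigD1 i)//= big1; last first.
  by move=> j ji; rewrite mxE (negbTE ji) mulr0.
by rewrite mxE !eqxx mulr1 addr0; apply/eqP; rewrite eq_le si s0.
Qed.

(** [Some j] stands for the vertex [e_j] of the base and [None] for the origin. The segment from
    [(0, s)] in direction [(1, - ref_dir o)] is parallel to the edge from vertex [o] to the apex:
    along it only the barycentric coordinate of [o] decreases, at unit speed. *)
Definition ref_dir n (o : option 'I_n) : 'rV[R]_n := oapp (fun j => delta_mx ord0 j) 0 o.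
Definition ref_bary n (o : option 'I_n) (s : 'rV[R]_n) : R :=
  oapp (fun j => s ord0 j) (1 - \sum_i s ord0 i) o.
Definition ref_piece n (o : option 'I_n) : set 'rV[R]_n :=
  @oref_simplex n `&` [set s | n.+1%:R^-1 <= ref_bary o s].

Lemma measurable_ref_bary n (o : option 'I_n) :
  measurable_fun [set: 'rV[R]_n] (ref_bary o).
Proof.
case: o => [j|]; first exact: measurable_coord.
apply: measurable_funB => //; apply: measurable_sum => i.
exact: measurable_coord.
Qed.

Lemma measurable_ref_piece n o : measurable (@ref_piece n o).
Proof.
apply: measurableI; first exact: measurable_oref_simplex.
rewrite (_ : [set s | _] = ref_bary o @^-1` `[n.+1%:R^-1, +oo[).
  by apply: preimage_measurable => //; exact: measurable_ref_bary.
by apply/seteqP; split => s; rewrite /preimage /= in_itv/= andbT.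
Qed.

(** The [n + 1] barycentric coordinates sum to 1, so they cannot all be below [1 / (n + 1)]. *)
Lemma ref_piece_cover n : @oref_simplex n `<=` \bigcup_(o in [set: option 'I_n]) ref_piece o.
Proof.
move=> s os; apply: contrapT => H.
have lt o : ref_bary o s < n.+1%:R^-1.
  by rewrite ltNge; apply/negP => le; apply: H; exists o.
have : \sum_(i < n) s ord0 i <= \sum_(i < n) n.+1%:R^-1.
  by apply: ler_sum => i _; have /ltW := lt (Some i).
rewrite sumr_const card_ord -(mulr_natr (n.+1%:R^-1) n).
have := lt None; rewrite /=.
have : n.+1%:R^-1 * n%:R + n.+1%:R^-1 = 1 :> R.
  by rewrite -[X in _ + X]mulr1 -mulrDr natr1 mulVf ?pnatr_eq0.
move: (\sum_(i < n) _) (_^-1) n%:R => S c m; lra.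
Qed.

Lemma ref_piece_inside n o (s : 'rV[R]_n) t : ref_piece o s ->
  0 < t < n.+1%:R^-1 -> oref_simplex (rV_cons (t, s - t *: ref_dir o)).
Proof.
move=> [[s0 s1] os] /andP[t0 td]; split.
  move=> i; case: (unliftP ord0 i) => [j|] ->; last by rewrite rV_cons0.
  rewrite rV_consS; case: o os => [k|] /= os; last by rewrite scaler0 subr0.
  rewrite !mxE eqxx/=; have [jk|jk] := eqVneq j k.
    by rewrite mulr1 subr_gt0 jk (lt_le_trans td).
  by rewrite mulr0 subr0.
rewrite big_ord_recl rV_cons0.
have -> : \sum_(i < n) rV_cons (t, s - t *: ref_dir o) ord0 (lift ord0 i) =
    \sum_i s ord0 i - t * \sum_i ref_dir o ord0 i.
  by rewrite mulr_sumr -sumrB; apply: eq_bigr => i _; rewrite rV_consS !mxE.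
case: o os => [k|] /= os.
  rewrite [X in t * X](bigD1 k)//= [X in t * (_ + X)]big1 => [|j jk]; last first.
    by rewrite mxE (negbTE jk) andbF.
  by rewrite mxE !eqxx addr0 mulr1 addrC subrK.
rewrite [X in t * X]big1 => [|i _]; last by rewrite mxE.
by move: s1 os td; move: (\sum_(i < n) _) (_^-1) => S c; lra.
Qed.

Lemma measurable_horner_EFin (D : set R) (r : {poly R}) :
  measurable_fun D (fun t => (r.[t])%:E).
Proof.
apply/measurable_EFinP; apply: measurable_funTS.
by apply: continuous_measurable_fun; exact: horner_continuous.
Qed.

(** The inequality in one variable is applied on the segment above each [s] and then integrated in
    [s]; the segments are straightened by a shear that preserves the measure. *)
Lemma ref_piece_trace n d (G : 'rV[R]_n.+1 -> R) (o : option 'I_n) :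
  measurable_fun setT G -> line_poly d G ->
  (\int[leb R n]_(s in ref_piece o) (G (rV_cons (0, s)) ^+ 2)%:E <=
   (n.+1%:R * d.+1%:R ^+ 2)%:E *
   \int[leb R n.+1]_(z in @oref_simplex n.+1) (G z ^+ 2)%:E)%E.
Proof.
move=> mG lG.
pose h z := ((\1_(@oref_simplex n.+1) z : R) * G z ^+ 2)%:E.
have h0 z : (0 <= h z)%E by rewrite lee_fin mulr_ge0// sqr_ge0.
have mh : measurable_fun setT h.
  apply/measurable_EFinP; apply: measurable_funM; last exact: measurable_funX.
  by apply: measurable_indic; exact: measurable_oref_simplex.
have hE : (\int[leb R n.+1]_(z in @oref_simplex n.+1) (G z ^+ 2)%:E =
           \int[leb R n.+1]_z h z)%E.
  rewrite integral_mkcond; apply: eq_integral => z _.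
  rewrite patchE /h indicE; case: ifP => zo; first by rewrite mul1r.
  by rewrite mul0r.
pose shear (p : measurableTypeR R * 'rV[R]_n) := rV_cons (p.1, p.2 - p.1 *: ref_dir o).
have mshear : measurable_fun setT shear.
  rewrite (_ : shear = @rV_cons R n \o (fun p => (p.1, p.2 - p.1 *: ref_dir o)))//.
  apply: (measurableT_comp (@measurable_rV_cons R n)).
  apply: measurable_fun_pair; first exact: measurable_fst.
  apply: measurable_fun_coordP => i; under eq_fun do rewrite !mxE.
  apply: measurable_funB.
    exact: (measurableT_comp (measurable_coord i) measurable_snd).
  by apply: measurable_funM => //; exact: measurable_fst.
have key s : ref_piece o s -> ((G (rV_cons (0, s)) ^+ 2)%:E <=
    (n.+1%:R * d.+1%:R ^+ 2)%:E * \int[@lebesgue_measure R]_t h (shear (t, s)))%E.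
  move=> so; pose dlt : R := n.+1%:R^-1.
  have d0 : 0 < dlt by rewrite invr_gt0.
  have [r sr rE] := lG (rV_cons (0, s)) (rV_cons (1, - ref_dir o)).
  have shE t : shear (t, s) = rV_cons (0, s) + t *: rV_cons (1, - ref_dir o).
    have -> : shear (t, s) = rV_cons (t : R, s - t *: ref_dir o) by [].
    apply/rowP => i; rewrite [RHS]mxE [X in _ = _ + X]mxE.
    case: (unliftP ord0 i) => [j|] ->.
      by rewrite !rV_consS !mxE mulrN.
    by rewrite !rV_cons0/= mulr1 add0r.
  have G0 : G (rV_cons (0, s)) = r.[0] by rewrite -rE scale0r addr0.
  have := poly_trace_ineq d0 sr; rewrite -G0 -lee_fin => /le_trans; apply.
  (* The segments have length [1 / (n + 1)], which is the origin of the factor [n + 1]. *)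
  rewrite (_ : d.+1%:R ^+ 2 / dlt = n.+1%:R * d.+1%:R ^+ 2); last first.
    by rewrite /dlt invrK mulrC.
  rewrite [leLHS]EFinM; apply: lee_wpmul2l; first by rewrite lee_fin mulr_ge0// sqr_ge0.
  rewrite /poly_int /Rintegral fineK; last first.
    apply: integrable_fin_num => //; exact: integrable_horner.
  rewrite integral_itv_bndoo; last exact: measurable_horner_EFin.
  rewrite [leLHS]integral_mkcond; apply: ge0_le_integral => //.
  - by move=> t _; rewrite patchE; case: ifP => // _; rewrite lee_fin horner_exp sqr_ge0.
  - by apply/(measurable_restrictT _ _).1 => //; exact: measurable_horner_EFin.
  - exact: (measurableT_comp mh (measurableT_comp mshear (measurable_pair2 s))).
  - move=> t _; rewrite patchE; case: ifP => // /set_mem/=; rewrite in_itv/= => td.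
    rewrite /h indicE mem_set ?mul1r; last exact: ref_piece_inside.
    by rewrite shE rE horner_exp.
pose C := (n.+1%:R * d.+1%:R ^+ 2)%:E : \bar R.
have C0 : (0 <= C)%E by rewrite lee_fin mulr_ge0// sqr_ge0.
have mhs : measurable_fun setT (h \o shear) by exact: (measurableT_comp mh mshear).
have mI : measurable_fun setT (fun s => \int[@lebesgue_measure R]_t h (shear (t, s)))%E.
  apply: (measurable_fun_fubini_tonelli_G (m1 := @lebesgue_measure R) (h \o shear)) => //.
  by move=> p; exact: h0.
have I0 s : (0 <= \int[@lebesgue_measure R]_t h (shear (t, s)))%E by exact: integral_ge0.
apply: (@le_trans _ _ (\int[leb R n]_(s in ref_piece o)
    (C * \int[@lebesgue_measure R]_t h (shear (t, s))))%E).
  apply: ge0_le_integral => //.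
  - exact: measurable_ref_piece.
  - by move=> s _; rewrite lee_fin sqr_ge0.
  - apply: measurable_funTS; apply/measurable_EFinP; apply: measurable_funX.
    apply: (measurableT_comp mG); apply: (measurableT_comp (@measurable_rV_cons R n)).
    exact: measurable_pair1.
  - by apply: measurable_funTS; exact: measurable_funeM.
apply: (@le_trans _ _ (\int[leb R n]_s
    (C * \int[@lebesgue_measure R]_t h (shear (t, s))))%E).
  apply: ge0_subset_integral => //.
  - exact: measurable_ref_piece.
  - exact: measurable_funeM.
  - by move=> s _; exact: mule_ge0.
rewrite ge0_integralZl//; apply: lee_wpmul2l => //.
rewrite hE ge0_integral_lebS//.
have := @fubini_tonelli _ _ _ _ _ (@lebesgue_measure R) (leb R n) (h \o shear) mhs
  (fun p => h0 (shear p)).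
(* At fixed height [t] the shear is a translation in [s]. *)
rewrite /= => <-; rewrite le_eqVlt; apply/orP; left; apply/eqP.
apply: eq_integral => t _.
have mht : measurable_fun setT (fun s : 'rV[R]_n => h (rV_cons (t, s))).
  apply: (measurableT_comp mh); apply: (measurableT_comp (@measurable_rV_cons R n)).
  exact: measurable_pair1.
exact: (ge0_integral_translate (- (t *: ref_dir o)) mht).
Qed.

Lemma ge0_integral_bigcup_le n (I : finType) (A : I -> set 'rV[R]_n)
    (g : 'rV[R]_n -> \bar R) : (forall i, measurable (A i)) ->
  measurable_fun setT g -> (forall x, 0 <= g x)%E ->
  (\int[leb R n]_(x in \bigcup_(i in [set: I]) A i) g x <=
   \sum_(i : I) \int[leb R n]_(x in A i) g x)%E.
Proof.
move=> mA mg g0.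
have mgA i : measurable_fun setT (g \_ (A i)).
  by apply/(measurable_restrictT _ _).1 => //; exact: measurable_funTS.
have gA0 i x : (0 <= (g \_ (A i)) x)%E by rewrite patchE; case: ifP.
under eq_bigr do rewrite integral_mkcond.
rewrite -ge0_integral_sum// [leLHS]integral_mkcond; apply: ge0_le_integral => //.
- by move=> x _; rewrite patchE; case: ifP.
- apply/(measurable_restrictT _ _).1; last exact: measurable_funTS.
  by apply: fin_bigcup_measurable.
- exact: emeasurable_sum.
- move=> x _; rewrite patchE; case: ifPn => [/set_mem[i _ Aix]|_]; last exact: sume_ge0.
  rewrite (bigD1 i)//= patchE mem_set// leeDl//.
  exact: sume_ge0.
Qed.

(** Each of the [n + 1] pieces is bounded by the integral over the whole simplex, so overlaps are
    harmless and [n + 1] appears squared. *)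
Lemma ref_trace n d (G : 'rV[R]_n.+1 -> R) :
  measurable_fun setT G -> line_poly d G ->
  (\int[leb R n]_(s in @ref_simplex R n) (G (rV_cons (0, s)) ^+ 2)%:E <=
   (n.+1%:R ^+ 2 * d.+1%:R ^+ 2)%:E *
   \int[leb R n.+1]_(z in @oref_simplex n.+1) (G z ^+ 2)%:E)%E.
Proof.
move=> mG lG; set g := fun s => _; set J := (\int[leb R n.+1]_(z in _) _)%E.
have mg : measurable_fun setT g.
  apply/measurable_EFinP; apply: measurable_funX.
  apply: (measurableT_comp mG); apply: (measurableT_comp (@measurable_rV_cons R n)).
  exact: measurable_pair1.
have g0 s : (0 <= g s)%E by rewrite lee_fin sqr_ge0.
have [N [mN N0 bN]] := @negligible_ref_boundary n.
have mU : measurable (\bigcup_(o in [set: option 'I_n]) ref_piece o).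
  by apply: fin_bigcup_measurable => // o _; exact: measurable_ref_piece.
apply: (@le_trans _ _ (\int[leb R n]_(s in \bigcup_(o in [set: option 'I_n]) ref_piece o) g s)%E).
  have mD := @measurable_ref_simplex n.
  have mgD : measurable_fun (@ref_simplex R n) g by exact: measurable_funTS.
  rewrite (ge0_negligible_integral mN mD mgD (fun s _ => g0 s) N0).
  apply: ge0_subset_integral => //.
  - by apply: measurableD => //; exact: measurable_ref_simplex.
  - exact: measurable_funTS.
  - move=> s [rs Ns]; apply: ref_piece_cover; apply: contrapT => os.
    by apply: Ns; apply: bN.
have mP (o : option 'I_n) : measurable (ref_piece o) by exact: measurable_ref_piece.
apply: (le_trans (ge0_integral_bigcup_le mP mg g0)).
apply: (@le_trans _ _ (\sum_(o : option 'I_n) ((n.+1%:R * d.+1%:R ^+ 2)%:E * J))%E).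
  by apply: lee_sum => o _; exact: ref_piece_trace.
rewrite -ge0_sume_distrl => [|o _]; last by rewrite lee_fin mulr_ge0// sqr_ge0.
rewrite sumEFin sumr_const card_option card_ord -[X in (X%:E * _)%E]mulr_natr.
by rewrite [_ * n.+1%:R]mulrC mulrA -expr2.
Qed.

End reference_trace.

(** * Affine transport of the trace inequality to arbitrary simplices *)

Section simplex_trace.
Context (R : realType).
Implicit Types n : nat.

(** The factor is the volume of the preimage of the unit cube under [x |-> - x M]: this is the
    product identity [leb_mulmx] with the cube, of volume 1, as second set. *)
Lemma leb_affine n (M : 'M[R]_n) (v : 'rV[R]_n) : M \in unitmx ->
  exists c : {nonneg R}, forall A, measurable A ->
    leb R n ((fun z => z *m M + v) @^-1` A) = (c%:num%:E * leb R n A)%E.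
Proof.
move=> uM; pose B := (fun x : 'rV[R]_n => - (x *m M)) @^-1` (@box R n 0 1).
have mB : measurable B.
  apply: preimage_measurable; last exact: measurable_box.
  rewrite (_ : (fun x => _) = fun x => x *m (- M)); first exact: measurable_mulrV.
  by apply/funext => x; rewrite mulmxN.
have Boo : (leb R n B < +oo)%E.
  apply: leb_bounded_lty => //.
  exists (\sum_i \sum_j `|invmx M i j|) => x Bx i.
  have -> : x = (- (x *m M)) *m (- invmx M) by rewrite mulmxN mulNmx opprK mulmxK.
  rewrite mxE (le_trans (ler_norm_sum _ _ _))//; apply: ler_sum => k _.
  have /andP[b0 b1] := Bx k.
  apply: (@le_trans _ _ `|invmx M k i|); last by rewrite (bigD1 i)//= lerDl sumr_ge0.
  by rewrite normrM [(- invmx M) k i]mxE normrN ger0_norm// ler_piMl.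
exists (NngNum (fine_ge0 (measure_ge0 (leb R n) B))) => A mA /=.
rewrite fineK ?ge0_fin_numE// muleC.
have mA' : measurable ((fun x => x + v) @^-1` A).
  by apply: preimage_measurable mA; exact: measurable_addrV.
have := leb_mulmx uM mA' (@measurable_box R n 0 1).
rewrite leb_box// subr0 expr1n mule1 => ->.
by rewrite leb_translate.
Qed.

Lemma csimplex_bounded k n (W : 'I_k.+1 -> 'rV[R]_n) : coord_bounded (csimplex W).
Proof.
exists (\sum_i \sum_j `|W i ord0 j|) => x [w [w0 w1 ->]] j.
rewrite summxE (le_trans (ler_norm_sum _ _ _))//; apply: ler_sum => i _.
apply: (@le_trans _ _ `|W i ord0 j|); last by rewrite (bigD1 j)//= lerDl sumr_ge0.
rewrite mxE normrM ger0_norm// ler_piMl// -w1 (bigD1 i)//= lerDl.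
exact: sumr_ge0.
Qed.

Definition apex_cone n (V : 'I_n.+1 -> 'rV[R]_n.+1) (a : 'rV[R]_n.+1) :
  'I_n.+2 -> 'rV[R]_n.+1 := fun i => oapp V a (unlift ord0 i).

Section cone_param.
Context (n : nat) (V : 'I_n.+1 -> 'rV[R]_n.+1) (a : 'rV[R]_n.+1).

(** The first coordinate is the height: at height 0 the map [cone_param] restricts to the
    parametrization used in [face_int], and height 1 over the origin is the apex. *)
Definition cone_mx : 'M[R]_(1 + n, n.+1) := col_mx (a - V ord0) (edges V).

Definition cone_param (z : 'rV[R]_n.+1) : 'rV[R]_n.+1 := z *m cone_mx + V ord0.

Lemma cone_param_cons t s :
  cone_param (rV_cons (t, s)) = V ord0 + s *m edges V + t *: (a - V ord0).
Proof.
rewrite /cone_param /rV_cons (mul_row_col t%:M s) mul_scalar_mx.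
by rewrite addrC [_ + s *m _]addrC addrA.
Qed.

Lemma row_edges k m (W : 'I_k.+1 -> 'rV[R]_m) i :
  row i (edges W) = W (lift ord0 i) - W ord0.
Proof. by apply/rowP => j; rewrite !mxE. Qed.

Lemma mulmx_edges k m (W : 'I_k.+1 -> 'rV[R]_m) (s : 'rV[R]_k) :
  s *m edges W = \sum_i s ord0 i *: (W (lift ord0 i) - W ord0).
Proof. by rewrite mulmx_sum_row; apply: eq_bigr => i _; rewrite row_edges. Qed.

Lemma cone_combE (w : 'I_n.+2 -> R) : \sum_i w i = 1 ->
  \sum_i w i *: apex_cone V a i =
  cone_param (rV_cons (w ord0, \row_i w (lift ord0 (lift ord0 i)))).
Proof.
move=> w1; rewrite cone_param_cons mulmx_edges !big_ord_recl in w1 *.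
rewrite /apex_cone unlift_none liftK /=.
have -> : w (lift ord0 ord0) =
    1 - w ord0 - \sum_(i < n) w (lift ord0 (lift ord0 i)) by rewrite -w1; ring.
rewrite (eq_bigr (fun i => w (lift ord0 (lift ord0 i)) *: V (lift ord0 i))); last first.
  by move=> i _; rewrite liftK.
rewrite [in RHS](eq_bigr (fun i => w (lift ord0 (lift ord0 i)) *: V (lift ord0 i) -
  w (lift ord0 (lift ord0 i)) *: V ord0)); last first.
  by move=> i _; rewrite mxE scalerBr.
rewrite sumrB -scaler_suml !scalerBl scale1r scalerBr.
by apply/rowP => j; rewrite !mxE; ring.
Qed.

(** Barycentric coordinates in the order of [apex_cone]: the apex carries the height, the vertex
    [V ord0] the complement to 1, and the other vertices the remaining coordinates. *)
Definition cone_weight (z : 'rV[R]_n.+1) (i : 'I_n.+2) : R :=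
  oapp (fun j => oapp (fun k => z ord0 (lift ord0 k)) (1 - \sum_k z ord0 k) (unlift ord0 j))
    (z ord0 ord0) (unlift ord0 i).

Lemma cone_weight0 z : cone_weight z ord0 = z ord0 ord0.
Proof. by rewrite /cone_weight; case: unliftP => [j /eqP|//]; rewrite eq_liftF. Qed.

Lemma cone_weight1 z : cone_weight z (lift ord0 ord0) = 1 - \sum_k z ord0 k.
Proof.
rewrite /cone_weight liftK /=; case: unliftP => [j /eqP|//].
by rewrite eq_liftF.
Qed.

Lemma cone_weightS z k : cone_weight z (lift ord0 (lift ord0 k)) = z ord0 (lift ord0 k).
Proof. by rewrite /cone_weight liftK /= liftK. Qed.

Lemma sum_cone_weight z : \sum_i cone_weight z i = 1.
Proof.
rewrite 2!big_ord_recl cone_weight0 cone_weight1.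
rewrite (eq_bigr (fun k => z ord0 (lift ord0 k))) => [|k _]; last exact: cone_weightS.
by rewrite big_ord_recl; ring.
Qed.

Lemma cone_param_weight z : cone_param z = \sum_i cone_weight z i *: apex_cone V a i.
Proof.
rewrite cone_combE ?sum_cone_weight//; congr cone_param.
rewrite -[LHS]rV_unconsK cone_weight0; congr (rV_cons (_, _)).
by apply/rowP => i; rewrite !mxE cone_weightS.
Qed.

Hypothesis free : affine_free (apex_cone V a).

(** Freeness concerns edges issued from the apex, while [cone_mx] uses edges issued from [V ord0]. A
    vector [z] in the kernel represents the point [V ord0], so by freeness its weights are those of
    that vertex, and [z = 0]. *)
Lemma cone_mx_unit : cone_mx \in unitmx.
Proof.
rewrite -row_free_unit; apply/inj_row_free => z z0.
have [t [s zE]] : exists t s, z = rV_cons (t, s) :> 'rV[R]_n.+1.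
  by exists (rV_uncons z).1, (rV_uncons z).2; rewrite -[LHS]rV_unconsK; case: (rV_uncons z).
pose w := cone_weight z.
pose y : 'rV[R]_n.+1 := \row_j w (lift ord0 j).
have yE : y *m edges (apex_cone V a) = z *m cone_mx + V ord0 - a.
  rewrite -/(cone_param z) cone_param_weight mulmx_edges [in RHS]big_ord_recl.
  have w1 := sum_cone_weight z; rewrite big_ord_recl in w1.
  rewrite (_ : apex_cone V a ord0 = a); last by rewrite /apex_cone unlift_none.
  transitivity (\sum_i w (lift ord0 i) *: apex_cone V a (lift ord0 i) -
      (\sum_i w (lift ord0 i)) *: a).
    by rewrite scaler_suml -sumrB; apply: eq_bigr => i _; rewrite mxE scalerBr.
  rewrite -[X in _ = _ - X]scale1r -w1 scalerDl opprD addrACA subrr add0r.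
  by [].
have y1 : (y - \row_j (j == ord0)%:R) *m edges (apex_cone V a) = 0.
  rewrite mulmxBl yE z0 add0r mulmx_edges big_ord_recl big1 => [|i _]; last first.
    by rewrite mxE scale0r.
  by rewrite mxE eqxx scale1r addr0 /apex_cone unlift_none liftK /= subrr.
have /eqP := y1; rewrite mulmx_free_eq0// subr_eq0 => /eqP/rowP yd.
have zk k : z ord0 (lift ord0 k) = 0.
  by have := yd (lift ord0 k); rewrite !mxE /w cone_weightS.
apply/rowP => i; rewrite mxE; case: (unliftP ord0 i) => [k|] -> //.
have := yd ord0; rewrite !mxE eqxx /w cone_weight1.
rewrite big_ord_recl (eq_bigr (fun=> 0)) => [|k _]; last exact: zk.
by rewrite big1_eq addr0 => /eqP; rewrite subr_eq addrC -subr_eq subrr => /eqP.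
Qed.

Lemma cone_param_inj : injective cone_param.
Proof.
move=> x y /addIr /eqP; rewrite -subr_eq0 -mulmxBl mulmx_free_eq0.
  by rewrite subr_eq0 => /eqP.
by rewrite row_free_unit; exact: cone_mx_unit.
Qed.

Lemma csimplex_cone_param z : csimplex (apex_cone V a) (cone_param z) <-> ref_simplex z.
Proof.
split.
  move=> [w [w0 w1]]; rewrite cone_combE// => /cone_param_inj ->; split.
    move=> i; case: (unliftP ord0 i) => [k|] ->; first by rewrite rV_consS mxE.
    by rewrite rV_cons0.
  rewrite -w1 !big_ord_recl rV_cons0 lerD2l.
  rewrite (eq_bigr (fun i => w (lift ord0 (lift ord0 i)))) => [|i _]; last by rewrite rV_consS mxE.
  by rewrite lerDr.
move=> [z0 z1]; exists (cone_weight z); split.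
- move=> i; rewrite /cone_weight; case: (unliftP ord0 i) => [j|] _ //=.
  by case: (unliftP ord0 j) => [k|] _ //=; rewrite subr_ge0.
- exact: sum_cone_weight.
- exact: cone_param_weight.
Qed.

Lemma osimplex_cone_param z : osimplex (apex_cone V a) (cone_param z) <-> oref_simplex z.
Proof.
split.
  move=> [w [w0 w1]]; rewrite cone_combE// => /cone_param_inj ->; split.
    move=> i; case: (unliftP ord0 i) => [k|] ->; first by rewrite rV_consS mxE.
    by rewrite rV_cons0.
  rewrite -w1 !big_ord_recl rV_cons0 ltrD2l.
  rewrite (eq_bigr (fun i => w (lift ord0 (lift ord0 i)))) => [|i _]; last by rewrite rV_consS mxE.
  by rewrite ltrDr.
move=> [z0 z1]; exists (cone_weight z); split.
- move=> i; rewrite /cone_weight; case: (unliftP ord0 i) => [j|] _ //=.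
  by case: (unliftP ord0 j) => [k|] _ //=; rewrite subr_gt0.
- exact: sum_cone_weight.
- exact: cone_param_weight.
Qed.

Lemma measurable_cone_set (S A : set 'rV[R]_n.+1) :
  (forall z, S (cone_param z) <-> A z) -> measurable A -> measurable S.
Proof.
move=> SA mA.
pose g (x : 'rV[R]_n.+1) := (x - V ord0) *m invmx cone_mx.
have gK x : cone_param (g x) = x.
  by rewrite /cone_param /g mulmxKV ?subrK//; exact: cone_mx_unit.
rewrite (_ : S = g @^-1` A); last first.
  by apply/seteqP; split => x /=; [move=> Sx; apply/SA|move/SA]; rewrite gK.
apply: preimage_measurable mA.
exact: (measurableT_comp (measurable_mulrV (invmx cone_mx)) (measurable_addrV (- V ord0))).
Qed.

(** The area element multiplies both the face integral and the face area, and the volume factor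
    multiplies both the cell integral and the volume of the simplex. Only the measures of the
    reference simplices and the ratio of area to volume are left, whatever the shape. *)
Lemma simplex_trace d (G : 'rV[R]_n.+1 -> R) :
  measurable_fun setT G -> line_poly d G ->
  (leb R n.+1).-integrable (osimplex (apex_cone V a)) (fun x => (G x ^+ 2)%:E) ->
  face_area V != 0 -> fine (leb R n.+1 (csimplex (apex_cone V a))) != 0 ->
  face_int V (fun x => G x ^+ 2) <=
    n.+1%:R ^+ 2 * d.+1%:R ^+ 2 *
    (fine (leb R n.+1 (@ref_simplex R n.+1)) / fine (leb R n (@ref_simplex R n))) *
    (face_area V / fine (leb R n.+1 (csimplex (apex_cone V a)))) *
    \int[leb R n.+1]_(x in osimplex (apex_cone V a)) (G x ^+ 2).
Proof.
move=> mG lG iG areaN0 volN0; set K := csimplex _; set Ko := osimplex _.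
have mK : measurable K.
  exact: measurable_cone_set csimplex_cone_param (@measurable_ref_simplex R n.+1).
have mKo : measurable Ko.
  exact: measurable_cone_set osimplex_cone_param (@measurable_oref_simplex R n.+1).
have [c cE] := leb_affine (V ord0) cone_mx_unit.
have mphi : measurable_fun setT cone_param.
  exact: (measurableT_comp (measurable_addrV (V ord0)) (measurable_mulrV cone_mx)).
have refK : cone_param @^-1` K = @ref_simplex R n.+1.
  by apply/seteqP; split => z /csimplex_cone_param.
have refKo : cone_param @^-1` Ko = @oref_simplex R n.+1.
  by apply/seteqP; split => z /osimplex_cone_param.
pose H (x : 'rV[R]_n.+1) := ((\1_Ko x : R) * G x ^+ 2)%:E.
have mH : measurable_fun setT H.
  apply/measurable_EFinP; apply: measurable_funM; last exact: measurable_funX.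
  exact: measurable_indic.
have H0 x : (0 <= H x)%E by rewrite lee_fin mulr_ge0// sqr_ge0.
have intH : (\int[leb R n.+1]_(x in Ko) (G x ^+ 2)%:E = \int[leb R n.+1]_x H x)%E.
  rewrite integral_mkcond; apply: eq_integral => x _.
  by rewrite patchE /H indicE; case: ifP => _; rewrite ?mul1r ?mul0r.
have mGp : measurable_fun setT (G \o cone_param) by exact: measurableT_comp.
have lGp : line_poly d (G \o cone_param).
  move=> x w; have [r sr rE] := lG (cone_param x) (w *m cone_mx).
  exists r => // t; rewrite -rE /= /cone_param mulmxDl -scalemxAl.
  by rewrite addrAC.
have := ref_trace mGp lGp.
set I1 := (\int[leb R n]_(s in _) _)%E; set I2 := (\int[leb R n.+1]_(z in _) _)%E.
have I2E : I2 = (c%:num%:E * \int[leb R n.+1]_(x in Ko) (G x ^+ 2)%:E)%E.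
  rewrite intH -(ge0_integral_leb_transform mphi cE mH H0) /I2 integral_mkcond.
  apply: eq_integral => z _; rewrite patchE /H indicE -refKo.
  have -> : (z \in cone_param @^-1` Ko) = (cone_param z \in Ko).
    by apply/idP/idP; rewrite !inE.
  by case: ifP => _; rewrite ?mul1r ?mul0r.
set J := \int[leb R n.+1]_(x in Ko) (G x ^+ 2).
have JE : (\int[leb R n.+1]_(x in Ko) (G x ^+ 2)%:E)%E = J%:E.
  by rewrite /J /Rintegral fineK//; exact: integrable_fin_num.
rewrite I2E JE -!EFinM => I1le.
have J0 : 0 <= J by apply: Rintegral_ge0 => x _; exact: sqr_ge0.
have I1E : I1 = (fine I1)%:E.
  rewrite fineK// ge0_fin_numE; first exact: le_lt_trans I1le (ltry _).
  by apply: integral_ge0 => s _; rewrite lee_fin sqr_ge0.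
rewrite I1E lee_fin in I1le.
have faceE : face_int V (fun x => G x ^+ 2) =
    Num.sqrt (\det (edges V *m (edges V)^T)) * fine I1.
  rewrite /face_int /Rintegral; congr (_ * fine _).
  apply: eq_integral => s _ /=; congr (_%:E); congr (G _ ^+ 2).
  by rewrite cone_param_cons scale0r addr0.
have areaE : face_area V =
    Num.sqrt (\det (edges V *m (edges V)^T)) * fine (leb R n (@ref_simplex R n)).
  by rewrite /face_area /face_int Rintegral_cst ?mul1r//; exact: measurable_ref_simplex.
set rn := fine (leb R n _); set rS := fine (leb R n.+1 (@ref_simplex R n.+1)).
set vK := fine (leb R n.+1 K).
have rn0 : rn != 0 by apply: contra areaN0 => /eqP r0; rewrite areaE -/rn r0 mulr0.
have cK : rS = c%:num * vK.
  have KE : leb R n.+1 K = vK%:E.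
    rewrite fineK// ge0_fin_numE//; apply: leb_bounded_lty => //.
    exact: csimplex_bounded.
  by rewrite /rS -refK cE// KE.
have -> : n.+1%:R ^+ 2 * d.+1%:R ^+ 2 * (rS / rn) * (face_area V / vK) * J =
    Num.sqrt (\det (edges V *m (edges V)^T)) *
      (n.+1%:R ^+ 2 * d.+1%:R ^+ 2 * (c%:num * J)).
  by rewrite areaE cK -/rn; set sd := Num.sqrt _; field; rewrite rn0 volN0.
by rewrite faceE ler_wpM2l.
Qed.
End cone_param.
End simplex_trace.

(** * Polynomial functions *)

Section polynomial_functions.
Context (R : realType) (n p : nat).

Notation mi := {ffun 'I_n -> 'I_p.+1}.

(** Bounding each partial degree makes the exponents a finite type, so that coefficients form a
    vector. The price is a degree up to [n * p] along lines. *)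
Definition mono (m : mi) (x : 'rV[R]_n) : R := \prod_i x ord0 i ^+ m i.

Definition peval (c : mi -> R) (x : 'rV[R]_n) : R := \sum_m c m * mono m x.

Definition is_pol (f : 'rV[R]_n -> R) := exists c, forall x, f x = peval c x.

Lemma pevalD c1 c2 x : peval (c1 \+ c2) x = peval c1 x + peval c2 x.
Proof. by rewrite /peval -big_split/=; apply: eq_bigr => m _; rewrite mulrDl. Qed.

Lemma pevalZ a c x : peval (fun m => a * c m) x = a * peval c x.
Proof. by rewrite /peval mulr_sumr; apply: eq_bigr => m _; rewrite mulrA. Qed.

Lemma is_pol_mono m : is_pol (mono m).
Proof.
exists (fun m' => (m' == m)%:R) => x; rewrite /peval (bigD1 m)//= eqxx mul1r.
by rewrite big1 ?addr0// => m' /negbTE ->; rewrite mul0r.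
Qed.

Lemma is_polZ a f : is_pol f -> is_pol (fun x => a * f x).
Proof. by move=> [c cE]; exists (fun m => a * c m) => x; rewrite pevalZ cE. Qed.

Lemma is_polD f g : is_pol f -> is_pol g -> is_pol (fun x => f x + g x).
Proof. by move=> [c cE] [e eE]; exists (c \+ e) => x; rewrite pevalD cE eE. Qed.

Lemma is_pol_sum (I : Type) (s : seq I) (Q : pred I) (F : I -> 'rV[R]_n -> R) :
  all Q s -> (forall i, Q i -> is_pol (F i)) -> is_pol (fun x => \sum_(i <- s) F i x).
Proof.
move=> + H; elim: s => [_|i s IHs /= /andP[Qi Qs]].
  exists (fun=> 0) => x; rewrite big_nil /peval big1// => m _; exact: mul0r.
under [X in is_pol X]funext => x do rewrite big_cons.
by apply: is_polD; [exact: H|exact: IHs].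
Qed.

Definition line_mono (m : mi) (a v : 'rV[R]_n) : {poly R} :=
  \prod_i ((a ord0 i)%:P + v ord0 i *: 'X) ^+ m i.

Definition line_peval (c : mi -> R) a v : {poly R} := \sum_m c m *: line_mono m a v.

Lemma line_pevalE c a v t : (line_peval c a v).[t] = peval c (a + t *: v).
Proof.
rewrite /line_peval horner_sum; apply: eq_bigr => m _.
rewrite hornerZ /line_mono horner_prod; congr (_ * _); apply: eq_bigr => i _.
by rewrite horner_exp !hornerE !mxE [t * _]mulrC.
Qed.

Lemma line_poly_peval c : line_poly (n * p) (peval c).
Proof.
move=> a v; exists (line_peval c a v); last by move=> t; rewrite line_pevalE.
rewrite (leq_trans (size_sum _ _ _))//; apply/bigmax_leqP => m _.
rewrite (leq_trans (size_scale_leq _ _))// /line_mono.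
rewrite (leq_trans (size_poly_prod_leq _ _))//.
rewrite (@leq_trans ((\sum_(i < n) p.+1).+1 - n))//.
  rewrite card_ord leq_sub2r// ltnS leq_sum// => i _.
  rewrite (leq_trans (size_poly_exp_leq _ _))// ltnS (leq_trans _ (leq_ord (m i)))//.
  rewrite -[leqRHS]mul1n leq_mul2r; apply/orP; right.
  have : (size ((a ord0 i)%:P + v ord0 i *: 'X)%R <= 2)%N.
    rewrite (leq_trans (size_polyD _ _))// geq_max (leq_trans (size_polyC_leq1 _))//.
    by rewrite (leq_trans (size_scale_leq _ _))// size_polyX.
  by case: (size _) => [|[|[|]]].
by rewrite sum_nat_const card_ord mulnS; lia.
Qed.

Lemma prod_continuous (T : topologicalType) (I : Type) (s : seq I) (F : I -> T -> R) :
  (forall i, continuous (F i)) -> continuous (fun x => \prod_(i <- s) F i x).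
Proof.
move=> cF; elim: s => [|i s IHs] x.
  by under eq_fun do rewrite big_nil; exact: cvg_cst.
by under eq_fun do rewrite big_cons; apply: cvgM; [exact: cF|exact: IHs].
Qed.

Lemma sum_continuous (T : topologicalType) (I : Type) (s : seq I) (F : I -> T -> R) :
  (forall i, continuous (F i)) -> continuous (fun x => \sum_(i <- s) F i x).
Proof.
move=> cF; elim: s => [|i s IHs] x.
  by under eq_fun do rewrite big_nil; exact: cvg_cst.
by under eq_fun do rewrite big_cons; apply: cvgD; [exact: cF|exact: IHs].
Qed.

Lemma mono_continuous m : continuous (mono m).
Proof.
apply: prod_continuous => i x.
apply: (@continuous_comp _ _ _ (fun x : 'rV[R]_n => x ord0 i) (fun y => y ^+ m i)).
  exact: coord_continuous.
exact: exprn_continuous.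
Qed.

Lemma peval_continuous c : continuous (peval c).
Proof.
apply: sum_continuous => m x.
apply: (@continuousM _ _ (fun=> c m) (mono m)); first exact: cst_continuous.
exact: mono_continuous.
Qed.

Lemma measurable_mono m : measurable_fun setT (mono m).
Proof.
by apply: measurable_prod => i _; apply: (measurable_funX (m i)); exact: measurable_coord.
Qed.

Lemma measurable_peval c : measurable_fun setT (peval c).
Proof.
by apply: measurable_sum => m; apply: measurable_funM => //; exact: measurable_mono.
Qed.

Lemma mono_bounded (A : set 'rV[R]_n) : coord_bounded A ->
  exists2 B : R, 0 <= B & forall m x, A x -> `|mono m x| <= B.
Proof.
move=> [M AM]; pose N := Num.max 1 M; have N1 : 1 <= N by rewrite le_max lexx.
exists (N ^+ (n * p)) => [|m x Ax]; first by rewrite exprn_ge0// (le_trans ler01).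
rewrite /mono normr_prod (@le_trans _ _ (\prod_(i < n) N ^+ p))//; last first.
  by rewrite prodr_const card_ord mulnC exprM.
apply: ler_prod => i _; rewrite normr_ge0/= normrX (@le_trans _ _ (N ^+ m i))//.
  apply: lerXn2r; rewrite ?nnegrE//; first exact: le_trans ler01 N1.
  by rewrite le_max AM// orbT.
by rewrite ler_weXn2l// -ltnS.
Qed.

(** The directional derivative is the linear coefficient of the restriction to the line, which
    reduces the calculus to coefficients of polynomials in one variable. *)
Lemma is_derive_line (f : 'rV[R]_n -> R) (a v : 'rV[R]_n) (r : {poly R}) :
  (forall t, f (a + t *: v) = r.[t]) -> is_derive a v f (r`_1).
Proof.
move=> fr.
have H : (fun h => h^-1 *: ((f \o shift a) (h *: v) - f a)) @ (0 : R)^' --> r`_1.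
  pose q := drop_poly 1 r.
  have rE : r = q * 'X + (r`_0)%:P.
    by rewrite -{1}(poly_take_drop 1 r) addrC; congr (_ + _); apply/polyP => -[|i];
      rewrite coef_take_poly coefC.
  have q0 : q.[0] = r`_1 by rewrite horner_coef0 coef_drop_poly.
  rewrite -q0; apply: (@cvg_trans _ ((fun h => q.[h]) @ (0 : R)^')); last first.
    by apply/continuous_withinNx; exact: horner_continuous.
  apply: near_eq_cvg; near=> h.
  have h0 : h != 0 by near: h; exact: nbhs_dnbhs_neq.
  have fa : f a = r.[0] by rewrite -fr scale0r addr0.
  rewrite /= [h *: v + a]addrC fr fa rE !hornerE addrK.
  by rewrite /GRing.scale/= mulrC mulfK.
by apply: DeriveDef; [apply/cvg_ex; exists r`_1|exact: cvg_lim].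
Unshelve. all: by end_near. Qed.

(** The matrix [d] depends neither on the polynomial nor on the point; this uniformity later bounds
    differentiation on coefficients. *)
Lemma peval_derive j : exists d : mi -> mi -> R, forall c a,
  is_derive a (delta_mx ord0 j) (peval c) (peval (fun m' => \sum_m c m * d m m') a).
Proof.
(* When [m j = 0] the truncated predecessor is meaningless, but the factor [m j] then cancels its
   contribution. *)
pose dec (m : mi) : mi := [ffun i => if i == j then inord (m i).-1 else m i].
exists (fun m m' : mi => (m j)%:R * (m' == dec m)%:R) => c a.
have -> : peval (fun m' => \sum_m c m * ((m j)%:R * (m' == dec m)%:R)) a =
    \sum_m (c m * (m j)%:R) * mono (dec m) a.
  rewrite /peval; under eq_bigr do rewrite mulr_suml.
  rewrite exchange_big/=; apply: eq_bigr => m _; rewrite (bigD1 (dec m))//= eqxx mulr1.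
  by rewrite big1 ?addr0// => m' /negbTE ->; rewrite !mulr0 mul0r.
suff -> : \sum_m (c m * (m j)%:R) * mono (dec m) a = (line_peval c a (delta_mx ord0 j))`_1.
  by apply: is_derive_line => t; rewrite line_pevalE.
rewrite coef_sum; apply: eq_bigr => m _; rewrite coefZ -mulrA; congr (_ * _).
rewrite /line_mono (bigD1 j)//= (eq_bigr (fun i => (a ord0 i ^+ m i)%:P)); last first.
  move=> i ij; rewrite mxE (negbTE ij) andbF scale0r addr0.
  by rewrite rmorphXn.
have c1 (q : {poly R}) : q`_1 = q^`().[0] by rewrite horner_coef0 coef_deriv mulr1n.
rewrite -rmorph_prod/= coefMC mxE !eqxx scale1r c1 deriv_exp.
rewrite derivD derivC derivX add0r mul1r hornerMn horner_exp !hornerE.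
rewrite /mono (bigD1 j)//= ffunE eqxx inordK; last first.
  by rewrite (leq_ltn_trans (leq_pred _)).
rewrite mulrA mulr_natl; congr (_ * _); apply: eq_bigr => i ij.
by rewrite ffunE (negbTE ij).
Qed.

End polynomial_functions.

(** * Square integrable functions and polynomials on open sets *)

Section L2_theory.
Context (R : realType).

Context (n : nat).
Implicit Types (A : set 'rV[R]_n) (f g : 'rV[R]_n -> R).
Notation mu := (leb R n).

Lemma inL2M_integrable A f g : measurable A -> inL2 A f -> inL2 A g ->
  mu.-integrable A (fun x => (f x * g x)%:E).
Proof.
move=> mA [mf f2] [mg g2]; apply: (le_integrable mA _ _ (integrableD mA f2 g2)).
  by apply/measurable_EFinP; exact: measurable_funM.
move=> x Ax /=; rewrite lee_fin [leRHS]ger0_norm ?addr_ge0 ?sqr_ge0//.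
rewrite ler_norml; apply/andP; split; rewrite -subr_ge0.
  have := sqr_ge0 (f x + g x); have := sqr_ge0 (f x); have := sqr_ge0 (g x); nra.
by have := sqr_ge0 (f x - g x); have := sqr_ge0 (f x); have := sqr_ge0 (g x); nra.
Qed.

Lemma inL2_lin A f g a : measurable A -> inL2 A f -> inL2 A g ->
  inL2 A (fun x => a * f x + g x).
Proof.
move=> mA [mf f2] [mg g2]; split.
  by apply: measurable_funD => //; exact: measurable_funM.
have fg := inL2M_integrable mA (conj mf f2) (conj mg g2).
have := integrableD mA (integrableD mA (integrableZl mA (a ^+ 2) f2)
  (integrableZl mA (2 * a) fg)) g2.
apply: eq_integrable => // x _ /=; rewrite -!EFinM -!EFinD; congr (_%:E); ring.
Qed.

Lemma L2norm_ge0 A f : 0 <= L2norm A f.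
Proof. exact: sqrtr_ge0. Qed.

Lemma L2norm_sqr A f : L2norm A f ^+ 2 = \int[mu]_(x in A) (f x ^+ 2).
Proof. by rewrite sqr_sqrtr//; apply: Rintegral_ge0 => x _; exact: sqr_ge0. Qed.

Lemma integrable_lin A f g a : measurable A -> mu.-integrable A (EFin \o f) ->
  mu.-integrable A (EFin \o g) -> mu.-integrable A (EFin \o (fun x => a * f x + g x)).
Proof.
move=> mA fi gi; have := integrableD mA (integrableZl mA a fi) gi.
by apply: eq_integrable.
Qed.

Lemma Rintegral_lin A f g a : measurable A -> mu.-integrable A (EFin \o f) ->
  mu.-integrable A (EFin \o g) ->
  \int[mu]_(x in A) (a * f x + g x) = a * \int[mu]_(x in A) f x + \int[mu]_(x in A) g x.
Proof.
move=> mA fi gi; rewrite RintegralD//; first by rewrite RintegralZl.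
by have := integrableZl mA a fi; apply: eq_integrable.
Qed.

Lemma integrable_Rintegral_sum A (I : Type) (s : seq I) (F : I -> 'rV[R]_n -> R) :
  measurable A -> (forall i, mu.-integrable A (EFin \o F i)) ->
  mu.-integrable A (EFin \o (fun x => \sum_(i <- s) F i x)) /\
  \int[mu]_(x in A) (\sum_(i <- s) F i x) = \sum_(i <- s) \int[mu]_(x in A) F i x.
Proof.
move=> mA iF; elim: s => [|i s [IHi IHe]].
  split; first by apply: eq_integrable (integrable0 mu A) => // x _; rewrite /= big_nil.
  rewrite big_nil -[RHS](mul0r (fine (mu A))) -Rintegral_cst//.
  by apply: eq_Rintegral => x _; rewrite big_nil.
split.
  have := integrableD mA (iF i) IHi.
  by apply: eq_integrable => // x _; rewrite /= big_cons.
rewrite big_cons -IHe -RintegralD//.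
by apply: eq_Rintegral => x _; rewrite big_cons.
Qed.

Lemma L2_CauchySchwarz A f g : measurable A -> inL2 A f -> inL2 A g ->
  `|\int[mu]_(x in A) (f x * g x)| <= L2norm A f * L2norm A g.
Proof.
move=> mA fL gL; rewrite -(ler_pXn2r (n := 2)) ?nnegrE ?mulr_ge0 ?L2norm_ge0//.
rewrite real_normK ?num_real// exprMn !L2norm_sqr; apply: quadratic_ge0_discr.
- by apply: Rintegral_ge0 => x _; exact: sqr_ge0.
- by apply: Rintegral_ge0 => x _; exact: sqr_ge0.
move=> t; have fg := inL2M_integrable mA fL gL.
rewrite [X in _ <= X](_ : _ = \int[mu]_(x in A) ((f x + t * g x) ^+ 2)).
  by apply: Rintegral_ge0 => x _; exact: sqr_ge0.
have [_ f2] := fL; have [_ g2] := gL.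
transitivity (\int[mu]_(x in A)
    (t ^+ 2 * g x ^+ 2 + (2 * t * (f x * g x) + f x ^+ 2))).
  rewrite Rintegral_lin//; last exact: integrable_lin.
  by rewrite Rintegral_lin//; ring.
by apply: eq_Rintegral => x _; ring.
Qed.

Lemma integrable_bounded A f (B : R) : measurable A -> coord_bounded A ->
  measurable_fun A f -> (forall x, A x -> `|f x| <= B) -> mu.-integrable A (EFin \o f).
Proof.
move=> mA bA mf fB; apply: measurable_bounded_integrable => //.
  exact: leb_bounded_lty.
by exists B; split; [exact: num_real|move=> M BM x Ax; exact: le_trans (fB _ Ax) (ltW BM)].
Qed.

Lemma bounded_inL2 A f (B : R) : measurable A -> coord_bounded A ->
  measurable_fun A f -> (forall x, A x -> `|f x| <= B) -> inL2 A f.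
Proof.
move=> mA bA mf fB; split => //.
apply: (@integrable_bounded _ _ (B ^+ 2)) => // [|x Ax]; first exact: measurable_funX.
by rewrite normrX lerXn2r ?nnegrE ?fB// (le_trans (normr_ge0 _) (fB x Ax)).
Qed.

(** If [f x] were nonzero, [|f|] would exceed [|f x| / 2] on a nonempty open subset, which has
    positive measure. This identifies the kernel of the Gram matrix below. *)
Lemma continuous_Rintegral_sqr_eq0 A f : open A -> continuous f ->
  mu.-integrable A (fun x => (f x ^+ 2)%:E) ->
  \int[mu]_(x in A) (f x ^+ 2) = 0 -> forall x, A x -> f x = 0.
Proof.
move=> oA cf f2 I0 x Ax; apply: contrapT => /eqP fx0.
have mA := open_measurable_rV oA.
have e0 : 0 < `|f x| / 2 by rewrite divr_gt0 ?normr_gt0.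
pose B := A `&` [set y | `|f x| / 2 < `|f y|].
have oB : open B.
  apply: openI => //.
  have -> : [set y | `|f x| / 2 < `|f y|] = (Num.norm \o f) @^-1` [set t | `|f x| / 2 < t] by [].
  apply: open_comp; last exact: open_gt.
  by move=> y _; apply: continuous_comp; [exact: cf|exact: norm_continuous].
have B0 : (0 < mu B)%E.
  apply: leb_open_gt0 => //; exists x; split => //=.
  by rewrite ltr_pdivrMr// ltr_pMr ?normr_gt0// ltr1n.
have eps0 : 0 < (`|f x| / 2) ^+ 2 by rewrite exprn_gt0.
have mB := open_measurable_rV oB.
have mf2 : measurable_fun A (fun y => (f y ^+ 2)%:E) by case/integrableP : f2.
have : (((`|f x| / 2) ^+ 2)%:E * mu B <= \int[mu]_(y in A) (f y ^+ 2)%:E)%E.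
  rewrite -integral_cst//.
  apply: (@le_trans _ _ (\int[mu]_(y in B) (f y ^+ 2)%:E)%E).
    apply: ge0_le_integral => //.
    - by move=> y _; rewrite lee_fin sqr_ge0.
    - by apply: measurable_funS mf2 => // y [].
    - move=> y [_ /= fy]; rewrite lee_fin -[leRHS]real_normK ?num_real//.
      by rewrite lerXn2r ?nnegrE// ltW.
  apply: ge0_subset_integral => // [y _|y []//].
  by rewrite lee_fin sqr_ge0.
rewrite -[X in (_ <= X)%E]fineK; last exact: integrable_fin_num.
rewrite -[fine _]/(\int[mu]_(y in A) (f y ^+ 2)) I0 leNgt => /negP; apply.
by rewrite mule_gt0// lte_fin.
Qed.
End L2_theory.

(** * Polynomial coefficients controlled by the L2 norm *)

Section coefficient_bound.
Context (R : realType) (n p : nat) (A : set 'rV[R]_n).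
Hypotheses (oA : open A) (bA : coord_bounded A).
Notation mi := {ffun 'I_n -> 'I_p.+1}.
Notation mu := (leb R n).

Lemma inL2_peval c : inL2 A (peval (p := p) c).
Proof.
have [B B0 BP] := mono_bounded p bA.
apply: (@bounded_inL2 _ _ _ _ (\sum_m `|c m| * B)) => //.
- exact: open_measurable_rV.
- by apply: measurable_funTS; exact: measurable_peval.
- move=> x Ax; rewrite (le_trans (ler_norm_sum _ _ _))//; apply: ler_sum => m _.
  by rewrite normrM ler_wpM2l// BP.
Qed.

Lemma inL2_mono m : inL2 A (mono (p := p) m).
Proof.
have [c cE] := is_pol_mono R m.
by rewrite (_ : mono m = peval c); [exact: inL2_peval|exact/funext].
Qed.

(* With the Gram matrix [G] of the monomials, the vector [c G G^+] represents the
   same polynomial as [c] on [A], and its entries are controlled by the scalar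
   products [c G] of the polynomial with the monomials. *)
Lemma peval_coef_bound : exists2 K : R, 0 <= K & forall c : mi -> R, exists c' : mi -> R,
  (forall x, A x -> peval c x = peval c' x) /\
  forall m, `|c' m| <= K * L2norm A (peval c).
Proof.
have mA := open_measurable_rV oA.
pose N := #|mi|; pose e : 'I_N -> mi := enum_val.
pose b i := mono (R := R) (p := p) (e i).
have bL i : inL2 A (b i) by exact: inL2_mono.
pose G : 'M[R]_N := \matrix_(i, j) \int[mu]_(x in A) (b i x * b j x).
pose vec (c : mi -> R) : 'rV[R]_N := \row_i c (e i).
pose cof (v : 'rV[R]_N) : mi -> R := fun m => v ord0 (enum_rank m).
have vecE c x : peval c x = \sum_i vec c ord0 i * b i x.
  rewrite /peval (reindex_onto e enum_rank) => [|m _]; last exact: enum_rankK.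
  by apply: eq_big => i; rewrite ?enum_valK ?eqxx// mxE.
have cofK v : vec (cof v) = v.
  by apply/rowP => i; rewrite mxE /cof enum_valK.
have GE c i : (vec c *m G) ord0 i = \int[mu]_(x in A) (peval c x * b i x).
  pose g j x := vec c ord0 j * (b j x * b i x).
  have bb j : mu.-integrable A (EFin \o (fun x => b j x * b i x)).
    exact: inL2M_integrable.
  have gI j : mu.-integrable A (EFin \o g j).
    by have := integrableZl mA (vec c ord0 j) (bb j); apply: eq_integrable.
  have [_ sumE] := integrable_Rintegral_sum (index_enum 'I_N) mA gI.
  rewrite mxE (eq_bigr (fun j => \int[mu]_(x in A) g j x)) => [|j _]; last first.
    by rewrite [G j i]mxE RintegralZl.
  rewrite -sumE; apply: eq_Rintegral => x _.
  by rewrite vecE mulr_suml; apply: eq_bigr => j _; rewrite /g mulrA.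
(* A vector in the kernel of [G] gives a polynomial orthogonal to all monomials, hence to itself,
   hence zero on the open set [A]. *)
have kerG (v : 'rV[R]_N) : v *m G = 0 -> forall x, A x -> peval (cof v) x = 0.
  move=> vG; apply: (continuous_Rintegral_sqr_eq0 oA (@peval_continuous _ _ _ (cof v))).
    by have [] := inL2_peval (cof v).
  have vG0 i : \int[mu]_(x in A) (peval (cof v) x * b i x) = 0.
    by rewrite -GE cofK vG mxE.
  have vb i : mu.-integrable A (EFin \o (fun x => v ord0 i * (peval (cof v) x * b i x))).
    have := integrableZl mA (v ord0 i) (inL2M_integrable mA (inL2_peval (cof v)) (bL i)).
    by apply: eq_integrable.
  have [_ vbE] := integrable_Rintegral_sum (index_enum 'I_N) mA vb.
  transitivity (\sum_i \int[mu]_(x in A) (v ord0 i * (peval (cof v) x * b i x))); last first.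
    apply: big1 => i _; rewrite RintegralZl ?vG0 ?mulr0//.
    by apply: inL2M_integrable => //; exact: inL2_peval.
  rewrite -vbE; apply: eq_Rintegral => x _.
  rewrite expr2 {2}vecE cofK mulr_sumr; apply: eq_bigr => i _.
  by rewrite mulrCA.
pose K := \sum_i \sum_j L2norm A (b i) * `|pinvmx G i j|.
have K0 : 0 <= K.
  by apply: sumr_ge0 => i _; apply: sumr_ge0 => j _; rewrite mulr_ge0// L2norm_ge0.
exists K => // c.
pose v := vec c *m G *m pinvmx G.
have vG : (vec c - v) *m G = 0.
  by rewrite mulmxBl /v mulmxKpV ?submxMl// subrr.
exists (cof v); split.
  move=> x Ax; apply/eqP; rewrite -subr_eq0 !vecE -sumrB.
  have := kerG _ vG x Ax; rewrite vecE cofK => H; rewrite -[X in _ == X]H; apply/eqP.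
  by apply: eq_bigr => i _; rewrite cofK -mulrBl !mxE.
move=> m; rewrite /cof /v mxE (le_trans (ler_norm_sum _ _ _))//.
rewrite /K mulr_suml; apply: ler_sum => i _.
apply: (@le_trans _ _ (L2norm A (b i) * `|pinvmx G i (enum_rank m)| * L2norm A (peval c))).
  rewrite normrM GE mulrAC ler_wpM2r// mulrC.
  by apply: L2_CauchySchwarz => //; exact: inL2_peval.
rewrite ler_wpM2r ?L2norm_ge0// (bigD1 (enum_rank m))//= lerDl.
by apply: sumr_ge0 => j _; rewrite mulr_ge0// L2norm_ge0.
Qed.

End coefficient_bound.

(** * Elements, faces and traces *)

Section convex_sets.
Context (R : realType) (n : nat).
Implicit Types C : set 'rV[R]_n.

Lemma rV_closureP C x : closure C x <->
  forall e : R, 0 < e -> exists2 y, C y & forall i, `|x ord0 i - y ord0 i| < e.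
Proof.
split=> [Cx e e0|H B /rV_nbhsP[e e0 xB]].
  have /Cx[y [Cy xy]] : nbhs x [set y : 'rV[R]_n | forall i, `|x ord0 i - y ord0 i| < e].
    by apply/rV_nbhsP; exists e.
  by exists y.
by have [y Cy xy] := H _ e0; exists y; split => //; exact: xB.
Qed.

Lemma small_multiple (w : 'rV[R]_n) (e : R) : 0 < e ->
  exists2 s : R, 0 < s & forall i, `|(s *: w) ord0 i| < e.
Proof.
move=> e0; pose M := 1 + \sum_i `|w ord0 i|.
have M0 : 0 < M by rewrite ltr_pwDl// sumr_ge0.
exists (e / M) => [|i]; first exact: divr_gt0.
rewrite mxE normrM gtr0_norm ?divr_gt0// mulrAC ltr_pdivrMr// ltr_pM2l//.
rewrite /M (bigD1 i)//= addrCA ltrDl ltr_pwDl// sumr_ge0//.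
Qed.

(** Elements are only known to lie in the closure of a subdomain; being open, they lie in its
    interior, and convexity brings them into the subdomain. The segment from [c0] to [x] is
    prolonged slightly beyond [x], up to [y], and [y] is approximated by a point [y'] of [C]. *)
Lemma interior_closure_convex C : open C -> convex_set C ->
  interior (closure C) `<=` C.
Proof.
move=> oC cC x ix.
have [c0 Cc0] : C !=set0.
  by have /rV_closureP/(_ _ ltr01)[y Cy _] := interior_subset ix; exists y.
have /rV_nbhsP[e e0 xe] : nbhs x (closure C) by [].
have /rV_nbhsP[r r0 cr] : nbhs c0 C by apply: open_nbhs_nbhs.
have [s s0 se] := small_multiple (c0 - x) e0.
pose y := x - s *: (c0 - x).
have /rV_closureP/(_ _ (mulr_gt0 s0 r0))[y' Cy' yy'] : closure C y.
  by apply: xe => i; rewrite !mxE opprD addrA subrr sub0r opprK; have := se i; rewrite !mxE.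
(* The error [y - y'] is moved to the other end, so that [x] is exactly the convex combination of
   [c'] and [y'] with weights [s / (1 + s)] and [1 / (1 + s)]. *)
pose c' := c0 + s^-1 *: (y - y').
have Cc' : C c'.
  apply: cr => i; rewrite /c' !mxE opprD addrA subrr sub0r normrN normrM.
  rewrite gtr0_norm ?invr_gt0// -(ltr_pM2l s0) mulrA mulfV ?gt_eqF// mul1r.
  by have := yy' i; rewrite !mxE.
have t0 : 0 <= s / (1 + s) by rewrite divr_ge0 ?addr_ge0// ltW.
have s1 : 0 < 1 + s by rewrite addr_gt0.
have t1 : s / (1 + s) <= 1 by rewrite ler_pdivrMr// mul1r lerDr.
have := cC c' y' (Itv01 t0 t1) (mem_set Cc') (mem_set Cy') => /set_mem.
suff -> : conv (Itv01 t0 t1) (c' : convex_lmodType _) y' = x by [].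
transitivity ((s / (1 + s)) *: c' + (1 - s / (1 + s)) *: y') => //.
by apply/rowP => i; rewrite !mxE; field; rewrite !gt_eqF.
Qed.

Lemma disjoint_open_closure (A B : set 'rV[R]_n) : open A -> A `&` B = set0 ->
  A `&` closure B = set0.
Proof.
move=> oA AB; apply/seteqP; split => // x [Ax Bx].
have [y [By Ay]] := Bx A (open_nbhs_nbhs (conj oA Ax)).
by have : (A `&` B) y; [split|rewrite AB].
Qed.

End convex_sets.

Section cells.
Context (R : realType) (n : nat) (P : problem R n) (D : discretization R n).
Hypotheses (hgeo : geometry P) (hmesh : is_mesh P D).
Implicit Types (k : cells D) (F : faces D).

Lemma elastic_sub k : elastic P k -> cell k `<=` Ome P.
Proof.
move=> /asboolP kO x kx; have [oO _ _ cO] := Ome_convex hgeo.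
apply: interior_closure_convex => //.
by apply: filterS kO _; apply: open_nbhs_nbhs; split => //; exact: cell_open hmesh k.
Qed.

Lemma acoustic_sub k : acoustic P k -> cell k `<=` Oma P.
Proof.
move=> /asboolP kO x kx; have [oO _ _ cO] := Oma_convex hgeo.
apply: interior_closure_convex => //.
by apply: filterS kO _; apply: open_nbhs_nbhs; split => //; exact: cell_open hmesh k.
Qed.

Lemma Ome_sub : Ome P `<=` Om P.
Proof.
move=> x Ox; have [oO _ _ cO] := Om_convex hgeo; have [oOe _ _ _] := Ome_convex hgeo.
apply: interior_closure_convex => //.
apply: (@filterS _ _ _ (Ome P)); last exact: open_nbhs_nbhs.
by move=> y Oy; rewrite (Om_split hgeo); left; exact: subset_closure.
Qed.

Lemma elastic_acoustic k : elastic P k -> acoustic P k -> False.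
Proof.
move=> ke ka; have [x kx] := cell_neq0 hmesh k.
have := Om_disjoint hgeo => /seteqP[+ _] => /(_ x); apply.
by split; [exact: elastic_sub ke _ kx|exact: acoustic_sub ka _ kx].
Qed.

(** Since [faces_e] and [faces_a] exclude the faces on the interface, this guarantees that their
    jumps and averages involve elements of a single kind. *)
Lemma interface_GammaI F k k' : owner F k -> owner F k' -> elastic P k ->
  acoustic P k' -> on_GammaI P F.
Proof.
move=> /asboolP Fk /asboolP Fk' /asboolP ke /asboolP ka; apply/asboolP => x Fx.
have [oOe _ _ _] := Ome_convex hgeo; have [oOa _ _ _] := Oma_convex hgeo.
have cl (A B : set 'rV[R]_n.+1) : A `<=` closure B -> closure A `<=` closure B.
  by move=> AB; have /closure_id -> := @closed_closure _ B; exact: closureS.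
have [xk _] := Fk x Fx; have [xk' _] := Fk' x Fx.
have xe : closure (Ome P) x by exact: cl ke _ xk.
have xa : closure (Oma P) x by exact: cl ka _ xk'.
split; split => //; rewrite -/(interior _).
- move=> /interior_subset Ox.
  by have := disjoint_open_closure oOe (Om_disjoint hgeo) => /seteqP[+ _] => /(_ x); apply.
- move=> /interior_subset Ox.
  have := @disjoint_open_closure _ _ _ (Ome P) oOa.
  rewrite setIC => /(_ (Om_disjoint hgeo)) /seteqP[+ _] => /(_ x); apply.
  by split.
Qed.

Lemma face_owner F : exists k, owner F k.
Proof. by case: (face_kind hmesh F) => [[k [k' [_ Fk _]]]|[_ [k Fk]]]; exists k. Qed.

Lemma faces_e_owner F k : faces_e P F -> owner F k -> elastic P k.
Proof.
move=> /andP[/existsP[k' /andP[Fk' k'e]] FI] Fk.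
have /orP[//|ka] := cell_kind hmesh k.
by rewrite (interface_GammaI Fk' Fk k'e ka) in FI.
Qed.

Lemma faces_a_owner F k : faces_a P F -> owner F k -> acoustic P k.
Proof.
move=> /andP[/existsP[k' /andP[Fk' k'a]] FI] Fk.
have /orP[ke|//] := cell_kind hmesh k.
by rewrite (interface_GammaI Fk Fk' ke k'a) in FI.
Qed.

Lemma cell_bounded k : coord_bounded (cell k).
Proof.
have [I [V [_ kV]]] := cell_polytope hmesh k.
have [M MP] := choice (fun i => csimplex_bounded (V i)).
exists (\sum_i `|M i|) => x kx j.
have : closure (cell k) x by exact: subset_closure.
rewrite kV => -[i _ Vi]; rewrite (le_trans (MP i x Vi j))//.
by rewrite (le_trans (ler_norm _))// (bigD1 i)//= lerDl sumr_ge0.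
Qed.

Lemma measurable_cell k : measurable (cell k).
Proof. by apply: open_measurable_rV; exact: cell_open hmesh k. Qed.

Lemma fnorm_ge0 p q (A : 'M[R]_(p, q)) : 0 <= fnorm A.
Proof. exact: sqrtr_ge0. Qed.

Lemma frob_ge0 p q (A : 'M[R]_(p, q)) : 0 <= frob A A.
Proof. by apply: sumr_ge0 => i _; apply: sumr_ge0 => j _; rewrite -expr2 sqr_ge0. Qed.

Lemma fnorm_sqr p q (A : 'M[R]_(p, q)) : fnorm A ^+ 2 = frob A A.
Proof. by rewrite sqr_sqrtr// frob_ge0. Qed.

Lemma le_fnorm p q (A : 'M[R]_(p, q)) i j : `|A i j| <= fnorm A.
Proof.
rewrite -(ler_pXn2r (n := 2)) ?nnegrE ?fnorm_ge0// real_normK ?num_real//.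
rewrite fnorm_sqr /frob (bigD1 i)//= (bigD1 j)//= -expr2 -addrA lerDl.
by rewrite addr_ge0// sumr_ge0// => i' _; rewrite ?sumr_ge0// => *; rewrite -expr2 sqr_ge0.
Qed.

Lemma fnorm_bounded p q (A : 'M[R]_(p, q)) B : 0 <= B ->
  (forall i j, `|A i j| <= B) -> fnorm A <= Num.sqrt (p * q)%:R * B.
Proof.
move=> B0 AB; rewrite -[leRHS]ger0_norm ?mulr_ge0 ?sqrtr_ge0// -sqrtr_sqr.
rewrite ler_wsqrtr// exprMn sqr_sqrtr//.
apply: (@le_trans _ _ (\sum_(i < p) \sum_(j < q) B ^+ 2)).
  apply: ler_sum => i _; apply: ler_sum => j _.
  by rewrite -expr2 -[leLHS]real_normK ?num_real// lerXn2r ?nnegrE.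
by rewrite !sumr_const !card_ord -mulrnA mulr_natl mulnC.
Qed.

Lemma diam_gt0 k : 0 < diam (cell k).
Proof.
have [x kx] := cell_neq0 hmesh k.
have /rV_nbhsP[e e0 xe] : nbhs x (cell k) by apply: open_nbhs_nbhs; split => //; exact: cell_open hmesh k.
pose y := x + (e / 2) *: delta_mx ord0 ord0.
have e2 : 0 < e / 2 by rewrite divr_gt0.
have ky : cell k y.
  apply: xe => i; rewrite /y !mxE opprD addrA subrr sub0r normrN eqxx/=.
  have [_|_] := eqVneq i ord0; last by rewrite mulr0 normr0.
  by rewrite mulr1 gtr0_norm// ltr_pdivrMr// ltr_pMr// ltr1n.
apply: (@lt_le_trans _ _ (fnorm (y - x))).
  apply: (@lt_le_trans _ _ `|(y - x) ord0 ord0|); last exact: le_fnorm.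
  by rewrite /y !mxE addrAC subrr add0r !eqxx/= mulr1 normr_gt0 gt_eqF.
apply: sup_upper_bound; last by exists y => //; exists x.
split; first by exists (fnorm (y - x)), y => //; exists x.
have [M MP] := cell_bounded k.
have M0 : 0 <= M by apply: le_trans (MP x kx ord0).
exists (Num.sqrt (1 * n.+1)%:R * (M + M)) => _ [a ka [b kb <-]].
apply: fnorm_bounded; first exact: addr_ge0.
move=> i j; rewrite ord1 !mxE (le_trans (ler_normB _ _))// lerD//; exact: MP.
Qed.

End cells.

Section cell_polynomials.
Context (R : realType) (n : nat) (P : problem R n) (D : discretization R n).
Hypotheses (hgeo : geometry P) (hmesh : is_mesh P D).
Variables (cT : R).
Hypothesis hreg : mesh_regular D cT.
Implicit Types (k : cells D) (F : faces D) (g : 'rV[R]_n.+1 -> R).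

(* Same as [poly_on], with a fixed finite family of monomials: only each partial
   degree is bounded by p. *)
Definition cell_pol k p g (c : {ffun 'I_n.+1 -> 'I_p.+1} -> R) :=
  forall x, cell k x -> g x = peval c x.

Definition cell_poly k p g := exists c, @cell_pol k p g c.

Lemma poly_on_cell_poly k p g : poly_on (cell k) p g -> cell_poly k p g.
Proof.
move=> [q [qp gq]].
have [c cE] : is_pol p (fun x : 'rV[R]_n.+1 => \sum_(m <- mpoly.msupp q)
    mpoly.mcoeff m q * \prod_i x ord0 i ^+ mpoly.fun_of_multinom m i).
  apply: is_pol_sum qp _ => m mp'; apply: is_polZ.
  have mp i : (mpoly.fun_of_multinom m i < p.+1)%N.
    rewrite ltnS (leq_trans _ mp')// mpoly.mdegE (bigD1 i)//=.
    exact: leq_addr.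
  have [c cE] := is_pol_mono R [ffun i => Ordinal (mp i)].
  exists c => x; rewrite -cE /mono; apply: eq_bigr => i _.
  by rewrite ffunE.
by exists c => x kx; rewrite gq// mpoly.mevalE -cE.
Qed.

Lemma cell_poly_lin k p g1 g2 a : cell_poly k p g1 -> cell_poly k p g2 ->
  cell_poly k p (fun x => a * g1 x + g2 x).
Proof.
move=> [c1 E1] [c2 E2].
have [c cE] := is_polD (is_polZ a (ex_intro _ c1 (fun=> erefl))) (ex_intro _ c2 (fun=> erefl)).
by exists c => x kx; rewrite -cE E1// E2.
Qed.

Lemma eq_cell_poly k p g1 g2 : (forall x, cell k x -> g1 x = g2 x) ->
  cell_poly k p g1 -> cell_poly k p g2.
Proof. by move=> gE [c cE]; exists c => x kx; rewrite -gE// cE. Qed.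

Lemma cell_pol_derive k p j : exists d, forall g c, @cell_pol k p g c ->
  @cell_pol k p (fun x => 'D_(delta_mx ord0 j) g x) (fun m' => \sum_m c m * d m m').
Proof.
have [d dP] := peval_derive R p j; exists d => g c gc x kx.
rewrite -(@derive_val _ _ _ _ _ _ _ (dP c x)).
apply: near_eq_derive.
apply: (@filterS _ _ _ (cell k)); first by move=> y ky; exact: gc.
by apply: open_nbhs_nbhs; split => //; exact: cell_open hmesh k.
Qed.

(** The trace is the limit of a continuous polynomial. Membership of [x] in the closure makes the
    filter proper, so that [lim] is the expected value. *)
Lemma strc_peval k p g c x : @cell_pol k p g c -> closure (cell k) x ->
  strc k g x = peval c x.
Proof.
move=> gc kx; rewrite /strc; apply: cvg_lim => //.
have PF : ProperFilter (within (cell k) (nbhs x)).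
  by apply: within_nbhs_proper.
apply: (@cvg_trans _ (peval c y @[y --> within (cell k) (nbhs x)])); last first.
  by apply: cvg_within_filter; exact: peval_continuous.
apply: near_eq_cvg; apply: filterS (withinT _ _) => y ky.
by rewrite gc.
Qed.

Lemma owner_closure k F x : owner F k -> face F x -> closure (cell k) x.
Proof. by move=> /asboolP H /H[]. Qed.

Lemma face_param F (s : 'rV[R]_n) : ref_simplex s -> face F (vtx F ord0 + s *m edges (vtx F)).
Proof.
move=> [s0 s1].
pose w (i : 'I_n.+1) := oapp (fun j => s ord0 j) (1 - \sum_j s ord0 j) (unlift ord0 i).
have w0 : w ord0 = 1 - \sum_j s ord0 j.
  by rewrite /w; case: unliftP => [j /eqP|//]; rewrite eq_liftF.
have wS i : w (lift ord0 i) = s ord0 i by rewrite /w liftK.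
exists w; split.
- move=> i; case: (unliftP ord0 i) => [j|] ->; first by rewrite wS.
  by rewrite w0 subr_ge0.
- rewrite big_ord_recl w0 [X in _ + X](eq_bigr (fun i => s ord0 i)) ?subrK//.
- rewrite mulmx_edges big_ord_recl w0.
  rewrite [in RHS](eq_bigr (fun i => s ord0 i *: vtx F (lift ord0 i))); last first.
    by move=> i _; rewrite wS.
  rewrite (eq_bigr (fun i => s ord0 i *: vtx F (lift ord0 i) - s ord0 i *: vtx F ord0)).
    rewrite sumrB -scaler_suml scalerBl scale1r.
    by apply/rowP => i; rewrite !mxE; ring.
  by move=> i _; rewrite scalerBr.
Qed.

Lemma eq_face_int F (g1 g2 : 'rV[R]_n.+1 -> R) :
  (forall x, face F x -> g1 x = g2 x) -> face_int (vtx F) g1 = face_int (vtx F) g2.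
Proof.
move=> gE; rewrite /face_int; congr (_ * _); apply: eq_Rintegral => s /set_mem sr.
by apply: gE; exact: face_param.
Qed.

(** The square of [n + 1] comes from the reference simplex, the square of [n + 2] from the degree
    along lines, the quotient from the change of variables and the last factor from mesh regularity;
    the absolute value makes nonnegativity immediate. *)
Definition trace_const : R := n.+1%:R ^+ 2 * n.+2%:R ^+ 2 *
  (fine (leb R n.+1 (@ref_simplex R n.+1)) / fine (leb R n (@ref_simplex R n))) *
  (`|cT| * n.+1%:R).

Lemma trace_const_ge0 : 0 <= trace_const.
Proof.
by rewrite /trace_const !mulr_ge0 ?sqr_ge0// ?invr_ge0 fine_ge0.
Qed.

Lemma cell_trace k p g : (1 <= p)%N -> cell_poly k p g ->
  \sum_(F : faces D | owner F k) face_int (vtx F) (fun x => strc k g x ^+ 2) <=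
  trace_const * (p%:R ^+ 2 / diam (cell k)) * \int[leb R n.+1]_(x in cell k) (g x ^+ 2).
Proof.
move=> p1 [c gc]; have [a [a1 a2 a3 a4]] := hreg k.
pose Ko F := osimplex (apex_cone (vtx F) (a F)).
have dk := diam_gt0 hmesh k.
have bk := cell_bounded hmesh k.
have mk := measurable_cell hmesh k.
have mKo F : owner F k -> measurable (Ko F).
  move=> /a1[/= fr' _]; have fr : affine_free (apex_cone (vtx F) (a F)) by exact: fr'.
  refine (measurable_cone_set fr (osimplex_cone_param fr) (@measurable_oref_simplex R n.+1)).
have gL2 : inL2 (cell k) (peval c).
  by apply: inL2_peval => //; exact: cell_open hmesh k.
have gI : \int[leb R n.+1]_(x in cell k) (g x ^+ 2) =
    \int[leb R n.+1]_(x in cell k) (peval c x ^+ 2).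
  by apply: eq_Rintegral => x /set_mem kx; rewrite gc.
have one F : owner F k -> face_int (vtx F) (fun x => strc k g x ^+ 2) <=
    trace_const * (p%:R ^+ 2 / diam (cell k)) *
    \int[leb R n.+1]_(x in Ko F) (peval c x ^+ 2).
  move=> Fk; have [fr' Ksub] := a1 F Fk.
  have fr : affine_free (apex_cone (vtx F) (a F)) by exact: fr'.
  have dle := a4 F Fk.
  set vol := fine _ in dle; set area := face_area _ in dle.
  have cTn : 0 <= vol by exact: fine_ge0.
  (* Division by zero has value 0, so a vanishing area would make the regularity bound on the
     positive diameter nonpositive. *)
  have areaN0 : area != 0.
    by apply: contraTneq dle => ->; rewrite invr0 !mulr0 -ltNge.
  have volN0 : vol != 0.
    by apply: contraTneq dle => ->; rewrite mulr0 mul0r mulr0 -ltNge.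
  have area0 : 0 <= area.
    by rewrite mulr_ge0 ?sqrtr_ge0//; apply: Rintegral_ge0.
  have area_gt0 : 0 < area by rewrite lt_neqAle eq_sym areaN0.
  have vol_gt0 : 0 < vol by rewrite lt_neqAle eq_sym volN0.
  have ratio : area / vol <= `|cT| * n.+1%:R / diam (cell k).
    rewrite ler_pdivrMr// mulrAC ler_pdivlMr// mulrC.
    apply: (le_trans (ler_wpM2r area0 dle)).
    rewrite -!mulrA mulVf// mulr1 ler_wpM2r//; last exact: ler_norm.
    by rewrite mulr_ge0.
  have iG : (leb R n.+1).-integrable (Ko F) (fun x => (peval c x ^+ 2)%:E).
    by apply: integrableS gL2.2 => //; exact: mKo.
  rewrite (@eq_face_int _ _ (fun x => peval c x ^+ 2)); last first.
    by move=> x Fx; rewrite (strc_peval gc)//; exact: owner_closure Fx.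
  apply: le_trans (simplex_trace fr (measurable_peval c) (line_poly_peval c) iG areaN0 volN0) _.
  rewrite ler_wpM2r//; first by apply: Rintegral_ge0 => x _; exact: sqr_ge0.
  rewrite -/area -/vol /trace_const.
  set q := _ / fine _; have q0 : 0 <= q by rewrite divr_ge0// fine_ge0.
  (* Here [p >= 1] is used: [(n + 1) p + 1 <= (n + 2) p]. *)
  have dp : (n.+1 * p).+1%:R ^+ 2 <= n.+2%:R ^+ 2 * p%:R ^+ 2 :> R.
    rewrite -exprMn lerXn2r ?nnegrE ?mulr_ge0// -natrM ler_nat.
    by rewrite [(n.+2 * p)%N]mulSn -add1n leq_add2r.
  apply: (@le_trans _ _ (n.+1%:R ^+ 2 * (n.+2%:R ^+ 2 * p%:R ^+ 2) * q *
      (`|cT| * n.+1%:R / diam (cell k)))).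
    apply: ler_pM => //; last by rewrite ler_wpM2r// ler_wpM2l ?sqr_ge0.
      by apply: mulr_ge0 => //; apply: mulr_ge0; exact: sqr_ge0.
    by rewrite divr_ge0.
  rewrite le_eqVlt; apply/orP; left; apply/eqP; ring.
apply: (le_trans (ler_sum _ one)).
rewrite -mulr_sumr; apply: ler_wpM2l.
  by rewrite mulr_ge0 ?trace_const_ge0// divr_ge0 ?sqr_ge0// ltW.
rewrite gI; set G := fun x => peval c x ^+ 2.
have G0 x : 0 <= G x by exact: sqr_ge0.
have iG (B : set 'rV[R]_n.+1) : measurable B -> B `<=` cell k ->
    (leb R n.+1).-integrable B (EFin \o G).
  by move=> mB Bk; apply: integrableS gL2.2.
(* The simplices attached to the faces are disjoint inside the element, so their integrals add up to
   an integral over their union [B]; the number of faces does not enter. Disjointness of [B] from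
   the simplices not yet treated carries the induction. *)
suff H (s : seq (faces D)) : uniq s -> all (fun F => owner F k) s -> exists B : set 'rV[R]_n.+1,
    [/\ measurable B, B `<=` cell k, forall F, F \notin s -> owner F k -> B `&` Ko F = set0 &
    \sum_(F <- s) \int[leb R n.+1]_(x in Ko F) G x = \int[leb R n.+1]_(x in B) G x].
  rewrite -big_filter.
  have [||B [mB Bk _ ->]] := H [seq F <- index_enum (faces D) | owner F k].
  - by rewrite filter_uniq// index_enum_uniq.
  - exact: filter_all.
  apply: fine_le; [exact: integrable_fin_num (iG _ mB Bk)|
    exact: integrable_fin_num (iG _ mk (@subset_refl _ _))|].
  apply: ge0_subset_integral => //; last by move=> x _; rewrite lee_fin.
  by apply/measurable_EFinP; exact: measurable_funX gL2.1.
elim: s => [_ _|F s IHs /= /andP[Fs us] /andP[Fk sk]].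
  exists set0; split => //; first by move=> ? ? ?; rewrite set0I.
  by rewrite big_nil Rintegral_set0.
have [B [mB Bk BK Bs]] := IHs us sk.
have mKF := mKo F Fk.
have KFk : Ko F `<=` cell k by have [_] := a1 F Fk.
exists (Ko F `|` B); split.
- exact: measurableU.
- by move=> x [/KFk|/Bk].
- move=> F'; rewrite inE negb_or => /andP[FF' Fs'] Fk'.
  by rewrite setIUl BK// setU0; apply: a2 => //; rewrite eq_sym.
- rewrite big_cons Bs Rintegral_setU//.
    by apply: iG; [exact: measurableU|move=> x [/KFk|/Bk]].
  by rewrite disj_set2E setIC BK.
Qed.

End cell_polynomials.

(** * Opposite normals on interfaces *)

Section generic_points.
Context (R : realType) (n : nat).

Lemma csimplex_ref_param (V : 'I_n.+1 -> 'rV[R]_n.+1) x : csimplex V x ->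
  exists2 y : 'rV[R]_n, ref_simplex y & x = V ord0 + y *m edges V.
Proof.
move=> [w [w0 w1 ->]]; exists (\row_i w (lift ord0 i)).
  split=> [i|]; first by rewrite mxE.
  rewrite (eq_bigr (fun i => w (lift ord0 i))) => [|i _]; last by rewrite mxE.
  by rewrite -w1 big_ord_recl lerDr.
rewrite mulmx_edges.
transitivity ((\sum_i w i) *: V ord0 + \sum_i w i *: (V i - V ord0)).
  by rewrite scaler_suml -big_split/=; apply: eq_bigr => i _; rewrite scalerBr addrC subrK.
rewrite w1 scale1r [in LHS]big_ord_recl subrr scaler0 add0r; congr (_ + _).
by apply: eq_bigr => i _; rewrite mxE.
Qed.

Lemma oref_osimplex (V : 'I_n.+1 -> 'rV[R]_n.+1) (y : 'rV[R]_n) : oref_simplex y ->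
  osimplex V (V ord0 + y *m edges V).
Proof.
move=> [y0 y1].
pose w (i : 'I_n.+1) := oapp (fun j => y ord0 j) (1 - \sum_j y ord0 j) (unlift ord0 i).
have w0 : w ord0 = 1 - \sum_j y ord0 j.
  by rewrite /w; case: unliftP => [j /eqP|//]; rewrite eq_liftF.
have wS i : w (lift ord0 i) = y ord0 i by rewrite /w liftK.
have w1 : \sum_i w i = 1.
  rewrite big_ord_recl w0; have -> : \sum_i w (lift ord0 i) = \sum_i y ord0 i by exact: eq_bigr.
  by rewrite subrK.
exists w; split => //.
  move=> i; case: (unliftP ord0 i) => [j|] ->; first by rewrite wS.
  by rewrite w0 subr_gt0.
rewrite mulmx_edges.
transitivity ((\sum_i w i) *: V ord0 + \sum_i w i *: (V i - V ord0)); last first.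
  by rewrite scaler_suml -big_split/=; apply: eq_bigr => i _; rewrite scalerBr addrC subrK.
rewrite w1 scale1r [in RHS]big_ord_recl subrr scaler0 add0r; congr (_ + _).
by apply: eq_bigr => i _; rewrite wS.
Qed.

(* A point of the simplex V' outside its relative interior has its barycentric
   coordinate with respect to the apex a' equal to 0, as well as another one; these
   two affine functions cannot both vanish on the n-dimensional simplex V. *)
Lemma negligible_simplex_meet (V V' : 'I_n.+1 -> 'rV[R]_n.+1) (a' : 'rV[R]_n.+1) :
  (0 < n)%N -> affine_free V -> affine_free (apex_cone V' a') ->
  (leb R n).-negligible [set s | csimplex V' (V ord0 + s *m edges V) /\
    ~ osimplex V' (V ord0 + s *m edges V)].
Proof.
move=> n0 frV frV'; have uM := cone_mx_unit frV'.
pose N := invmx (cone_mx V' a'); pose B := edges V *m N.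
pose z0 := (V ord0 - V' ord0) *m N.
have zE s y : V ord0 + s *m edges V = V' ord0 + y *m edges V' ->
    rV_cons (0, y) = z0 + s *m B.
  move=> sy; have : cone_param V' a' (rV_cons (0, y)) = V ord0 + s *m edges V.
    by rewrite cone_param_cons scale0r addr0.
  rewrite /cone_param => /(canRL (addrK _)) /(congr1 (fun M => M *m N)).
  rewrite mulmxK// => ->; rewrite /z0 /B mulmxA -mulmxDl; congr (_ *m _).
  by rewrite addrAC.
have frB : row_free B.
  by rewrite /row_free /B mxrankMfree ?row_free_unit ?unitmx_inv.
have mulcol k m (M : 'M[R]_(k, m)) (s : 'rV_k) j : (s *m col j M) ord0 ord0 = (s *m M) ord0 j.
  by rewrite !mxE; apply: eq_bigr => i _; rewrite mxE.
clearbody B z0.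
have [c0|c0] := boolP ((col ord0 B != 0) || (z0 ord0 ord0 != 0)).
  apply: negligibleS (_ : (leb R n).-negligible
      [set s | (s *m col ord0 B) ord0 ord0 = - z0 ord0 ord0]); last first.
    apply/negligibleP; first exact: measurable_hyperplane.
    by apply: leb_hyperplane; rewrite oppr_eq0.
  move=> s [/csimplex_ref_param[y _ /zE] yE _] /=.
  have := congr1 (fun M : 'rV[R]_n.+1 => M ord0 ord0) yE; rewrite /= rV_cons0 mxE.
  by rewrite mulcol; move=> /esym/eqP; rewrite addrC addr_eq0 => /eqP.
move: c0; rewrite negb_or !negbK => /andP[/eqP cB /eqP z00].
pose B' : 'M[R]_n := \matrix_(i, j) B i (lift ord0 j).
have BB' (u : 'rV[R]_n) j : (u *m B) ord0 (lift ord0 j) = (u *m B') ord0 j.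
  by rewrite !mxE; apply: eq_bigr => i _; rewrite mxE.
(* In this case the height over [V'] vanishes identically on [V]. The injectivity of [B] then rests
   on its other [n] columns, so no other barycentric coordinate is constant on [V]. *)
have uB' : B' \in unitmx.
  rewrite -row_free_unit; apply/inj_row_free => u uB'.
  apply/eqP; rewrite -(mulmx_free_eq0 _ frB); apply/eqP/rowP => j.
  case: (unliftP ord0 j) => [k|] ->; first by rewrite BB' uB' !mxE.
  by rewrite -mulcol cB mulmx0 !mxE.
have inj (v : 'cV[R]_n) : B' *m v = 0 -> v = 0.
  by move=> /(congr1 (mulmx (invmx B'))); rewrite mulKmx// mulmx0.
pose w (o : option 'I_n) : 'cV[R]_n :=
  oapp (fun i => col i B') (- (B' *m const_mx 1)) o.
pose b (o : option 'I_n) : R :=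
  oapp (fun i => - z0 ord0 (lift ord0 i)) (\sum_k z0 ord0 (lift ord0 k) - 1) o.
apply: negligibleS (leb_null_hyperplanes (w := w) (b := b) _); last first.
  move=> [i|] /=; apply/orP; left; apply/eqP.
    rewrite colE => /inj /colP/(_ i)/eqP.
    by rewrite !mxE !eqxx/= oner_eq0.
  move/eqP; rewrite oppr_eq0 => /eqP/inj/colP/(_ (Ordinal n0))/eqP.
  by rewrite !mxE oner_eq0.
move=> s [/csimplex_ref_param[y [y0 y1] ye] nos].
have yE i : y ord0 i = z0 ord0 (lift ord0 i) + (s *m B') ord0 i.
  have := congr1 (fun M : 'rV[R]_n.+1 => M ord0 (lift ord0 i)) (zE _ _ ye).
  by rewrite /= rV_consS => ->; rewrite mxE BB'.
have [/forallP yp|/forallPn[i]] := boolP [forall i, 0 < y ord0 i]; last first.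
  rewrite -leNgt => yi; exists (Some i) => /=; rewrite mulcol.
  have : y ord0 i = 0 by apply/eqP; rewrite eq_le yi y0.
  by rewrite yE => /eqP; rewrite addrC addr_eq0 => /eqP.
exists None => /=; have yy : \sum_i y ord0 i = 1.
  apply/eqP; rewrite eq_le y1/= leNgt; apply/negP => y1'.
  by apply: nos; rewrite ye; exact: oref_osimplex.
have ys : \sum_i y ord0 i = \sum_k z0 ord0 (lift ord0 k) + \sum_i (s *m B') ord0 i.
  by rewrite -big_split; apply: eq_bigr => i _; exact: yE.
by rewrite mulmxN mxE mulmxA -sum_coordE -yy ys opprD addrA subrr add0r.
Qed.

End generic_points.

Section normals.
Context (R : realType) (n : nat) (P : problem R n) (D : discretization R n).
Hypotheses (n0 : (0 < n)%N) (hgeo : geometry P) (hmesh : is_mesh P D).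
Variables (cT : R).
Hypothesis hreg : mesh_regular D cT.
Implicit Types (k : cells D) (F : faces D).

Lemma face_apex F : exists a, affine_free (apex_cone (vtx F) a).
Proof.
have [k Fk] := face_owner hmesh F.
have [a [a1 _ _ _]] := hreg k; have [fr _] := a1 F Fk.
by exists (a F).
Qed.

(** The open simplices of distinct faces are disjoint, so another face can meet the interior of [F]
    only through its own relative boundary, which is negligible in the parameter of [F]. There are
    finitely many faces, and a cube of parameters has positive measure. *)
Lemma face_generic_point F : exists2 x, osimplex (vtx F) x &
  forall F', F' != F -> ~ face F' x.
Proof.
pose phi (s : 'rV[R]_n) := vtx F ord0 + s *m edges (vtx F).
pose N F' := [set s | csimplex (vtx F') (phi s) /\ ~ osimplex (vtx F') (phi s)].
have negN F' : (leb R n).-negligible (N F').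
  have [a' fr'] := face_apex F'.
  apply: negligible_simplex_meet fr' => //; exact: face_simplex hmesh F.
have negU (s : seq (faces D)) : (leb R n).-negligible [set x | exists2 F', F' \in s & N F' x].
  elim: s => [|F' s IHs]; first by apply: negligibleS (negligible_set0 _) => x [].
  apply: negligibleS (negligibleU (negN F') IHs) => x [F''].
  by rewrite inE => /predU1P[->|Fs Nx]; [left|right; exists F''].
(* The cube [[del, 2 del]^n] lies in the open reference simplex because its coordinates sum to at
   most [n / (n + 1)]. *)
pose del : R := (2 * n.+1%:R)^-1.
have del0 : 0 < del by rewrite invr_gt0 mulr_gt0// ltr0n.
have boxo : @box R n del (2 * del) `<=` @oref_simplex R n.
  move=> s bs; split; first by move=> i; have /andP[/(lt_le_trans del0)] := bs i.
  apply: (@le_lt_trans _ _ (\sum_(i < n) 2 * del)).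
    by apply: ler_sum => i _; have /andP[] := bs i.
  rewrite sumr_const card_ord -[_ *+ _]mulr_natr /del invfM mulrA mulfV ?pnatr_eq0// mul1r.
  by rewrite mulrC ltr_pdivrMr ?ltr0n// mul1r ltr_nat.
have [s [bs nN]] : exists s, box del (2 * del) s /\ forall F', ~ N F' s.
  apply: contrapT => H.
  have : (leb R n).-negligible (@box R n del (2 * del)).
    apply: negligibleS (negU (enum (faces D))) => s bs; apply: contrapT => nN; apply: H.
    exists s; split => // F' NF'; apply: nN; exists F' => //; exact: mem_enum.
  move=> neg; have : leb R n (@box R n del (2 * del)) = 0%E.
    by apply/negligibleP; [exact: measurable_box|].
  move/eqP; rewrite leb_box; last by rewrite ler_peMl ?ler1n// ltW.
  by rewrite (_ : 2 * del - del = del) ?eqe ?gt_eqF ?exprn_gt0//; ring.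
exists (phi s); first by apply: oref_osimplex; exact: boxo.
move=> F' FF' Fx; apply: (nN F'); split => // oF'.
have /seteqP[+ _] := face_disjoint hmesh FF'; move/(_ (phi s)); apply; split => //.
by apply: oref_osimplex; exact: boxo.
Qed.

Lemma frobDr p q (A B C : 'M[R]_(p, q)) : frob A (B + C) = frob A B + frob A C.
Proof.
rewrite /frob -big_split/=; apply: eq_bigr => i _; rewrite -big_split/=.
by apply: eq_bigr => j _; rewrite mxE mulrDr.
Qed.

Lemma frobZr p q (A B : 'M[R]_(p, q)) a : frob A (a *: B) = a * frob A B.
Proof.
rewrite /frob mulr_sumr; apply: eq_bigr => i _; rewrite mulr_sumr.
by apply: eq_bigr => j _; rewrite mxE mulrCA.
Qed.

Lemma frobC p q (A B : 'M[R]_(p, q)) : frob A B = frob B A.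
Proof. by apply: eq_bigr => i _; apply: eq_bigr => j _; rewrite mulrC. Qed.

Lemma frob_eq0 p q (A : 'M[R]_(p, q)) : frob A A = 0 -> A = 0.
Proof.
move=> A0; apply/matrixP => i j; rewrite mxE; apply/eqP; rewrite -normr_le0.
by rewrite (le_trans (le_fnorm A i j))// /fnorm A0 sqrtr0.
Qed.

(** Near a generic point both elements are half spaces. Were [u + v] nonzero, both [u] and [v] would
    have the positive product [1 + u.v] with it, and the points [x - s (u + v)] would belong to both
    elements, which are disjoint. *)
Lemma nrm_opposite F k k' : k != k' -> owner F k -> owner F k' ->
  nrm k' F = - nrm k F.
Proof.
move=> kk' Fk Fk'; have [x ox xF] := face_generic_point F.
have [u1 uN] := nrm_outer hmesh Fk; have [v1 vN] := nrm_outer hmesh Fk'.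
have xk := uN x ox xF; have xk' := vN x ox xF.
set u := nrm k F in u1 uN xk *; set v := nrm k' F in v1 vN xk' *.
have uu : frob u u = 1 by rewrite -fnorm_sqr u1 expr1n.
have vv : frob v v = 1 by rewrite -fnorm_sqr v1 expr1n.
have c0 : 0 <= 1 + frob u v.
  have := frob_ge0 (u + v); rewrite frobDr ![frob (u + v) _]frobC !frobDr uu vv (frobC v u).
  by lra.
have [c1|c1] := eqVneq (1 + frob u v) 0.
  have : frob (u + v) (u + v) = 0.
    by rewrite frobDr ![frob (u + v) _]frobC !frobDr uu vv (frobC v u); lra.
  by move=> /frob_eq0/eqP; rewrite addrC addr_eq0 => /eqP.
have c2 : 0 < 1 + frob u v by rewrite lt_neqAle eq_sym c1.
have /rV_nbhsP[e e0 xe] : \forall y \near x, ~ (frob (y - x) u < 0 /\ frob (y - x) v < 0).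
  near=> y => -[yu yv].
  have kuy : cell k y by apply/(near xk y).
  have kvy : cell k' y by apply/(near xk' y).
  by have /seteqP[+ _] := cell_disjoint hmesh kk'; move/(_ y); apply.
have [s s0 se] := small_multiple (u + v) e0.
exfalso; apply: (xe (x - s *: (u + v))).
  by move=> i; rewrite !mxE opprD addrA subrr sub0r opprK; have := se i; rewrite !mxE.
rewrite addrAC subrr add0r -scaleNr.
rewrite ![frob (_ *: _) _]frobC !frobZr !frobDr uu vv (frobC v u).
by rewrite [frob u v + 1]addrC mulNr oppr_lt0 mulr_gt0.
Unshelve. all: by end_near. Qed.

End normals.

(** * Bounded bilinear forms *)

Section bounded_forms.
Context (R : realType) (n : nat) (W : lmodType R).
Notation V := 'rV[R]_n.
Variables (X : (V -> W) -> Prop) (N : (V -> W) -> R).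

Hypothesis N0 : forall u, X u -> 0 <= N u.

Definition flin (a : R) (u v : V -> W) : V -> W := fun x => a *: u x + v x.

Definition bform (B : (V -> W) -> (V -> W) -> R) :=
  [/\ forall a u v w, X u -> X v -> X w -> B (flin a u v) w = a * B u w + B v w,
      forall a u v w, X u -> X v -> X w -> B w (flin a u v) = a * B w u + B w v &
      exists2 K : R, 0 <= K & forall u v, X u -> X v -> `|B u v| <= K * N u * N v].

(* Operators from functions to matrix fields on [S]; the bound is uniform in the point,
   which for the seminorm [N] = L2 norm is only possible on finite dimensional spaces. *)
Definition mbop m p q (S : set 'rV[R]_m) (L : (V -> W) -> 'rV[R]_m -> 'M[R]_(p, q)) :=
  [/\ forall u i j, X u -> measurable_fun S (fun x => L u x i j),
      forall a u v x, X u -> X v -> S x -> L (flin a u v) x = a *: L u x + L v x &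
      exists2 K : R, 0 <= K & forall u x i j, X u -> S x -> `|L u x i j| <= K * N u].

Lemma bformD B1 B2 : bform B1 -> bform B2 -> bform (fun u v => B1 u v + B2 u v).
Proof.
move=> [l1 r1 [K1 K10 b1]] [l2 r2 [K2 K20 b2]]; split.
- by move=> a u v w Xu Xv Xw; rewrite l1// l2//; ring.
- by move=> a u v w Xu Xv Xw; rewrite r1// r2//; ring.
- exists (K1 + K2) => [|u v Xu Xv]; first exact: addr_ge0.
  by rewrite (le_trans (ler_normD _ _))// !mulrDl lerD ?b1 ?b2.
Qed.

Lemma bformZ c B : bform B -> bform (fun u v => c * B u v).
Proof.
move=> [l1 r1 [K1 K10 b1]]; split.
- by move=> a u v w Xu Xv Xw; rewrite l1//; ring.
- by move=> a u v w Xu Xv Xw; rewrite r1//; ring.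
- exists (`|c| * K1) => [|u v Xu Xv]; first exact: mulr_ge0.
  by rewrite normrM -!mulrA ler_wpM2l// mulrA b1.
Qed.

Lemma bform_sum (I : finType) (Q : pred I) (B : I -> (V -> W) -> (V -> W) -> R) :
  (forall i, Q i -> bform (B i)) -> bform (fun u v => \sum_(i | Q i) B i u v).
Proof.
move=> HB; split.
- move=> a u v w Xu Xv Xw; rewrite mulr_sumr -big_split/=; apply: eq_bigr => i Qi.
  by have [l _ _] := HB i Qi; rewrite l.
- move=> a u v w Xu Xv Xw; rewrite mulr_sumr -big_split/=; apply: eq_bigr => i Qi.
  by have [_ r _] := HB i Qi; rewrite r.
have /choice[K KP] : forall i, exists K : R, Q i -> 0 <= K /\
    forall u v, X u -> X v -> `|B i u v| <= K * N u * N v.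
  move=> i; have [Qi|Qi] := boolP (Q i); last by exists 0.
  by have [_ _ [K K0 KB]] := HB i Qi; exists K.
exists (\sum_(i | Q i) K i) => [|u v Xu Xv].
  by apply: sumr_ge0 => i /KP[].
rewrite (le_trans (ler_norm_sum _ _ _))// !mulr_suml; apply: ler_sum => i /KP[_].
exact.
Qed.

Lemma eq_bform B1 B2 : (forall u v, B1 u v = B2 u v) -> bform B1 -> bform B2.
Proof.
by move=> E; rewrite (_ : B1 = B2)//; apply/funext => u; apply/funext => v.
Qed.

Section mbop_integral.
Context (m : nat) (S : set 'rV[R]_m).
Hypotheses (mS : measurable S) (bS : coord_bounded S).

Lemma mbop_integrable p q (L1 L2 : (V -> W) -> 'rV[R]_m -> 'M[R]_(p, q)) u v :
  mbop S L1 -> mbop S L2 -> X u -> X v ->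
  (leb R m).-integrable S (EFin \o (fun x => frob (L1 u x) (L2 v x))).
Proof.
move=> [m1 _ [K1 K10 b1]] [m2 _ [K2 K20 b2]] Xu Xv.
apply: (@integrable_bounded _ _ _ _ (\sum_(i < p) \sum_(j < q) (K1 * N u * (K2 * N v)))) => //.
  apply: measurable_sum => i; apply: measurable_sum => j.
  by apply: measurable_funM; [exact: m1|exact: m2].
move=> x Sx; rewrite (le_trans (ler_norm_sum _ _ _))//; apply: ler_sum => i _.
rewrite (le_trans (ler_norm_sum _ _ _))//; apply: ler_sum => j _.
by rewrite normrM ler_pM// ?b1 ?b2.
Qed.

Lemma bform_integral p q (L1 L2 : (V -> W) -> 'rV[R]_m -> 'M[R]_(p, q)) :
  (forall a u v, X u -> X v -> X (flin a u v)) ->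
  mbop S L1 -> mbop S L2 ->
  bform (fun u v => \int[leb R m]_(x in S) frob (L1 u x) (L2 v x)).
Proof.
move=> Xlin o1 o2; have [m1 l1 [K1 K10 b1]] := o1; have [m2 l2 [K2 K20 b2]] := o2.
split.
- move=> a u v w Xu Xv Xw; rewrite -Rintegral_lin//; try exact: mbop_integrable.
  apply: eq_Rintegral => x /set_mem Sx.
  by rewrite l1// frobC frobDr frobZr !(frobC (L2 w x)).
- move=> a u v w Xu Xv Xw; rewrite -Rintegral_lin//; try exact: mbop_integrable.
  apply: eq_Rintegral => x /set_mem Sx.
  by rewrite l2// frobDr frobZr.
have fS : 0 <= fine (leb R m S) by exact: fine_ge0.
exists (\sum_(i < p) \sum_(j < q) (K1 * K2) * fine (leb R m S)).
  by apply: sumr_ge0 => i _; apply: sumr_ge0 => j _; rewrite !mulr_ge0.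
move=> u v Xu Xv.
have i12 := mbop_integrable o1 o2 Xu Xv.
rewrite (le_trans (le_normr_Rintegral _ _))//.
apply: (@le_trans _ _ (\int[leb R m]_(x in S) (\sum_(i < p) \sum_(j < q) (K1 * N u * (K2 * N v))))).
  apply: le_Rintegral => //.
  - by have := integrable_norm i12.
  - apply: (@integrable_bounded _ _ _ _ (`|\sum_(i < p) \sum_(j < q) (K1 * N u * (K2 * N v))|)) => //.
  - move=> x Sx; rewrite (le_trans (ler_norm_sum _ _ _))//; apply: ler_sum => i _.
    rewrite (le_trans (ler_norm_sum _ _ _))//; apply: ler_sum => j _.
    by rewrite normrM ler_pM// ?b1 ?b2.
rewrite Rintegral_cst// le_eqVlt; apply/orP; left; apply/eqP.
have E (a : R) : \sum_(i < p) \sum_(j < q) a = q%:R * p%:R * a.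
  by rewrite !sumr_const !card_ord -mulrnA -[LHS]mulr_natl natrM.
move: (fine _) fS => f _; rewrite !E.
by move: (q%:R * p%:R) (N u) (N v) => b c d; ring.
Qed.
End mbop_integral.

Section mbop_closure.
Context (m : nat) (S : set 'rV[R]_m).

Lemma mbopZ p q c (L : (V -> W) -> 'rV[R]_m -> 'M[R]_(p, q)) :
  mbop S L -> mbop S (fun u x => c *: L u x).
Proof.
move=> [mL lL [K K0 bL]]; split.
- move=> u i j Xu; under eq_fun do rewrite mxE.
  by apply: measurable_funM => //; exact: mL.
- by move=> a u v x Xu Xv Sx; rewrite lL// scalerDr !scalerA mulrC.
- exists (`|c| * K) => [|u x i j Xu Sx]; first exact: mulr_ge0.
  by rewrite mxE normrM -mulrA ler_wpM2l// bL.
Qed.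

Lemma mbop_sum p q (I : finType) (Q : pred I) (L : I -> (V -> W) -> 'rV[R]_m -> 'M[R]_(p, q)) :
  (forall i, Q i -> mbop S (L i)) -> mbop S (fun u x => \sum_(i | Q i) L i u x).
Proof.
move=> HL; split.
- move=> u i j Xu.
  under eq_fun do rewrite summxE.
  under eq_fun do rewrite -big_filter.
  have : all Q [seq k <- index_enum I | Q k] by exact: filter_all.
  elim: [seq _ <- _ | _] => [_|k s IHs /= /andP[Qk Qs]].
    by under eq_fun do rewrite big_nil; exact: measurable_cst.
  under eq_fun do rewrite big_cons; apply: measurable_funD; last exact: IHs.
  by have [mk _ _] := HL k Qk; exact: mk.
- move=> a u v x Xu Xv Sx; rewrite scaler_sumr -big_split/=; apply: eq_bigr => i Qi.
  by have [_ l _] := HL i Qi; rewrite l.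
have /choice[K KP] : forall i, exists K : R, Q i -> 0 <= K /\
    forall u x a b, X u -> S x -> `|L i u x a b| <= K * N u.
  move=> i; have [Qi|Qi] := boolP (Q i); last by exists 0.
  by have [_ _ [K K0 KB]] := HL i Qi; exists K.
exists (\sum_(i | Q i) K i) => [|u x a b Xu Sx]; first by apply: sumr_ge0 => i /KP[].
rewrite summxE (le_trans (ler_norm_sum _ _ _))// mulr_suml; apply: ler_sum => i /KP[_].
exact.
Qed.

End mbop_closure.
End bounded_forms.

(** * Operators with polynomial values on an element *)

Section cell_operators.
Context (R : realType) (n : nat) (P : problem R n) (D : discretization R n).
Hypotheses (hgeo : geometry P) (hmesh : is_mesh P D).
Context (W : lmodType R).
Notation V := 'rV[R]_n.+1.
Variables (X : (V -> W) -> Prop) (N : (V -> W) -> R).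
Hypothesis N0 : forall u, X u -> 0 <= N u.
Hypothesis Xlin : forall a u v, X u -> X v -> X (flin a u v).

Definition sop m (S : set 'rV[R]_m) (l : (V -> W) -> 'rV[R]_m -> R) :=
  [/\ forall u, X u -> measurable_fun S (l u),
      forall a u v x, X u -> X v -> S x -> l (flin a u v) x = a * l u x + l v x &
      exists2 K : R, 0 <= K & forall u x, X u -> S x -> `|l u x| <= K * N u].

Lemma sop_sum m (S : set 'rV[R]_m) (I : finType) (Q : pred I) (a : I -> R)
    (l : I -> (V -> W) -> 'rV[R]_m -> R) :
  (forall i, Q i -> sop S (l i)) -> sop S (fun u x => \sum_(i | Q i) a i * l i u x).
Proof.
move=> Hl; split.
- move=> u Xu; under eq_fun do rewrite -big_filter.
  have : all Q [seq k <- index_enum I | Q k] by exact: filter_all.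
  elim: [seq _ <- _ | _] => [_|k s IHs /= /andP[Qk Qs]].
    by under eq_fun do rewrite big_nil; exact: measurable_cst.
  under eq_fun do rewrite big_cons; apply: measurable_funD; last exact: IHs.
  by have [mk _ _] := Hl k Qk; apply: measurable_funM => //; exact: mk.
- move=> b u v x Xu Xv Sx; rewrite mulr_sumr -big_split/=; apply: eq_bigr => i Qi.
  by have [_ li _] := Hl i Qi; rewrite li//; ring.
have /choice[K KP] : forall i, exists K : R, Q i -> 0 <= K /\
    forall u x, X u -> S x -> `|l i u x| <= K * N u.
  move=> i; have [Qi|Qi] := boolP (Q i); last by exists 0.
  by have [_ _ [K K0 KB]] := Hl i Qi; exists K.
exists (\sum_(i | Q i) `|a i| * K i) => [|u x Xu Sx].
  by apply: sumr_ge0 => i /KP[K0 _]; exact: mulr_ge0.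
rewrite (le_trans (ler_norm_sum _ _ _))// mulr_suml; apply: ler_sum => i /KP[K0 KB].
by rewrite normrM -mulrA ler_wpM2l// KB.
Qed.

Lemma eq_sop m (S : set 'rV[R]_m) l1 l2 : (forall u x, X u -> S x -> l1 u x = l2 u x) ->
  sop S l1 -> sop S l2.
Proof.
move=> E [ml ll [K K0 bl]]; split.
- move=> u Xu; apply: eq_measurable_fun (ml u Xu) => x /set_mem Sx; exact: E.
- by move=> a u v x Xu Xv Sx; rewrite -!E//; [exact: ll|exact: Xlin].
- by exists K => // u x Xu Sx; rewrite -E// bl.
Qed.

Lemma mbop_sop m p q (S : set 'rV[R]_m) (L : (V -> W) -> 'rV[R]_m -> 'M[R]_(p, q)) :
  (forall i j, sop S (fun u x => L u x i j)) -> mbop X N S L.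
Proof.
move=> HL; split.
- by move=> u i j Xu; have [mL _ _] := HL i j; exact: mL.
- move=> a u v x Xu Xv Sx; apply/matrixP => i j; rewrite !mxE.
  by have [_ lL _] := HL i j; rewrite lL.
have /choice[K KP] : forall ij : 'I_p * 'I_q, exists K : R, 0 <= K /\
    forall u x, X u -> S x -> `|L u x ij.1 ij.2| <= K * N u.
  by move=> [i j]; have [_ _ [K K0 KB]] := HL i j; exists K.
exists (\sum_ij K ij) => [|u x i j Xu Sx]; first by apply: sumr_ge0 => ij _; have [] := KP ij.
have [_ KB] := KP (i, j); rewrite (le_trans (KB u x Xu Sx))// ler_wpM2r ?N0//.
by rewrite (bigD1 (i, j))//= lerDl sumr_ge0// => ij _; have [] := KP ij.
Qed.

(* Operators whose values are polynomials on the element [k]. The bound on the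
   coefficients, rather than on the values, is what is inherited by derivatives and by
   traces on the boundary. *)
Definition cop k p (l : (V -> W) -> V -> R) :=
  (forall a u v x, X u -> X v -> cell k x -> l (flin a u v) x = a * l u x + l v x) /\
  exists2 K : R, 0 <= K & forall u, X u -> exists2 c, @cell_pol _ _ D k p (l u) c &
    forall m, `|c m| <= K * N u.

Lemma cop_cell_poly k p l u : cop k p l -> X u -> cell_poly k p (l u).
Proof. by move=> [_ [K _ H]] /H[c lc _]; exists c. Qed.

(** Entry point of the L2 norm: the Gram matrix argument converts an L2 bound on the element into a
    bound on coefficients. *)
Lemma cop_base k p (l : (V -> W) -> V -> R) :
  (forall a u v x, X u -> X v -> cell k x -> l (flin a u v) x = a * l u x + l v x) ->
  (forall u, X u -> cell_poly k p (l u)) ->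
  (forall u, X u -> L2norm (cell k) (l u) <= N u) ->
  cop k p l.
Proof.
move=> ll lp lN; split => //.
have oc : open (cell k) by exact: cell_open hmesh k.
have bc := cell_bounded hmesh k.
have [K K0 KP] := peval_coef_bound p oc bc.
exists K => // u Xu; have [c lc] := lp u Xu; have [c' [cc' c'K]] := KP c.
exists c' => [x kx|m]; first by rewrite lc// cc'.
rewrite (le_trans (c'K m))// ler_wpM2l// (le_trans _ (lN u Xu))//.
rewrite le_eqVlt; apply/orP; left; apply/eqP; rewrite /L2norm; congr Num.sqrt.
by apply: eq_Rintegral => x /set_mem kx; rewrite lc.
Qed.

(** Differentiation acts on coefficients by a fixed matrix, so it is bounded although it is not so
    on L2 functions. *)
Lemma cop_derive k p j l : cop k p l ->
  cop k p (fun u x => 'D_(delta_mx ord0 j) (l u) x).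
Proof.
move=> [ll [K K0 KP]]; have [d dP] := cell_pol_derive hmesh k p j; split.
  move=> a u v x Xu Xv kx.
  have [cu lcu _] := KP u Xu; have [cv lcv _] := KP v Xv.
  have lcw : cell_pol k (l (flin a u v)) (fun m => a * cu m + cv m).
    move=> y ky; rewrite ll// lcu// lcv// -pevalZ -pevalD.
    by rewrite /peval.
  rewrite (dP _ _ lcw x kx) (dP _ _ lcu x kx) (dP _ _ lcv x kx) -pevalZ -pevalD.
  rewrite /peval; apply: eq_bigr => m' _; congr (_ * _) => /=.
  by rewrite mulr_sumr -big_split/=; apply: eq_bigr => m _; ring.
exists (K * \sum_m \sum_m' `|d m m'|) => [|u Xu].
  by apply: mulr_ge0 => //; apply: sumr_ge0 => m _; apply: sumr_ge0.
have [c lc cK] := KP u Xu; exists (fun m' => \sum_m c m * d m m'); first exact: dP.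
move=> m'; rewrite (le_trans (ler_norm_sum _ _ _))// mulrAC mulr_sumr.
apply: ler_sum => m _; rewrite normrM ler_pM//.
by rewrite (bigD1 m')//= lerDl sumr_ge0.
Qed.

Lemma cop_sum k p (I : finType) (a : I -> R) (l : I -> (V -> W) -> V -> R) :
  (forall i, cop k p (l i)) -> cop k p (fun u x => \sum_i a i * l i u x).
Proof.
move=> Hl; split.
  move=> b u v x Xu Xv kx; rewrite mulr_sumr -big_split/=; apply: eq_bigr => i _.
  by have [li _] := Hl i; rewrite li//; ring.
have /choice[K KP] : forall i, exists K : R, 0 <= K /\ forall u, X u ->
    exists2 c, @cell_pol _ _ D k p (l i u) c & forall m, `|c m| <= K * N u.
  by move=> i; have [_ [K K0 KB]] := Hl i; exists K.
exists (\sum_i `|a i| * K i) => [|u Xu].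
  by apply: sumr_ge0 => i _; have [K0 _] := KP i; exact: mulr_ge0.
have /choice[c cP] : forall i, exists c, @cell_pol _ _ D k p (l i u) c /\
    forall m, `|c m| <= K i * N u.
  by move=> i; have [_ /(_ u Xu)[c lc cK]] := KP i; exists c.
exists (fun m => \sum_i a i * c i m) => [x kx|m].
  rewrite /peval; under [in RHS]eq_bigr do rewrite mulr_suml.
  rewrite exchange_big/=; apply: eq_bigr => i _.
  have [lc _] := cP i; rewrite lc// /peval mulr_sumr; apply: eq_bigr => m _.
  by rewrite mulrA.
rewrite (le_trans (ler_norm_sum _ _ _))// mulr_suml; apply: ler_sum => i _.
by have [_ cK] := cP i; rewrite normrM -mulrA ler_wpM2l// cK.
Qed.

Lemma eq_cop k p l1 l2 : (forall u x, X u -> cell k x -> l1 u x = l2 u x) ->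
  cop k p l1 -> cop k p l2.
Proof.
move=> E [ll [K K0 KP]]; split.
  by move=> a u v x Xu Xv kx; rewrite -!E//; [exact: ll|exact: Xlin].
exists K => // u Xu; have [c lc cK] := KP u Xu.
by exists c => // x kx; rewrite -E// lc.
Qed.

(** The trace is the value of the polynomial on the closure of the element, where all monomials are
    bounded. *)
Lemma cop_trace_sop k p l m (S : set 'rV[R]_m) (phi : 'rV[R]_m -> V) :
  measurable S -> measurable_fun setT phi -> (forall s, S s -> closure (cell k) (phi s)) ->
  cop k p l -> sop S (fun u s => strc k (l u) (phi s)).
Proof.
move=> mS mphi Sk [ll [K K0 KP]]; split.
- move=> u Xu; have [c lc _] := KP u Xu.
  apply: (@eq_measurable_fun _ _ _ _ _ (fun s => peval c (phi s))).
    by move=> s /set_mem Ss; rewrite (strc_peval lc)//; exact: Sk.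
  by apply: measurable_funTS; exact: measurableT_comp (measurable_peval c) mphi.
- move=> a u v s Xu Xv Ss; have [cu lcu _] := KP u Xu; have [cv lcv _] := KP v Xv.
  have lcw : cell_pol k (l (flin a u v)) (fun m => a * cu m + cv m).
    by move=> y ky; rewrite ll// lcu// lcv// -pevalZ -pevalD.
  have ks := Sk s Ss.
  by rewrite (strc_peval lcw)// (strc_peval lcu)// (strc_peval lcv)// -pevalZ -pevalD.
have cb : coord_bounded (closure (cell k)).
  have [M MP] := cell_bounded hmesh k.
  (* Points of the closure are within distance 1 of the element, so the bound grows by at most 1. *)
  exists (M + 1) => x /rV_closureP/(_ _ ltr01)[y ky xy] i.
  rewrite -[x ord0 i](subrK (y ord0 i)) (le_trans (ler_normD _ _))// addrC lerD//.
    exact: MP.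
  exact: ltW.
have [B B0 BP] := mono_bounded p cb.
exists ((\sum_(m : {ffun 'I_n.+1 -> 'I_p.+1}) K) * B) => [|u s Xu Ss].
  by apply: mulr_ge0 => //; exact: sumr_ge0.
have [c lc cK] := KP u Xu; rewrite (strc_peval lc); last exact: Sk.
rewrite (le_trans (ler_norm_sum _ _ _))// mulrAC mulr_suml mulr_suml.
apply: ler_sum => m' _; rewrite normrM ler_pM//; last by apply: BP; exact: Sk.
Qed.

Lemma cop_cell_sop k p l : cop k p l -> sop (cell k) l.
Proof.
move=> lc; apply: (@eq_sop _ _ (fun u x => strc k (l u) x)).
  move=> u x Xu kx; have [_ [K _ /(_ u Xu)[c lc' _]]] := lc.
  by rewrite (strc_peval lc') ?lc'//; exact: subset_closure.
apply: (@cop_trace_sop _ _ _ _ _ id) lc => //; first exact: measurable_cell hmesh k.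
exact: subset_closure.
Qed.

End cell_operators.

(** * The symmetric interior penalty form *)

Lemma sqr_sum_le (R : realType) (I : finType) (Q : pred I) (a : I -> R) :
  (\sum_(i | Q i) a i) ^+ 2 <= #|Q|%:R * \sum_(i | Q i) a i ^+ 2.
Proof.
rewrite mulrC -[X in _ <= _ * X]/(#|Q|%:R); apply: quadratic_ge0_discr => //.
  by apply: sumr_ge0 => i _; exact: sqr_ge0.
move=> t; rewrite -sum1_card natr_sum -mulrnAr -sumrMnl !mulr_sumr -!big_split/=.
apply: sumr_ge0 => i _; rewrite [X in 0 <= X](_ : _ = (a i + t) ^+ 2) ?sqr_ge0//.
ring.
Qed.

Section symmetric_interior_penalty.
Context (R : realType) (n : nat) (P : problem R n) (D : discretization R n).
Hypotheses (hgeo : geometry P) (hmesh : is_mesh P D).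
Variable cT : R.
Hypothesis hreg : mesh_regular D cT.
Context (W : lmodType R).
Notation V := 'rV[R]_n.+1.
Variables (X : (V -> W) -> Prop) (N : (V -> W) -> R).
Hypothesis N0 : forall u, X u -> 0 <= N u.
Hypothesis Xlin : forall a u v, X u -> X v -> X (flin a u v).

Variables (sel : pred (cells D)) (fsel : pred (faces D)) (p q : nat).
Variables (deg : cells D -> nat) (w : cells D -> R) (pen : faces D -> R) (alpha : R).
Variables (sig ep : (V -> W) -> V -> 'M[R]_(p, q)).
Variables (g : cells D -> (V -> W) -> V -> 'M[R]_(p, q)).
Variables (jmp : faces D -> (V -> W) -> V -> 'M[R]_(p, q)).

Notation phi F := (fun s : 'rV[R]_n => vtx F ord0 + s *m edges (vtx F)).
Notation rS := (@ref_simplex R n).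
Implicit Types (k : cells D) (F : faces D).

Hypotheses (alpha0 : 0 < alpha) (w0 : forall k, sel k -> 0 < w k)
  (deg1 : forall k, sel k -> (1 <= deg k)%N)
  (selF : forall F k, fsel F -> owner F k -> sel k)
  (penE : forall F k, fsel F -> owner F k ->
    alpha * (w k * (deg k)%:R ^+ 2 / diam (cell k)) <= pen F)
  (sigC : forall k i j, sel k -> cop X N k (deg k) (fun u x => sig u x i j))
  (epC : forall k i j, sel k -> cop X N k (deg k) (fun u x => ep u x i j))
  (gC : forall k i j, sel k -> cop X N k (deg k) (fun u x => g k u x i j))
  (jmpB : forall F, fsel F -> mbop X N rS (fun u s => jmp F u (phi F s)))
  (sym : forall k u v x, sel k -> X u -> X v -> cell k x ->
    frob (sig u x) (ep v x) = frob (sig v x) (ep u x))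
  (sigE : forall k u x, sel k -> X u -> cell k x ->
    frob (sig u x) (ep u x) = frob (g k u x) (g k u x))
  (flux : forall F k u s, fsel F -> owner F k -> X u -> rS s ->
    frob (mtrc k (sig u) (phi F s)) (mtrc k (sig u) (phi F s)) <=
    w k * frob (mtrc k (g k u) (phi F s)) (mtrc k (g k u) (phi F s))).

Definition sip (u v : V -> W) : R :=
  \sum_(k : cells D | sel k)
     \int[leb R n.+1]_(x in cell k) frob (sig u x) (ep v x)
  - \sum_(F : faces D | fsel F)
     face_int (vtx F) (fun x => frob (avg F (sig u) x) (jmp F v x))
  - \sum_(F : faces D | fsel F)
     face_int (vtx F) (fun x => frob (jmp F u x) (avg F (sig v) x))
  + \sum_(F : faces D | fsel F)
     face_int (vtx F) (fun x => frob (pen F *: jmp F u x) (jmp F v x)).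

Definition sip_norm2 (u : V -> W) : R :=
  \sum_(k : cells D | sel k)
     \int[leb R n.+1]_(x in cell k) frob (sig u x) (ep u x)
  + \sum_(F : faces D | fsel F)
     face_int (vtx F) (fun x => frob (pen F *: jmp F u x) (jmp F u x)).

Let mrS : measurable rS. Proof. exact: measurable_ref_simplex. Qed.
Let brS : coord_bounded rS. Proof. exact: ref_simplex_bounded. Qed.

Lemma measurable_face_param (F : faces D) : measurable_fun setT (phi F).
Proof.
have := measurableT_comp (measurable_addrV (vtx F ord0)) (measurable_mulrV (edges (vtx F))).
by apply: eq_measurable_fun => s _ /=; rewrite addrC.
Qed.

Lemma mtrc_mbop F k p' r (L : (V -> W) -> V -> 'M[R]_(p', r)) : owner F k ->
  (forall i j, cop X N k (deg k) (fun u x => L u x i j)) ->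
  mbop X N rS (fun u s => mtrc k (L u) (phi F s)).
Proof.
move=> Fk LC; apply: mbop_sop => // i j.
apply: (@eq_sop _ _ _ _ _ _ _ _ (fun u s => strc k (fun y => L u y i j) (phi F s))).
- exact: Xlin.
- by move=> u s _ _; rewrite mxE.
apply: (cop_trace_sop hmesh mrS (measurable_face_param F)) (LC i j) => s Ss.
by apply: owner_closure Fk _; exact: face_param.
Qed.

Lemma avg_mbop F : fsel F -> mbop X N rS (fun u s => avg F (sig u) (phi F s)).
Proof.
move=> FF; apply: mbopZ; apply: mbop_sum => // k Fk.
by apply: mtrc_mbop => // i j; apply: sigC; exact: selF FF Fk.
Qed.

Lemma face_bform F p' r (A B : (V -> W) -> V -> 'M[R]_(p', r)) :
  mbop X N rS (fun u s => A u (phi F s)) -> mbop X N rS (fun u s => B u (phi F s)) ->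
  bform X N (fun u v => face_int (vtx F) (fun x => frob (A u x) (B v x))).
Proof.
move=> HA HB.
have := bformZ (Num.sqrt (\det (edges (vtx F) *m (edges (vtx F))^T)))
  (bform_integral mrS brS Xlin HA HB).
by apply: eq_bform.
Qed.

Lemma cell_mbop k p' r (L : (V -> W) -> V -> 'M[R]_(p', r)) :
  (forall i j, cop X N k (deg k) (fun u x => L u x i j)) -> mbop X N (cell k) L.
Proof. by move=> LC; apply: mbop_sop => // i j; exact: (cop_cell_sop hmesh Xlin (LC i j)). Qed.

Lemma sip_bform : bform X N sip.
Proof.
have opp B : bform X N B -> bform X N (fun u v => - B u v).
  by move=> HB; apply: eq_bform (bformZ (-1) HB) => u v; rewrite mulN1r.
apply: bformD; [apply: bformD; [apply: bformD|]|].
- apply: bform_sum => k kS.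
  apply: (bform_integral (measurable_cell hmesh k) (cell_bounded hmesh k) Xlin).
    by apply: cell_mbop => i j; exact: sigC.
  by apply: cell_mbop => i j; exact: epC.
- by apply: opp; apply: bform_sum => F FF; apply: face_bform; [exact: avg_mbop|exact: jmpB].
- by apply: opp; apply: bform_sum => F FF; apply: face_bform; [exact: jmpB|exact: avg_mbop].
- by apply: bform_sum => F FF; apply: face_bform; [apply: mbopZ|]; exact: jmpB.
Qed.

Lemma sip_sym u v : X u -> X v -> sip u v = sip v u.
Proof.
move=> Xu Xv; rewrite /sip.
have -> : \sum_(k | sel k) \int[leb R n.+1]_(x in cell k) frob (sig u x) (ep v x) =
    \sum_(k | sel k) \int[leb R n.+1]_(x in cell k) frob (sig v x) (ep u x).
  by apply: eq_bigr => k kS; apply: eq_Rintegral => x /set_mem kx; exact: sym kS Xu Xv kx.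
have E (A B : faces D -> V -> 'M[R]_(p, q)) :
    \sum_(F | fsel F) face_int (vtx F) (fun x => frob (A F x) (B F x)) =
    \sum_(F | fsel F) face_int (vtx F) (fun x => frob (B F x) (A F x)).
  by apply: eq_bigr => F _; congr (_ * _); apply: eq_Rintegral => s _; rewrite frobC.
rewrite (E (fun F => avg F (sig u))) (E (fun F => jmp F u)).
rewrite [X in _ - _ - _ + X](_ : _ = \sum_(F | fsel F)
    face_int (vtx F) (fun x => frob (pen F *: jmp F v x) (jmp F u x))); last first.
  apply: eq_bigr => F _; congr (_ * _); apply: eq_Rintegral => s _.
  by rewrite frobC frobZr [RHS]frobC frobZr frobC.
exact: (congr1 (fun z => z + _) (addrAC _ _ _)).
Qed.

Lemma face_int_ge0 F (f : V -> R) : (forall x, face F x -> 0 <= f x) -> 0 <= face_int (vtx F) f.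
Proof.
move=> f0; apply: mulr_ge0; first exact: sqrtr_ge0.
by apply: Rintegral_ge0 => s Ss; apply: f0; exact: face_param.
Qed.

Lemma pen_gt0 F k : fsel F -> owner F k -> 0 < pen F.
Proof.
move=> FF Fk; apply: (lt_le_trans _ (penE FF Fk)).
have kS := selF FF Fk; apply: mulr_gt0 => //; apply: divr_gt0; last exact: diam_gt0 hmesh k.
by apply: mulr_gt0; [exact: w0|rewrite exprn_gt0// ltr0n deg1].
Qed.

Lemma frob_avg_le F (A : V -> 'M[R]_(p, q)) x :
  frob (avg F A x) (avg F A x) <= \sum_(k : cells D | owner F k) frob (mtrc k A x) (mtrc k A x).
Proof.
rewrite /frob [leRHS]exchange_big/=; apply: ler_sum => i _.
rewrite [leRHS]exchange_big/=; apply: ler_sum => j _; rewrite -expr2 mxE summxE exprMn.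
under [leRHS]eq_bigr do rewrite -expr2.
have [c0|c0] := posnP #|owner F|.
  by rewrite c0 invr0 expr0n mul0r sumr_ge0// => k _; exact: sqr_ge0.
apply: (@le_trans _ _ ((#|owner F|%:R^-1) ^+ 2 * (#|owner F|%:R *
    \sum_(k : cells D | owner F k) mtrc k A x i j ^+ 2))).
  by rewrite ler_wpM2l ?sqr_ge0//; exact: sqr_sum_le.
rewrite mulrA expr2 -(mulrA _ _ #|owner F|%:R) mulVf ?pnatr_eq0 -?lt0n// mulr1 ler_piMl//.
  by apply: sumr_ge0 => k _; exact: sqr_ge0.
by rewrite invf_le1 ?ltr0n// ler1n.
Qed.

(** With [t] equal to the penalty, exactly half of the jump term is spent and the flux is left with
    the small factor [2 / t]. *)
Lemma frob_young (A B : 'M[R]_(p, q)) (t : R) : 0 < t ->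
  2 * `|frob A B| <= 2^-1 * (t * frob B B) + 2 / t * frob A A.
Proof.
move=> t0; have H c : 0 <= frob (A + c *: B) (A + c *: B) by exact: frob_ge0.
have E c : frob (A + c *: B) (A + c *: B) = frob A A + 2 * c * frob A B + c ^+ 2 * frob B B.
  rewrite frobDr frobZr ![frob (A + _) _]frobC !frobDr !frobZr (frobC B A); ring.
have t2 : 0 < t / 2 by rewrite divr_gt0.
have H1 := H (t / 2); have H2 := H (- (t / 2)); rewrite !E in H1 H2.
rewrite -(ler_pM2l t2).
have -> : t / 2 * (2^-1 * (t * frob B B) + 2 / t * frob A A) =
    (t / 2) ^+ 2 * frob B B + frob A A by field; rewrite gt_eqF.
by case: (ger0P (frob A B)) => _; lra.
Qed.

Lemma mbop_sqr_integrable m (S : set 'rV[R]_m) p' r (L : (V -> W) -> 'rV[R]_m -> 'M[R]_(p', r))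
    u i j : measurable S -> coord_bounded S -> mbop X N S L -> X u ->
  (leb R m).-integrable S (EFin \o (fun x => L u x i j ^+ 2)).
Proof.
move=> mS bS [mL _ [K K0 bL]] Xu.
apply: (@integrable_bounded _ _ _ _ ((K * N u) ^+ 2)) => //.
  by apply: measurable_funX; exact: mL.
by move=> x Sx; rewrite normrX lerXn2r ?nnegrE ?mulr_ge0 ?N0// bL.
Qed.

Lemma Rintegral_frob m (A : set 'rV[R]_m) p' r (f : 'rV[R]_m -> 'M[R]_(p', r)) : measurable A ->
  (forall i j, (leb R m).-integrable A (EFin \o (fun x => f x i j ^+ 2))) ->
  \int[leb R m]_(x in A) frob (f x) (f x) = \sum_i \sum_j \int[leb R m]_(x in A) (f x i j ^+ 2).
Proof.
move=> mA fI.
have H i := integrable_Rintegral_sum (index_enum 'I_r) mA (fI i).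
have [_ E] := integrable_Rintegral_sum (index_enum 'I_p') mA (fun i => (H i).1).
transitivity (\int[leb R m]_(x in A) \sum_i \sum_j f x i j ^+ 2).
  by apply: eq_Rintegral => x _; apply: eq_bigr => i _; apply: eq_bigr => j _.
by rewrite E; apply: eq_bigr => i _; rewrite -(H i).2.
Qed.

Lemma cell_trace_frob k u : sel k -> X u ->
  \sum_(F : faces D | owner F k) face_int (vtx F)
    (fun x => frob (mtrc k (g k u) x) (mtrc k (g k u) x)) <=
  trace_const n cT * ((deg k)%:R ^+ 2 / diam (cell k)) *
    \int[leb R n.+1]_(x in cell k) frob (g k u x) (g k u x).
Proof.
move=> kS Xu; have mk := measurable_cell hmesh k; have bk := cell_bounded hmesh k.
rewrite (Rintegral_frob mk) => [|i j]; last first.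
  by apply: mbop_sqr_integrable => //; apply: cell_mbop => a b; exact: gC.
rewrite (eq_bigr (fun F => \sum_i \sum_j face_int (vtx F)
    (fun x => strc k (fun y => g k u y i j) x ^+ 2))) => [|F Fk]; last first.
  rewrite /face_int (Rintegral_frob mrS) => [|i j]; last first.
    apply: (@mbop_sqr_integrable _ _ _ _ (fun u s => mtrc k (g k u) (phi F s))) => //.
    by apply: mtrc_mbop => // a b; exact: gC.
  rewrite mulr_sumr; apply: eq_bigr => i _; rewrite mulr_sumr; apply: eq_bigr => j _.
  by congr (_ * _); apply: eq_Rintegral => s _; rewrite mxE.
rewrite exchange_big mulr_sumr; apply: ler_sum => i _.
rewrite exchange_big mulr_sumr; apply: ler_sum => j _.
apply: (cell_trace hmesh hreg); first exact: deg1.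
exact: cop_cell_poly (gC i j kS) Xu.
Qed.

Lemma face_flux_bound F u : fsel F -> X u ->
  2 * `|face_int (vtx F) (fun x => frob (avg F (sig u) x) (jmp F u x))| <=
  2^-1 * face_int (vtx F) (fun x => frob (pen F *: jmp F u x) (jmp F u x)) +
  \sum_(k : cells D | owner F k) 2 / pen F * w k *
    face_int (vtx F) (fun x => frob (mtrc k (g k u) x) (mtrc k (g k u) x)).
Proof.
move=> FF Xu.
have [k0 Fk0] := face_owner hmesh F.
have pF := pen_gt0 FF Fk0.
have mA := avg_mbop FF; have mJ := jmpB FF.
have iAJ := mbop_integrable mrS brS mA mJ Xu Xu.
have iJJ := mbop_integrable mrS brS (mbopZ (pen F) mJ) mJ Xu Xu.
(* Extension by zero to all elements turns the sum over owners into an unconditional one, the form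
   in which sums and integrals are exchanged. *)
pose h k s := if owner F k then 2 / pen F * w k *
  frob (mtrc k (g k u) (phi F s)) (mtrc k (g k u) (phi F s)) else 0.
have ih k : (leb R n).-integrable rS (EFin \o h k).
  rewrite /h; case: (boolP (owner F k)) => Fk; last by have := integrable0 (leb R n) rS; apply: eq_integrable.
  have mg : mbop X N rS (fun u s => mtrc k (g k u) (phi F s)).
    by apply: mtrc_mbop => // i j; apply: gC; exact: selF FF Fk.
  have := integrableZl mrS (2 / pen F * w k) (mbop_integrable mrS brS mg mg Xu Xu).
  by apply: eq_integrable.
have [ish hE] := integrable_Rintegral_sum (index_enum (cells D)) mrS ih.
have hsum s : \sum_k h k s = \sum_(k | owner F k) 2 / pen F * w k *
    frob (mtrc k (g k u) (phi F s)) (mtrc k (g k u) (phi F s)) by rewrite [RHS]big_mkcond.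
have -> : \sum_(k | owner F k) 2 / pen F * w k *
    face_int (vtx F) (fun x => frob (mtrc k (g k u) x) (mtrc k (g k u) x)) =
  Num.sqrt (\det (edges (vtx F) *m (edges (vtx F))^T)) *
    \int[leb R n]_(s in rS) \sum_k h k s.
  rewrite hE mulr_sumr [LHS]big_mkcond; apply: eq_bigr => k _; rewrite /h; case: (boolP (owner F k)) => Fk.
    rewrite RintegralZl//; first by rewrite /face_int mulrCA.
    have mg : mbop X N rS (fun u s => mtrc k (g k u) (phi F s)).
      by apply: mtrc_mbop => // i j; apply: gC; exact: selF FF Fk.
    have := mbop_integrable mrS brS mg mg Xu Xu; by apply: eq_integrable.
  by rewrite Rintegral_cst// mul0r mulr0.
rewrite /face_int normrM ger0_norm ?sqrtr_ge0// mulrCA [X in _ <= X + _]mulrCA -mulrDr.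
rewrite ler_wpM2l ?sqrtr_ge0//.
rewrite -Rintegral_lin//; apply: (le_trans (ler_wpM2l _ (le_normr_Rintegral mrS iAJ))) => //.
rewrite -RintegralZl//; last exact: integrable_norm iAJ.
apply: le_Rintegral => //.
- have := integrableZl mrS 2 (integrable_norm iAJ).
  by apply: eq_integrable.
- exact: integrable_lin.
move=> s Ss; apply: (le_trans (frob_young _ _ pF)).
rewrite [frob (pen F *: _) _]frobC frobZr lerD2l hsum.
apply: (@le_trans _ _ (2 / pen F * \sum_(k | owner F k)
    frob (mtrc k (sig u) (phi F s)) (mtrc k (sig u) (phi F s)))).
  by rewrite ler_wpM2l ?divr_ge0 ?(ltW pF)//; exact: frob_avg_le.
rewrite mulr_sumr; apply: ler_sum => k Fk; rewrite -[leRHS]mulrA.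
rewrite ler_wpM2l ?divr_ge0 ?(ltW pF)//.
exact: flux.
Qed.

(** After Young's inequality the sums are regrouped by elements, each of which pays for all its
    faces at once through the trace inequality. Faces outside the selection contribute nonnegative
    terms and may be added. *)
Lemma flux_term_bound u : X u -> 4 * trace_const n cT <= alpha ->
  2 * `|\sum_(F : faces D | fsel F)
     face_int (vtx F) (fun x => frob (avg F (sig u) x) (jmp F u x))| <= 2^-1 * sip_norm2 u.
Proof.
move=> Xu ha.
apply: (le_trans (ler_wpM2l _ (ler_norm_sum _ _ _))) => //; rewrite mulr_sumr.
apply: (le_trans (ler_sum _ (fun F FF => face_flux_bound FF Xu))).
rewrite big_split/= /sip_norm2 [leRHS]mulrDr [leRHS]addrC -mulr_sumr lerD2l.
pose fk F k := face_int (vtx F) (fun x => frob (mtrc k (g k u) x) (mtrc k (g k u) x)).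
have fk0 F k : 0 <= fk F k by apply: face_int_ge0 => x _; exact: frob_ge0.
rewrite (exchange_big_dep sel)/=; last by move=> F k FF Fk; exact: selF FF Fk.
rewrite mulr_sumr; apply: ler_sum => k kS.
have dk := diam_gt0 hmesh k; have wk := w0 kS.
have dg : 0 < (deg k)%:R :> R by rewrite ltr0n deg1.
(* By [penE] this dominates [2 w / pen]. The trace inequality brings the inverse factor
   [deg^2 / diam], and the product [2 trace_const / alpha] is at most one half: this is the origin
   of [4 * trace_const]. *)
pose c := 2 / alpha * (diam (cell k) / (deg k)%:R ^+ 2).
have c0 : 0 <= c by rewrite mulr_ge0 ?divr_ge0 ?sqr_ge0 ?ltW.
apply: (@le_trans _ _ (\sum_(F | owner F k) c * fk F k)).
  rewrite [leLHS](eq_bigl (fun F => owner F k && fsel F)) => [|F]; last by rewrite andbC.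
  rewrite [leRHS](bigID fsel)/= ler_wpDr//.
    by apply: sumr_ge0 => F _; exact: mulr_ge0.
  apply: ler_sum => F /andP[Fk FF]; rewrite ler_wpM2r ?fk0//.
  have pF := pen_gt0 FF Fk; have := penE FF Fk => H.
  have -> : 2 / pen F * w k = 2 * w k / pen F by rewrite mulrAC.
  rewrite ler_pdivrMr//; apply: le_trans (ler_wpM2l c0 H).
  rewrite le_eqVlt; apply/orP; left; apply/eqP.
  by rewrite /c; field; rewrite ?gt_eqF.
rewrite -mulr_sumr; apply: (le_trans (ler_wpM2l c0 (cell_trace_frob kS Xu))).
have -> : \int[leb R n.+1]_(x in cell k) frob (g k u x) (g k u x) =
    \int[leb R n.+1]_(x in cell k) frob (sig u x) (ep u x).
  by apply: eq_Rintegral => x /set_mem kx; rewrite (sigE kS Xu kx).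
rewrite mulrA ler_wpM2r//.
  by apply: Rintegral_ge0 => x kx; rewrite (sigE kS Xu kx) frob_ge0.
have -> : c * (trace_const n cT * ((deg k)%:R ^+ 2 / diam (cell k))) =
    2^-1 * (4 * trace_const n cT / alpha) by rewrite /c; field; rewrite ?gt_eqF.
by rewrite ler_piMr// ler_pdivrMr// mul1r.
Qed.

Lemma sip_norm2_ge0 u : X u -> 0 <= sip_norm2 u.
Proof.
move=> Xu; apply: addr_ge0; last (apply: sumr_ge0 => F FF).
  apply: sumr_ge0 => k kS; by apply: Rintegral_ge0 => x kx; rewrite (sigE kS Xu kx) frob_ge0.
have [k Fk] := face_owner hmesh F.
apply: face_int_ge0 => x _; rewrite frobC frobZr mulr_ge0 ?frob_ge0// ltW//.
exact: pen_gt0 FF Fk.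
Qed.

Lemma sip_coercive u : X u -> 4 * trace_const n cT <= alpha ->
  2^-1 * sip_norm2 u <= sip u u <= 3 / 2 * sip_norm2 u.
Proof.
move=> Xu ha; have := flux_term_bound Xu ha.
have -> : sip u u = sip_norm2 u - 2 * \sum_(F : faces D | fsel F)
     face_int (vtx F) (fun x => frob (avg F (sig u) x) (jmp F u x)).
  rewrite /sip /sip_norm2.
  have -> : \sum_(F | fsel F) face_int (vtx F) (fun x => frob (jmp F u x) (avg F (sig u) x)) =
      \sum_(F | fsel F) face_int (vtx F) (fun x => frob (avg F (sig u) x) (jmp F u x)).
    apply: eq_bigr => F _; congr (_ * _).
    by apply: eq_Rintegral => s _; rewrite frobC.
  by ring.
move: (sip_norm2 u) (\sum_(F | fsel F) face_int (vtx F) _) => a b.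
by case: (ger0P b) => b0 H; apply/andP; split; lra.
Qed.

End symmetric_interior_penalty.

(** * Differentiation of quadratic forms along curves and energy inequality *)

Section rates.
Context (R : realType) (T : R).
Implicit Types (f : R -> R) (l t : R).

(* [l] is the derivative of [f] at [t], relatively to [0, T]. *)
Definition rate f l t := forall e, 0 < e -> exists2 d, 0 < d &
  forall s, 0 <= s <= T -> `|s - t| < d -> `|f s - f t - l * (s - t)| <= e * `|s - t|.

Lemma rateD f1 f2 l1 l2 t : rate f1 l1 t -> rate f2 l2 t ->
  rate (fun s => f1 s + f2 s) (l1 + l2) t.
Proof.
move=> r1 r2 e e0; have e2 : 0 < e / 2 by rewrite divr_gt0.
have [d1 d10 H1] := r1 _ e2; have [d2 d20 H2] := r2 _ e2.
exists (Num.min d1 d2) => [|s sT]; first by rewrite lt_min d10.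
rewrite lt_min => /andP[/(H1 s sT) + /(H2 s sT)].
set a := _ - l1 * _; set b := _ - l2 * _ => ha hb.
have -> : f1 s + f2 s - (f1 t + f2 t) - (l1 + l2) * (s - t) = a + b by rewrite /a /b; ring.
rewrite (le_trans (ler_normD _ _))// (le_trans (lerD ha hb))//.
by rewrite -mulrDl -splitr.
Qed.

Lemma rate_derive f l t : 0 < t < T -> rate f l t -> is_derive t (1 : R) f l.
Proof.
move=> /andP[t0 tT] H.
have lim : (fun h : R => h^-1 *: ((f \o shift t) (h *: 1) - f t)) @ 0^' --> l.
  apply/cvgrPdist_le => e e0; have [d d0 Hd] := H e e0.
  have m0 : 0 < Num.min d (Num.min t (T - t)) by rewrite !lt_min d0 t0 subr_gt0.
  apply/nbhs_ballP; exists (Num.min d (Num.min t (T - t))) => //= h.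
  rewrite /ball/= sub0r normrN !lt_min => /and3P[hd ht hT] h0.
  have /ltr_normlP[h1 h2] := ht; have /ltr_normlP[h3 h4] := hT.
  have := Hd (h + t); rewrite addrK => /(_ _ hd).
  have sT : 0 <= h + t <= T by apply/andP; split; lra.
  move=> /(_ sT) Hh; rewrite /= [h *: 1]mulr1 distrC.
  have hp : 0 < `|h| by rewrite normr_gt0.
  rewrite -(ler_pM2r hp) -normrM; apply: le_trans Hh; rewrite le_eqVlt; apply/orP; left.
  apply/eqP; congr (`| _ |); rewrite mulrBl -[_ *: _]/(_ * _) mulrAC mulVf// mul1r.
  by [].
by split; [apply: cvgP lim|exact: cvg_lim lim].
Qed.

Lemma rate_continuous f (l : R -> R) : (forall t, 0 <= t <= T -> rate f (l t) t) ->
  {within `[0, T], continuous f}.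
Proof.
move=> H; apply/subspace_continuousP => t; rewrite /= in_itv/= => tT.
apply/cvgrPdist_le => e e0; have [d d0 Hd] := H t tT 1 ltr01.
have M0 : 0 < 1 + `|l t| by rewrite ltr_pwDl.
have m0 : 0 < Num.min d (e / (1 + `|l t|)) by rewrite lt_min d0 divr_gt0.
apply/nbhs_ballP; exists (Num.min d (e / (1 + `|l t|))) => //= s.
rewrite /ball/= lt_min distrC => /andP[sd se]; rewrite in_itv/= => sT.
have := Hd s sT sd; rewrite mul1r => Hs.
rewrite distrC -[f s - f t](subrK (l t * (s - t))) (le_trans (ler_normD _ _))//.
rewrite normrM (le_trans (lerD Hs (lexx _)))// -[X in X + _]mul1r -mulrDl mulrC.
by rewrite -ler_pdivlMr// ltW.
Qed.

(** For each [e > 0] the function [sqrt (E + e^2) - C G], with [G] the primitive of [g], is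
    differentiable inside the interval even where [E] vanishes, and it is nonincreasing. Continuity
    up to the endpoints lets the comparison start at 0, and [sqrt (E 0 + e^2) <= sqrt (E 0) + e]
    lets [e] be arbitrary. *)
Lemma energy_gronwall (E E' g : R -> R) (C : R) : 0 < T -> 0 <= C ->
  (forall t, 0 <= t <= T -> rate E (E' t) t) ->
  (forall t, 0 <= t <= T -> 0 <= E t) ->
  {within `[0, T], continuous g} ->
  (forall t, 0 < t < T -> 0 <= g t) ->
  (forall t, 0 < t < T -> E' t <= 2 * C * g t * Num.sqrt (E t)) ->
  forall t, 0 <= t <= T ->
    Num.sqrt (E t) <= Num.sqrt (E 0) + C * \int[lebesgue_measure]_(s in `[0, t]) g s.
Proof.
move=> T0 C0 rE E0 cg g0 HE t tT.
pose G s := \int[@lebesgue_measure R]_(x in `[0, s]) g x.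
have ig : (@lebesgue_measure R).-integrable `[0, T] (EFin \o g).
  by apply: continuous_compact_integrable => //; exact: segment_compact.
have cG : {within `[0, T], continuous G}.
  by have := parameterized_integral_continuous (ltW T0) ig.
have z0 : 0 <= (0 : R) <= T by rewrite lexx ltW.
have G0 : G 0 = 0 by rewrite /G set_itv1 Rintegral_set1.
have gc s : 0 < s < T -> {for s, continuous g}.
  move=> sT; have /(continuous_within_itvP _ T0)[H _ _] := cg.
  by apply: H; rewrite in_itv.
apply/ler_addgt0Pr => e e0; pose H s := Num.sqrt (E s + e ^+ 2) - C * G s.
have e20 : 0 < e ^+ 2 by rewrite exprn_gt0.
have Ep s : 0 <= s <= T -> 0 < E s + e ^+ 2 by move=> sT; rewrite ltr_wpDl// E0.
have dH s : 0 < s < T -> is_derive s (1 : R) H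
    ((2 * Num.sqrt (E s + e ^+ 2))^-1 * E' s - C * g s).
  move=> sT; have sT' : 0 <= s <= T by case/andP: sT => ? ?; rewrite !ltW.
  have dE := rate_derive sT (rE s sT').
  have dEe : is_derive s (1 : R) (fun x => E x + e ^+ 2) (E' s).
    by apply: is_derive_eq (addr0 _).
  have dsq := is_derive1_sqrt (Ep s sT').
  have d1 := is_derive1_comp (f := @Num.sqrt R) (g := fun x => E x + e ^+ 2) dsq dEe.
  have [dG1 dG2] := continuous_FTC1_closed (proj2 (andP sT)) ig (proj1 (andP sT)) (gc s sT).
  have dG : is_derive s (1 : R) G (g s).
    by split; [exact: dG1|rewrite -derive1E; exact: dG2].
  have d2 : is_derive s (1 : R) (fun x => C * G x) (C * g s) by exact: is_deriveZ.
  exact: is_deriveB d1 d2.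
have cH : {within `[0, T], continuous H}.
  have /subspace_continuousP cE := rate_continuous rE.
  move/subspace_continuousP : cG => cG'.
  apply/subspace_continuousP => s sT; apply: cvgB.
    have cEe : E x + e ^+ 2 @[x --> within `[0, T] (nbhs s)] --> E s + e ^+ 2.
      by apply: cvgD; [exact: cE|exact: cvg_cst].
    by apply: continuous_cvg cEe; exact: sqrt_continuous.
  by apply: cvgM; [exact: cvg_cst|exact: cG'].
have : H t <= H 0.
  case/andP: tT => t0 tT; apply: (@ler0_derive1_nincr _ H 0 T _ _ cH 0 t) => // s;
    rewrite in_itv/= => sT.
  - by have [] := dH s sT.
  - rewrite derive1E; have [_ ->] := dH s sT; have sT' : 0 <= s <= T.
      by case/andP: sT => ? ?; rewrite !ltW.
    have y0 := Ep s sT'.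
    have q0 : 0 < Num.sqrt (E s + e ^+ 2) by rewrite sqrtr_gt0.
    rewrite subr_le0 mulrC ler_pdivrMr ?mulr_gt0//; apply: (le_trans (HE s sT)).
    have : Num.sqrt (E s) <= Num.sqrt (E s + e ^+ 2) by rewrite ler_wsqrtr// lerDl ltW.
    have cg0 : 0 <= C * g s by rewrite mulr_ge0// g0.
    by move=> /(ler_wpM2l cg0); lra.
rewrite /H G0 mulr0 subr0 lerBlDr => Ht.
have h1 : Num.sqrt (E t) <= Num.sqrt (E t + e ^+ 2) by rewrite ler_wsqrtr// lerDl ltW.
have h2 : Num.sqrt (E 0 + e ^+ 2) <= Num.sqrt (E 0) + e.
  rewrite -[leRHS]ger0_norm ?addr_ge0 ?sqrtr_ge0 ?(ltW e0)// -sqrtr_sqr ler_wsqrtr//.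
  rewrite sqrrD sqr_sqrtr ?E0// -addrA lerD2l lerDr mulrn_wge0// mulr_ge0 ?sqrtr_ge0//.
  exact: ltW.
by rewrite -/(G t); lra.
Qed.

End rates.

(** * Quadratic forms along curves that are differentiable in norm *)

Section evolution.
Context (R : realType) (n : nat) (W : lmodType R).
Notation V := 'rV[R]_n.
Variables (X : (V -> W) -> Prop) (N : (V -> W) -> R).
Hypothesis N0 : forall u, X u -> 0 <= N u.
Hypothesis Xlin : forall a u v, X u -> X v -> X (flin a u v).
Hypothesis NZ : forall a u, X u -> N (fun x => a *: u x) = `|a| * N u.
Hypothesis ND : forall u v, X u -> X v -> N (fun x => u x + v x) <= N u + N v.

Lemma memZ a u : X u -> X (fun x => a *: u x).
Proof.
move=> Xu; have X0 := Xlin (-1) Xu Xu; have := Xlin a Xu X0.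
by congr X; apply/funext => x; rewrite /flin scaleN1r addNr addr0.
Qed.

Lemma memB u v : X u -> X v -> X (fun x => u x - v x).
Proof.
move=> Xu Xv; have := Xlin (-1) Xv Xu; congr X; apply/funext => x.
by rewrite /flin scaleN1r addrC.
Qed.

(** The limit of difference quotients is rewritten without division; [s = t], excluded from the
    punctured limit, is treated apart. *)
Lemma isC1_expansion T u u1 t : isC1 X N T u u1 -> 0 <= t <= T -> forall e, 0 < e ->
  exists2 d, 0 < d & forall s, 0 <= s <= T -> `|s - t| < d ->
    N (fun x => u s x - u t x - (s - t) *: u1 t x) <= e * `|s - t|.
Proof.
move=> uC tT e e0; have [Xt Xt1 + _] := uC t tT.
move=> /cvgr0Pnorm_le/(_ e e0)/nbhs_ballP[d /= d0 Hd].
exists d => // s sT sd; have [->|st] := eqVneq s t.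
  rewrite !subrr normr0 mulr0 (_ : (fun x => _) = (fun x => 0 *: u t x)).
    by rewrite (NZ 0 Xt) normr0 mul0r.
  by apply/funext => x; rewrite subrr !scale0r subr0.
have h0 : s - t != 0 by rewrite subr_eq0.
have := Hd s; rewrite /ball/= distrC => /(_ sd st); rewrite in_itv/= => /(_ sT) H.
rewrite (_ : (fun x => _) = fun x => (s - t) *: ((s - t)^-1 *: (u s x - u t x) - u1 t x)).
  have [Xs _ _ _] := uC s sT.
  rewrite (NZ _ (memB (memZ _ (memB Xs Xt)) Xt1)) mulrC ler_wpM2r//.
  by rewrite (le_trans (ler_norm _)).
by apply/funext => x; rewrite scalerBr scalerA mulfV// scale1r.
Qed.

(** Applied to the loads, it makes the right-hand side of the energy inequality continuous in time,
    hence integrable with a differentiable primitive. *)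
Lemma isC1_norm_continuous T u u1 : isC1 X N T u u1 ->
  {within `[0, T], continuous (fun t => N (u t))}.
Proof.
move=> uC; apply/subspace_continuousP => t; rewrite /= in_itv/= => tT.
have [Xu Xu1 _ _] := uC t tT.
apply/cvgrPdist_le => e e0; have [d d0 Hd] := isC1_expansion uC tT ltr01.
have M0 : 0 < 1 + N (u1 t) by rewrite ltr_pwDl// N0.
have m0 : 0 < Num.min d (e / (1 + N (u1 t))) by rewrite lt_min d0 divr_gt0.
apply/nbhs_ballP; exists (Num.min d (e / (1 + N (u1 t)))) => //= s.
rewrite /ball/= lt_min distrC => /andP[sd se]; rewrite in_itv/= => sT.
have [Xs _ _ _] := uC s sT.
have := Hd s sT sd; rewrite mul1r => Hs.
have Xd := memB Xs Xu.
have D : N (fun x => u s x - u t x) <= e.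
  rewrite (_ : (fun x => _) = fun x => u s x - u t x - (s - t) *: u1 t x + (s - t) *: u1 t x).
    apply: (le_trans (ND (memB Xd (memZ _ Xu1)) (memZ _ Xu1))); rewrite (NZ _ Xu1).
    apply: (le_trans (lerD Hs (lexx _))); rewrite -[X in X + _]mulr1 -mulrDr.
    by rewrite -ler_pdivlMr// ltW.
  by apply/funext => x; rewrite subrK.
have D' : N (fun x => u t x - u s x) = N (fun x => u s x - u t x).
  rewrite (_ : (fun x => u t x - u s x) = fun x => -1 *: (u s x - u t x)).
    by rewrite (NZ _ Xd) normrN1 mul1r.
  by apply/funext => x; rewrite scaleN1r opprB.
have E1 : N (u t) <= N (fun x => u t x - u s x) + N (u s).
  apply: le_trans (ND (memB Xu Xs) Xs); rewrite le_eqVlt; apply/orP; left; apply/eqP.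
  by congr N; apply/funext => x; rewrite subrK.
have E2 : N (u s) <= N (fun x => u s x - u t x) + N (u t).
  apply: le_trans (ND Xd Xu); rewrite le_eqVlt; apply/orP; left; apply/eqP.
  by congr N; apply/funext => x; rewrite subrK.
rewrite D' in E1; suff : `|N (u t) - N (u s)| <= e by [].
by rewrite ler_norml; apply/andP; split; lra.
Qed.

(** With [h = s - t], write [u s = v + h b + a], where [N v <= e' |h|], and expand [B] bilinearly;
    symmetry merges the two first order terms into [2 B a b h]. *)
Lemma bform_rate T B u u1 t : bform X N B -> (forall v w, X v -> X w -> B v w = B w v) ->
  isC1 X N T u u1 -> 0 <= t <= T ->
  rate T (fun s => B (u s) (u s)) (2 * B (u t) (u1 t)) t.
Proof.
move=> [l r [K K0 BK]] sym uC tT e e0; have [Xa Xb _ _] := uC t tT.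
set a := u t in Xa *; set b := u1 t in Xb *.
have Na := N0 Xa; have Nb := N0 Xb.
(* [M] bounds the terms quadratic in [(v, h b)], small because [h] is, and [Q] the term linear in
   [v], small by the choice of [e']. The added ones allow divisions. *)
pose M := K * (1 + N b) ^+ 2 + 1; pose Q := 2 * K * N a + 1.
have M0 : 0 < M by rewrite ltr_wpDl// mulr_ge0// sqr_ge0.
have Q0 : 0 < Q by rewrite ltr_wpDl// !mulr_ge0.
pose e' := Num.min 1 (e / (2 * Q)).
have e'0 : 0 < e' by rewrite lt_min ltr01/= divr_gt0// mulr_gt0.
have e'1 : e' <= 1 by rewrite ge_min lexx.
have e'e : e' * Q <= e / 2.
  by rewrite -ler_pdivlMr// -mulrA -invfM [2 * Q]mulrC /e' ge_min [Q * 2]mulrC lexx orbT.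
have [d d0 Hd] := isC1_expansion uC tT e'0.
exists (Num.min d (e / (2 * M))) => [|s sT]; first by rewrite lt_min d0 divr_gt0// mulr_gt0.
rewrite lt_min => /andP[sd sM]; have [Xs _ _ _] := uC s sT.
have Hs := Hd s sT sd; set h := s - t in Hs sM *.
pose v x := u s x - u t x - h *: u1 t x.
have Xv : X v by apply: memB; [exact: memB|exact: memZ].
have usE : u s = flin 1 v (flin h b a).
  by apply/funext => x; rewrite /flin /v scale1r -/a -/b addrA !subrK.
have Xw := Xlin h Xb Xa.
have -> : B (u s) (u s) - B a a - 2 * B a b * h =
    B v v + 2 * h * B v b + 2 * B v a + h ^+ 2 * B b b.
  rewrite usE !l ?r// ?l ?r//; try exact: Xlin.
  by rewrite (sym b v)// (sym a v)// (sym b a)//; ring.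
have Nv := N0 Xv; move: Hs; rewrite -/v => Hs.
have Nvh : N v <= `|h| by rewrite (le_trans Hs)// ler_piMl.
have Bvv : `|B v v| <= K * (e' * `|h|) * `|h|.
  by rewrite (le_trans (BK _ _ Xv Xv))// ler_pM ?mulr_ge0 ?ler_wpM2l.
have Bvb : `|2 * h * B v b| <= 2 * K * `|h| * N b * `|h|.
  have /(ler_wpM2l (normr_ge0 (2 * h))) : `|B v b| <= K * `|h| * N b.
    by rewrite (le_trans (BK _ _ Xv Xb))// ler_wpM2r// ler_wpM2l.
  rewrite -normrM => /le_trans; apply; rewrite normrM ger0_norm// le_eqVlt.
  by apply/orP; left; apply/eqP; ring.
have Bva : `|2 * B v a| <= 2 * K * N a * e' * `|h|.
  have /(ler_wpM2l (normr_ge0 2)) : `|B v a| <= K * (e' * `|h|) * N a.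
    by rewrite (le_trans (BK _ _ Xv Xa))// ler_wpM2r// ler_wpM2l.
  rewrite -normrM => /le_trans; apply; rewrite ger0_norm// le_eqVlt.
  by apply/orP; left; apply/eqP; ring.
have Bbb : `|h ^+ 2 * B b b| <= K * `|h| * N b ^+ 2 * `|h|.
  have := ler_wpM2l (normr_ge0 (h ^+ 2)) (BK _ _ Xb Xb).
  rewrite -normrM => /le_trans; apply; rewrite normrX le_eqVlt.
  by apply/orP; left; apply/eqP; ring.
rewrite (le_trans (ler_normD _ _))// (le_trans (lerD (le_trans (ler_normD _ _)
  (lerD (le_trans (ler_normD _ _) (lerD Bvv Bvb)) Bva)) Bbb))//.
rewrite -!mulrDl ler_wpM2r//.
have hM : M * `|h| <= e / 2.
  by rewrite mulrC -ler_pdivlMr// -mulrA -invfM ltW.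
have : K * (e' * `|h|) <= K * `|h| by rewrite ler_wpM2l// ler_piMl.
have := normr_ge0 h; move: (`|h|) hM => y; rewrite /M => hM y0 Ke.
have : 2 * K * N a * e' + e' <= e / 2 by apply: le_trans e'e; rewrite /Q; lra.
by move=> Qe; nra.
Qed.

End evolution.

(** * Weighted scalar products *)

Section L2_norms.
Context (R : realType) (n : nat) (A : set 'rV[R]_n).
Hypothesis mA : measurable A.
Notation V := 'rV[R]_n.
Notation mu := (leb R n).
Implicit Types (f g w : V -> R).

Lemma ae_eq_Rintegral f g : measurable_fun A f -> measurable_fun A g ->
  {ae mu, forall x, A x -> f x = g x} -> \int[mu]_(x in A) f x = \int[mu]_(x in A) g x.
Proof.
move=> mf mg fg; congr fine; apply: ae_eq_integral => //; try exact/measurable_EFinP.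
by apply: filterS fg => x fg Ax; rewrite /= fg.
Qed.

Lemma ae_Rintegral_ge0 f : measurable_fun A f ->
  {ae mu, forall x, A x -> 0 <= f x} -> 0 <= \int[mu]_(x in A) f x.
Proof.
move=> mf f0; rewrite (@ae_eq_Rintegral _ (fun x => `|f x|))//.
- exact: Rintegral_ge0.
- exact: measurableT_comp.
- by apply: filterS f0 => x f0 Ax; rewrite ger0_norm// f0.
Qed.

Lemma ae_le_Rintegral f g : mu.-integrable A (EFin \o f) -> mu.-integrable A (EFin \o g) ->
  {ae mu, forall x, A x -> f x <= g x} -> \int[mu]_(x in A) f x <= \int[mu]_(x in A) g x.
Proof.
move=> fi gi fg; rewrite -subr_ge0 addrC -mulN1r -Rintegral_lin//.
apply: ae_Rintegral_ge0.
  by apply/measurable_EFinP; have /integrableP[] := integrable_lin (-1) mA fi gi.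
by apply: filterS fg => x fg Ax; rewrite mulN1r addrC subr_ge0 fg.
Qed.

Lemma inL2M_bounded w f (M : R) : measurable_fun A w ->
  {ae mu, forall x, A x -> `|w x| <= M} -> inL2 A f -> inL2 A (fun x => w x * f x).
Proof.
move=> mw wM [mf f2]; have mwf : measurable_fun A (fun x => w x * f x).
  exact: measurable_funM.
split => //; apply/integrableP; split.
  by apply/measurable_EFinP; exact: measurable_funX.
have /integrableP[_] := integrableZl mA (M ^+ 2) f2; apply: le_lt_trans.
apply: ae_ge0_le_integral => //.
- by apply: measurableT_comp => //; apply/measurable_EFinP; exact: measurable_funX.
- apply: measurableT_comp => //; apply: emeasurable_funM => //.
  by apply/measurable_EFinP; exact: measurable_funX.
apply: filterS wM => x wM Ax; rewrite /= lee_fin ger0_norm ?sqr_ge0//.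
rewrite (ger0_norm (mulr_ge0 (sqr_ge0 M) (sqr_ge0 (f x)))) exprMn ler_wpM2r ?sqr_ge0// -[leLHS]real_normK ?num_real//.
by rewrite lerXn2r ?nnegrE ?wM// (le_trans (normr_ge0 _) (wM Ax)).
Qed.

Lemma inL2D f g : inL2 A f -> inL2 A g -> inL2 A (fun x => f x + g x).
Proof.
move=> fL gL; rewrite (_ : (fun x => _) = fun x => 1 * f x + g x); first exact: inL2_lin.
by apply/funext => x; rewrite mul1r.
Qed.

Lemma inL2Z a f : inL2 A f -> inL2 A (fun x => a * f x).
Proof.
move=> fL; apply: (@inL2M_bounded (fun=> a) f `|a|) fL => //; exact: aeW.
Qed.

Lemma L2normD f g : inL2 A f -> inL2 A g ->
  L2norm A (fun x => f x + g x) <= L2norm A f + L2norm A g.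
Proof.
move=> fL gL; rewrite -(ler_pXn2r (n := 2)) ?nnegrE ?addr_ge0 ?L2norm_ge0//.
rewrite sqrrD !L2norm_sqr; have fg := inL2M_integrable mA fL gL.
have CS := le_trans (ler_norm _) (L2_CauchySchwarz mA fL gL).
have -> : \int[mu]_(x in A) ((f x + g x) ^+ 2) =
    2 * \int[mu]_(x in A) (f x * g x) + (1 * \int[mu]_(x in A) (f x ^+ 2) + \int[mu]_(x in A) (g x ^+ 2)).
  rewrite -Rintegral_lin//; [|exact: fL.2|exact: gL.2].
  rewrite -Rintegral_lin//; last by apply: integrable_lin => //; [exact: fL.2|exact: gL.2].
  by apply: eq_Rintegral => x _; ring.
by rewrite mul1r; lra.
Qed.

Lemma L2normZ a f : inL2 A f -> L2norm A (fun x => a * f x) = `|a| * L2norm A f.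
Proof.
move=> [_ f2]; rewrite /L2norm -sqrtr_sqr -sqrtrM ?sqr_ge0//; congr Num.sqrt.
by rewrite -RintegralZl//; apply: eq_Rintegral => x _; rewrite exprMn.
Qed.

Lemma L2norm_le f g : inL2 A f -> inL2 A g -> (forall x, A x -> `|f x| <= g x) ->
  L2norm A f <= L2norm A g.
Proof.
move=> [_ f2] [_ g2] fg; apply: ler_wsqrtr; apply: le_Rintegral => // x Ax.
rewrite -[leLHS]real_normK ?num_real// lerXn2r ?nnegrE ?fg//.
by rewrite (le_trans (normr_ge0 _) (fg x Ax)).
Qed.

Lemma inL2_fnorm p q (v : V -> 'M[R]_(p, q)) : inL2v A v -> inL2 A (fun x => fnorm (v x)).
Proof.
move=> vL; have mv : measurable_fun A (fun x => frob (v x) (v x)).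
  apply: measurable_sum => i; apply: measurable_sum => j.
  by apply: measurable_funM; exact: (vL i j).1.
split.
  apply: (measurable_comp (F := setT)) => //.
  by apply: continuous_measurable_fun; exact: sqrt_continuous.
have vv i j : mu.-integrable A (EFin \o (fun x => v x i j * v x i j)).
  exact: inL2M_integrable.
have H i := integrable_Rintegral_sum (index_enum 'I_q) mA (vv i).
have [E _] := integrable_Rintegral_sum (index_enum 'I_p) mA (fun i => (H i).1).
by apply: eq_integrable E => // x _; rewrite /= fnorm_sqr.
Qed.

Lemma frob_CauchySchwarz p q (B C : 'M[R]_(p, q)) : `|frob B C| <= fnorm B * fnorm C.
Proof.
rewrite -(ler_pXn2r (n := 2)) ?nnegrE ?mulr_ge0 ?fnorm_ge0// real_normK ?num_real//.
rewrite exprMn !fnorm_sqr; apply: quadratic_ge0_discr; try exact: frob_ge0.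
move=> t; have := frob_ge0 (B + t *: C).
rewrite frobDr ![frob (B + _) _]frobC !frobDr !frobZr ![frob (t *: _) _]frobC !frobZr.
by congr (_ <= _); ring.
Qed.

Lemma fnormD p q (B C : 'M[R]_(p, q)) : fnorm (B + C) <= fnorm B + fnorm C.
Proof.
rewrite -(ler_pXn2r (n := 2)) ?nnegrE ?addr_ge0 ?fnorm_ge0// sqrrD !fnorm_sqr.
rewrite frobDr ![frob (B + _) _]frobC !frobDr (frobC C B).
by have := le_trans (ler_norm _) (frob_CauchySchwarz B C); lra.
Qed.

Lemma fnormZ p q a (B : 'M[R]_(p, q)) : fnorm (a *: B) = `|a| * fnorm B.
Proof. by rewrite /fnorm frobZr frobC frobZr mulrA -expr2 sqrtrM ?sqr_ge0// sqrtr_sqr. Qed.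

Lemma inL2vD p q (u v : V -> 'M[R]_(p, q)) : inL2v A u -> inL2v A v -> inL2v A (fun x => u x + v x).
Proof. by move=> uL vL i j; under eq_fun do rewrite mxE; exact: inL2D. Qed.

Lemma inL2vZ p q a (u : V -> 'M[R]_(p, q)) : inL2v A u -> inL2v A (fun x => a *: u x).
Proof. by move=> uL i j; under eq_fun do rewrite mxE; exact: inL2Z. Qed.

Lemma L2vnormD p q (u v : V -> 'M[R]_(p, q)) : inL2v A u -> inL2v A v ->
  L2vnorm A (fun x => u x + v x) <= L2vnorm A u + L2vnorm A v.
Proof.
move=> uL vL; apply: le_trans (L2normD (inL2_fnorm uL) (inL2_fnorm vL)).
apply: L2norm_le.
- by apply: inL2_fnorm; exact: inL2vD.
- by apply: inL2D; exact: inL2_fnorm.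
- by move=> x _; rewrite ger0_norm ?fnorm_ge0// fnormD.
Qed.

Lemma L2vnormZ p q a (u : V -> 'M[R]_(p, q)) : inL2v A u ->
  L2vnorm A (fun x => a *: u x) = `|a| * L2vnorm A u.
Proof.
move=> uL; rewrite -[`|a|]normr_id -L2normZ; last exact: inL2_fnorm.
by rewrite /L2vnorm; congr L2norm; apply/funext => x; rewrite fnormZ.
Qed.

Lemma L2norm_entry_le p q (u : V -> 'M[R]_(p, q)) i j : inL2v A u ->
  L2norm A (fun x => u x i j) <= L2vnorm A u.
Proof.
move=> uL; apply: L2norm_le => //; first exact: inL2_fnorm.
by move=> x _; exact: le_fnorm.
Qed.

Lemma Rintegral_frobE p q (u v : V -> 'M[R]_(p, q)) : inL2v A u -> inL2v A v ->
  mu.-integrable A (EFin \o (fun x => frob (u x) (v x))) /\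
  \int[mu]_(x in A) frob (u x) (v x) = \sum_i \sum_j \int[mu]_(x in A) (u x i j * v x i j).
Proof.
move=> uL vL.
have uv i j : mu.-integrable A (EFin \o (fun x => u x i j * v x i j)).
  exact: inL2M_integrable.
have H i := integrable_Rintegral_sum (index_enum 'I_q) mA (uv i).
have [E S] := integrable_Rintegral_sum (index_enum 'I_p) mA (fun i => (H i).1).
split; first exact: E.
by rewrite [LHS]S; apply: eq_bigr => i _; rewrite (H i).2.
Qed.

Lemma L2v_CauchySchwarz p q (u v : V -> 'M[R]_(p, q)) : inL2v A u -> inL2v A v ->
  \int[mu]_(x in A) `|frob (u x) (v x)| <= L2vnorm A u * L2vnorm A v.
Proof.
move=> uL vL; have [iuv _] := Rintegral_frobE uL vL.
have fu := inL2_fnorm uL; have fv := inL2_fnorm vL.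
apply: le_trans (le_trans (ler_norm _) (L2_CauchySchwarz mA fu fv)).
apply: le_Rintegral => //.
- by have := integrable_norm iuv; apply: eq_integrable.
- exact: inL2M_integrable.
- by move=> x _; exact: frob_CauchySchwarz.
Qed.

Lemma L2_CauchySchwarz_norm f g : inL2 A f -> inL2 A g ->
  \int[mu]_(x in A) `|f x * g x| <= L2norm A f * L2norm A g.
Proof.
move=> fL gL.
have H h : inL2 A h -> inL2 A (fun x => `|h x|) /\ L2norm A (fun x => `|h x|) = L2norm A h.
  move=> [mh h2]; split.
    split; first exact: measurableT_comp.
    by apply: eq_integrable h2 => // x _; rewrite real_normK ?num_real.
  by congr Num.sqrt; apply: eq_Rintegral => x _; rewrite real_normK ?num_real.
have [fL' <-] := H f fL; have [gL' <-] := H g gL.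
apply: le_trans (le_trans (ler_norm _) (L2_CauchySchwarz mA fL' gL')).
by rewrite le_eqVlt; apply/orP; left; apply/eqP; apply: eq_Rintegral => x _; rewrite normrM.
Qed.

Lemma integrable_weight w f (M : R) : measurable_fun A w ->
  {ae mu, forall x, A x -> `|w x| <= M} -> mu.-integrable A (EFin \o f) ->
  mu.-integrable A (EFin \o (fun x => w x * f x)).
Proof.
move=> mw wM fi; have mf : measurable_fun A f.
  by apply/measurable_EFinP; case/integrableP : fi.
apply/integrableP; split; first by apply/measurable_EFinP; exact: measurable_funM.
have /integrableP[_] := integrableZl mA `|M| fi; apply: le_lt_trans.
apply: ae_ge0_le_integral => //.
- by apply: measurableT_comp => //; apply/measurable_EFinP; exact: measurable_funM.
- apply: measurableT_comp => //; apply: emeasurable_funM => //.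
  exact/measurable_EFinP.
apply: filterS wM => x wM Ax; rewrite /= lee_fin !normrM normr_id ler_wpM2r//.
by rewrite (le_trans (wM Ax))// ler_norm.
Qed.

Lemma norm_Rintegral_weight w f (M : R) : measurable_fun A w ->
  {ae mu, forall x, A x -> `|w x| <= M} -> mu.-integrable A (EFin \o f) ->
  `|\int[mu]_(x in A) (w x * f x)| <= `|M| * \int[mu]_(x in A) `|f x|.
Proof.
move=> mw wM fi; have wfi := integrable_weight mw wM fi.
apply: (le_trans (le_normr_Rintegral mA wfi)).
have nfi : mu.-integrable A (EFin \o (fun x => `|f x|)).
  by have := integrable_norm fi; apply: eq_integrable.
rewrite -RintegralZl//; apply: ae_le_Rintegral.
- by have := integrable_norm wfi; apply: eq_integrable.
- by have := integrableZl mA `|M| nfi; apply: eq_integrable.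
apply: filterS wM => x wM Ax; rewrite normrM ler_wpM2r//.
by rewrite (le_trans (wM Ax))// ler_norm.
Qed.

Lemma Rintegral_weight_ge w f (M lo : R) : measurable_fun A w ->
  {ae mu, forall x, A x -> `|w x| <= M} -> {ae mu, forall x, A x -> lo <= w x} ->
  mu.-integrable A (EFin \o f) -> (forall x, A x -> 0 <= f x) ->
  lo * \int[mu]_(x in A) f x <= \int[mu]_(x in A) (w x * f x).
Proof.
move=> mw wM wlo fi f0; rewrite -RintegralZl//; apply: ae_le_Rintegral.
- by have := integrableZl mA lo fi; apply: eq_integrable.
- exact: integrable_weight wM fi.
by apply: filterS wlo => x wlo Ax; rewrite ler_wpM2r ?f0 ?wlo.
Qed.

(** The coefficients are bounded only almost everywhere, so the weight is kept outside the pointwise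
    form [m] and estimated under the integral. *)
Lemma weighted_bform (W : lmodType R) (X : (V -> W) -> Prop) (N : (V -> W) -> R)
    (m : (V -> W) -> (V -> W) -> V -> R) w (M : R) :
  measurable_fun A w -> {ae mu, forall x, A x -> `|w x| <= M} ->
  (forall a u v z, X u -> X v -> X z -> forall x, A x ->
     m (flin a u v) z x = a * m u z x + m v z x) ->
  (forall a u v z, X u -> X v -> X z -> forall x, A x ->
     m z (flin a u v) x = a * m z u x + m z v x) ->
  (forall u v, X u -> X v -> mu.-integrable A (EFin \o m u v)) ->
  (forall u v, X u -> X v -> \int[mu]_(x in A) `|m u v x| <= N u * N v) ->
  bform X N (fun u v => \int[mu]_(x in A) (w x * m u v x)).
Proof.
move=> mw wM ml mr mi mN.
have wi u v : X u -> X v -> mu.-integrable A (EFin \o (fun x => w x * m u v x)).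
  by move=> Xu Xv; exact: integrable_weight wM (mi u v Xu Xv).
split.
- move=> a u v z Xu Xv Xz; rewrite -Rintegral_lin//; try exact: wi.
  by apply: eq_Rintegral => x /set_mem Ax; rewrite ml//; ring.
- move=> a u v z Xu Xv Xz; rewrite -Rintegral_lin//; try exact: wi.
  by apply: eq_Rintegral => x /set_mem Ax; rewrite mr//; ring.
- exists `|M| => // u v Xu Xv; rewrite -mulrA.
  apply: (le_trans (norm_Rintegral_weight mw wM (mi u v Xu Xv))).
  by rewrite ler_wpM2l ?mN.
Qed.

End L2_norms.

(** * The elastic and acoustic forms *)

Section discrete_functions.
Context (R : realType) (n : nat) (P : problem R n) (D : discretization R n).
Hypotheses (hgeo : geometry P) (hmesh : is_mesh P D).
Implicit Types (k : cells D) (F : faces D).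

(* The spaces [Vhe] and [Vha] with [poly_on] replaced by [cell_poly]; they are only
   used as domains of the bilinear forms. *)
Definition broken_e (v : 'rV[R]_n.+1 -> 'rV[R]_n.+1) := inL2v (Ome P) v /\
  forall k, elastic P k -> forall j, cell_poly k (pe k) (fun x => v x ord0 j).

Definition broken_a (psi : 'rV[R]_n.+1 -> R^o) := inL2 (Oma P) psi /\
  forall k, acoustic P k -> cell_poly k (pa k) psi.

Lemma Vhe_broken v : Vhe P D v -> broken_e v.
Proof. by move=> [vL vp]; split => // k ke j; exact: poly_on_cell_poly (vp k ke j). Qed.

Lemma Vha_broken psi : Vha P D psi -> broken_a psi.
Proof. by move=> [vL vp]; split => // k ka; exact: poly_on_cell_poly (vp k ka). Qed.

Lemma measurable_Ome : measurable (Ome P).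
Proof. by have [oO _ _ _] := Ome_convex hgeo; exact: open_measurable_rV. Qed.

Lemma measurable_Oma : measurable (Oma P).
Proof. by have [oO _ _ _] := Oma_convex hgeo; exact: open_measurable_rV. Qed.

Lemma broken_e_lin a u v : broken_e u -> broken_e v -> broken_e (flin a u v).
Proof.
move=> [uL up] [vL vp]; have mO := measurable_Ome; split.
  by apply: inL2vD => //; exact: inL2vZ.
move=> k ke j; apply: eq_cell_poly (cell_poly_lin a (up k ke j) (vp k ke j)) => x _.
by rewrite !mxE.
Qed.

Lemma broken_a_lin a f g : broken_a f -> broken_a g -> broken_a (flin a f g).
Proof.
move=> [fL fp] [gL gp]; have mO := measurable_Oma; split; first exact: inL2_lin.
by move=> k ka; exact: cell_poly_lin (fp k ka) (gp k ka).
Qed.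

Lemma L2norm_subset (A B : set 'rV[R]_n.+1) f : measurable A -> measurable B -> B `<=` A ->
  inL2 A f -> L2norm B f <= L2norm A f.
Proof.
move=> mA mB BA [mf f2]; apply: ler_wsqrtr; apply: fine_le.
- by apply: integrable_fin_num => //; exact: integrableS f2.
- exact: integrable_fin_num.
apply: ge0_subset_integral => //; last by move=> x _; rewrite lee_fin sqr_ge0.
by case/integrableP : f2.
Qed.

(** [lim] commutes with linear combinations only when the limits exist; here polynomials provide
    them. *)
Lemma strc_comb k p (I : finType) (a : I -> R) (l : I -> 'rV[R]_n.+1 -> R) L y :
  (forall i, cell_poly k p (l i)) -> (forall x, cell k x -> L x = \sum_i a i * l i x) ->
  closure (cell k) y -> strc k L y = \sum_i a i * strc k (l i) y.
Proof.
move=> lp LE ky; have /choice[c cP] : forall i, exists c, @cell_pol _ _ D k p (l i) c.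
  by move=> i; exact: lp.
have Lc : @cell_pol _ _ D k p L (fun m => \sum_i a i * c i m).
  move=> x kx; rewrite LE// /peval; under [in RHS]eq_bigr do rewrite mulr_suml.
  rewrite exchange_big/=; apply: eq_bigr => i _; rewrite (cP i x kx) /peval mulr_sumr.
  by apply: eq_bigr => m _; rewrite mulrA.
rewrite (strc_peval Lc ky) /peval; under eq_bigr do rewrite mulr_suml.
rewrite exchange_big/=; apply: eq_bigr => i _; rewrite (strc_peval (cP i) ky) /peval.
by rewrite mulr_sumr; apply: eq_bigr => m _; rewrite mulrA.
Qed.

Lemma cell_xget k : cell k (xget 0 (cell k)).
Proof. by have [x kx] := cell_neq0 hmesh k; apply: xgetI kx. Qed.

End discrete_functions.

Section tensor_operators.
Context (R : realType) (d : nat).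
Implicit Types (C S : tensor4 R d) (A B : 'M[R]_d).

Lemma frob_tapplyC C A B : tsymmetric C -> frob (tapply C A) B = frob (tapply C B) A.
Proof.
move=> Csym; have E M1 M2 : frob (tapply C M1) M2 =
    \sum_(p : 'I_d * 'I_d) \sum_(q : 'I_d * 'I_d) C p.1 p.2 q.1 q.2 * M1 q.1 q.2 * M2 p.1 p.2.
  rewrite /frob pair_bigA/=; apply: eq_bigr => -[i j] _ /=; rewrite mxE pair_bigA/= mulr_suml.
  by apply: eq_bigr => -[k l] _.
rewrite !E exchange_big/=; apply: eq_bigr => p _; apply: eq_bigr => q _.
by rewrite (Csym p.1 p.2 q.1 q.2).2 mulrAC.
Qed.

Lemma trmx_tapply C A : tsymmetric C -> (tapply C A)^T = tapply C A.
Proof.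
move=> Csym; apply/matrixP => i j; rewrite !mxE; apply: eq_bigr => k _; apply: eq_bigr => l _.
by rewrite (Csym j i k l).1.
Qed.

Lemma tapplyZ C a A : tapply C (a *: A) = a *: tapply C A.
Proof.
apply/matrixP => i j; rewrite !mxE mulr_sumr; apply: eq_bigr => k _; rewrite mulr_sumr.
by apply: eq_bigr => l _; rewrite mxE mulrCA.
Qed.

Lemma frob_tsqrt S C A : is_tsqrt S C -> A^T = A ->
  frob (tapply C A) A = frob (tapply S A) (tapply S A).
Proof. by move=> [Ssym _ SC] AT; rewrite -SC// frob_tapplyC. Qed.

(** Homogeneity reduces to the unit ball, where the supremum is a genuine bound because the entries
    of [S] bound the image. *)
Lemma topnorm_bound S A : A^T = A -> fnorm (tapply S A) <= topnorm S * fnorm A.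
Proof.
move=> AT; have [A0|A0] := eqVneq (fnorm A) 0.
  have /frob_eq0 -> : frob A A = 0 by rewrite -fnorm_sqr A0 expr0n.
  by rewrite -(scale0r 0) tapplyZ !fnormZ normr0 !mul0r mulr0.
have Ap : 0 < fnorm A by rewrite lt_neqAle eq_sym A0 fnorm_ge0.
rewrite -ler_pdivrMr// mulrC -[(fnorm A)^-1]ger0_norm ?invr_ge0 ?fnorm_ge0// -fnormZ -tapplyZ.
apply: sup_ubound; last first.
  exists ((fnorm A)^-1 *: A) => //; split; first by rewrite linearZ/= AT.
  by rewrite fnormZ ger0_norm ?invr_ge0 ?fnorm_ge0// mulVf.
pose M := \sum_i \sum_j (\sum_k \sum_l `|S i j k l|) ^+ 2.
exists (Num.sqrt M) => _ [B [_ B1] <-]; rewrite ler_wsqrtr// /frob.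
apply: ler_sum => i _; apply: ler_sum => j _; rewrite -expr2 -[leLHS]real_normK ?num_real//.
have b0 : 0 <= \sum_k \sum_l `|S i j k l| by apply: sumr_ge0 => k _; exact: sumr_ge0.
rewrite lerXn2r ?nnegrE// mxE (le_trans (ler_norm_sum _ _ _))//; apply: ler_sum => k _.
rewrite (le_trans (ler_norm_sum _ _ _))//; apply: ler_sum => l _.
by rewrite normrM ler_piMr// (le_trans (le_fnorm B k l)).
Qed.

End tensor_operators.

Section elastic_form.
Context (R : realType) (n : nat) (P : problem R n) (D : discretization R n).
Hypotheses (hgeo : geometry P) (hmat : materials P) (hmesh : is_mesh P D).
Variable cT : R.
Hypotheses (hreg : mesh_regular D cT) (helw : elementwise_constant P D).
Variable alpha : R.
Hypothesis alpha0 : 0 < alpha.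
Implicit Types (k : cells D) (F : faces D).
Notation V := 'rV[R]_n.+1.
Notation X := (broken_e P D).
Notation N := (L2vnorm (Ome P)).
Notation phi F := (fun s : 'rV[R]_n => vtx F ord0 + s *m edges (vtx F)).
Notation rS := (@ref_simplex R n).
Notation g := (fun k (u : V -> V) x => tapply (CCh P (xget 0 (cell k))) (eps u x)).

Let N0 u : X u -> 0 <= N u. Proof. by move=> _; exact: L2norm_ge0. Qed.
Let Xlin := broken_e_lin hgeo (D := D).

Lemma component_cop k i : elastic P k -> cop X N k (pe k) (fun u x => u x ord0 i).
Proof.
move=> ke; apply: (cop_base hmesh).
- by move=> a u v x _ _ _; rewrite !mxE.
- by move=> u [_ up]; exact: up.
- move=> u [uL _]; have mO := measurable_Ome hgeo.
  apply: le_trans (L2norm_entry_le mO ord0 i uL).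
  apply: L2norm_subset => //; first exact: measurable_cell hmesh k.
  by move=> x kx; exact: (elastic_sub hgeo hmesh ke kx).
Qed.

Lemma eps_cop k i j : elastic P k -> cop X N k (pe k) (fun u x => eps u x i j).
Proof.
move=> ke.
pose l (b : bool) (u : V -> V) (x : V) : R :=
  if b then 'D_(delta_mx ord0 j) (fun y => u y ord0 i) x
  else 'D_(delta_mx ord0 i) (fun y => u y ord0 j) x.
apply: (eq_cop Xlin _ (cop_sum (fun=> 2^-1) (l := l) _)).
  by move=> u x _ _; rewrite big_bool/= /l !mxE mulrDr.
by case; apply: (cop_derive hmesh); exact: component_cop.
Qed.

Lemma tapply_cop k (C : tensor4 R n.+1) i j : elastic P k ->
  cop X N k (pe k) (fun u x => tapply C (eps u x) i j).
Proof.
move=> ke; apply: (eq_cop Xlin _ (cop_sum (fun kl : 'I_n.+1 * 'I_n.+1 => C i j kl.1 kl.2)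
   (l := fun kl u x => eps u x kl.1 kl.2) _)).
  by move=> u x _ _; rewrite mxE pair_bigA.
by move=> kl; exact: eps_cop.
Qed.

Lemma CC_cell k x : elastic P k -> cell k x -> CC P x = CC P (xget 0 (cell k)).
Proof. by move=> ke kx; apply: helw.1 ke _ _ kx _; exact: cell_xget hmesh k. Qed.

Lemma sigma_cop k i j : elastic P k -> cop X N k (pe k) (fun u x => sigma P u x i j).
Proof.
move=> ke; apply: (eq_cop Xlin _ (tapply_cop (CC P (xget 0 (cell k))) i j ke)).
by move=> u x _ kx; rewrite /sigma (CC_cell ke kx).
Qed.

Lemma vjump_mbop F : faces_e P F -> mbop X N rS (fun u s => vjump F u (phi F s)).
Proof.
move=> FF; apply: mbop_sum => // k Fk; have ke := faces_e_owner hgeo hmesh FF Fk.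
apply: mbop_sop => // i j.
have H : sop X N rS (fun u s => strc k (fun y => u y ord0 i) (phi F s)).
  apply: (cop_trace_sop hmesh _ (measurable_face_param F)) (component_cop i ke).
    exact: measurable_ref_simplex.
  by move=> s Ss; apply: owner_closure Fk _; exact: face_param.
apply: eq_sop (sop_sum (Q := xpredT) (fun l : 'I_1 => nrm k F l j) (fun _ _ => H)).
  exact: Xlin.
by move=> u s _ _; rewrite !mxE; apply: eq_bigr => l _; rewrite !mxE mulrC !ord1.
Qed.

Lemma trmx_eps (u : V -> V) x : (eps u x)^T = eps u x.
Proof. by rewrite /eps linearZ/= linearD/= trmxK addrC. Qed.

(** If the norm of the root vanished, the root would kill the identity tensor, against
    ellipticity. *)
Lemma Cbar_gt0 k : elastic P k -> 0 < Cbar P k.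
Proof.
move=> ke; have Ox := elastic_sub hgeo hmesh ke (cell_xget hmesh k).
set x := xget 0 (cell k) in Ox *; have [gamma g0 gP] := CC_elliptic hmat.
rewrite /Cbar -/x lt_neqAle sqr_ge0 andbT eq_sym sqrf_eq0; apply/eqP => t0.
have I1 : (1%:M : 'M[R]_n.+1)^T = 1%:M by exact: trmx1.
have := topnorm_bound (CCh P x) I1; rewrite t0 mul0r => S0.
have Sz : frob (tapply (CCh P x) 1%:M) (tapply (CCh P x) 1%:M) = 0.
  by rewrite -fnorm_sqr (_ : fnorm _ = 0) ?expr0n//; apply/eqP; rewrite eq_le S0 fnorm_ge0.
have := gP x 1%:M Ox I1; rewrite (frob_tsqrt (CCh_sqrt hmat Ox) I1) Sz.
rewrite leNgt pmulr_rgt0// exprn_gt0//.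
rewrite lt_neqAle fnorm_ge0 andbT eq_sym; apply/eqP => f0.
have : frob (1%:M : 'M[R]_n.+1) 1%:M = 0 by rewrite -fnorm_sqr f0 expr0n.
move/frob_eq0/matrixP/(_ ord0 ord0)/eqP; rewrite !mxE eqxx oner_eq0.
by [].
Qed.

Lemma eta_ge F k : owner F k ->
  alpha * (Cbar P k * (pe k)%:R ^+ 2 / diam (cell k)) <= Defs.eta P alpha F.
Proof.
move=> Fk; rewrite /Defs.eta ler_wpM2l ?(ltW alpha0)//.
exact: (le_bigmax_cond _ (fun k => Cbar P k * (pe k)%:R ^+ 2 / diam (cell k)) Fk).
Qed.

Lemma sigma_sym k (u v : V -> V) x : elastic P k -> cell k x ->
  frob (sigma P u x) (eps v x) = frob (sigma P v x) (eps u x).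
Proof.
move=> ke kx; apply: frob_tapplyC; apply: CC_sym hmat _ _.
exact: (elastic_sub hgeo hmesh ke kx).
Qed.

(** The root is frozen at a point of the element, so that [g k u] is polynomial there; elementwise
    constancy is available for [CC], and the root at that point squares to it. *)
Lemma sigma_sqrt k (u : V -> V) x : elastic P k -> cell k x ->
  frob (sigma P u x) (eps u x) = frob (g k u x) (g k u x).
Proof.
move=> ke kx; rewrite /sigma (CC_cell ke kx); apply: frob_tsqrt; last exact: trmx_eps.
apply: CCh_sqrt hmat _ _; exact: (elastic_sub hgeo hmesh ke (cell_xget hmesh k)).
Qed.

Lemma flux_le F k (u : V -> V) s : faces_e P F -> owner F k -> X u -> rS s ->
  frob (mtrc k (sigma P u) (phi F s)) (mtrc k (sigma P u) (phi F s)) <=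
  Cbar P k * frob (mtrc k (g k u) (phi F s)) (mtrc k (g k u) (phi F s)).
Proof.
move=> FF Fk Xu Ss; have ke := faces_e_owner hgeo hmesh FF Fk.
have ky : closure (cell k) (phi F s) by apply: owner_closure Fk _; exact: face_param.
set y := phi F s in ky *; set S := CCh P (xget 0 (cell k)).
have [Ssym _ SC] : is_tsqrt S (CC P (xget 0 (cell k))).
  by apply: CCh_sqrt hmat _ _; exact: (elastic_sub hgeo hmesh ke (cell_xget hmesh k)).
(* [topnorm] only tests symmetric matrices, so the trace must be shown symmetric. *)
have gT : (mtrc k (g k u) y)^T = mtrc k (g k u) y.
  apply/matrixP => i j; rewrite !mxE; congr strc; apply/funext => x.
  by rewrite -[in LHS](trmx_tapply _ Ssym) mxE.
have -> : mtrc k (sigma P u) y = tapply S (mtrc k (g k u) y).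
  apply/matrixP => i j; rewrite !mxE pair_bigA/=.
  rewrite (strc_comb (p := pe k) (I := ('I_n.+1 * 'I_n.+1)%type)
    (a := fun kl => S i j kl.1 kl.2) (l := fun kl x => g k u x kl.1 kl.2)) => //.
  - by apply: eq_bigr => kl _; rewrite mxE.
  - by move=> kl; exact: cop_cell_poly (tapply_cop S kl.1 kl.2 ke) Xu.
  - move=> x kx; rewrite /sigma (CC_cell ke kx) -SC ?trmx_eps// mxE pair_bigA.
    by [].
rewrite /Cbar -!fnorm_sqr -exprMn lerXn2r ?nnegrE ?fnorm_ge0 ?topnorm_bound//.
exact: le_trans (fnorm_ge0 _) (topnorm_bound _ gT).
Qed.

Lemma Ae_bform : bform X N (Ae P D alpha).
Proof.
apply: (sip_bform hmesh N0 Xlin (Defs.eta P alpha) (deg := @pe _ _ D)).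
- by move=> F k FF Fk; exact: (faces_e_owner hgeo hmesh FF Fk).
- by move=> k i j; exact: sigma_cop.
- by move=> k i j; exact: eps_cop.
- by move=> F; exact: vjump_mbop.
Qed.

Lemma Ae_sym u v : X u -> X v -> Ae P D alpha u v = Ae P D alpha v u.
Proof.
apply: sip_sym => k u' v' x ke _ _ kx; exact: sigma_sym ke kx.
Qed.

(** The norm uses the root at each point and [sip_norm2] pairs stress with strain; both densities
    are [C eps : eps]. Nonnegativity comes first, because [Num.sqrt] of a negative number is 0. *)
Lemma dGe_sqr u : X u -> dGe P D alpha u ^+ 2 =
  sip_norm2 (elastic P (D := D)) (faces_e P (D := D)) (Defs.eta P alpha) (sigma P) (@eps R n)
    (@vjump R n D) u.
Proof.
move=> Xu.
have nn : 0 <= sip_norm2 (elastic P (D := D)) (faces_e P (D := D)) (Defs.eta P alpha) (sigma P)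
    (@eps R n) (@vjump R n D) u.
  apply: (sip_norm2_ge0 (X := X) (deg := @pe _ _ D) (w := @Cbar R n P D) hmesh (g := g) _ alpha0) => //.
  - exact: Cbar_gt0.
  - exact: pe_ge1 hmesh.
  - by move=> F k FF Fk; exact: (faces_e_owner hgeo hmesh FF Fk).
  - by move=> F k _; exact: eta_ge.
  - by move=> k v x ke _; exact: sigma_sqrt.
rewrite -[RHS](sqr_sqrtr nn); congr (Num.sqrt _ ^+ 2); congr (_ + _).
  apply: eq_bigr => k ke; rewrite L2norm_sqr; apply: eq_Rintegral => x /set_mem kx.
  have Ox := elastic_sub hgeo hmesh ke kx.
  by rewrite fnorm_sqr -(frob_tsqrt (CCh_sqrt hmat Ox) (trmx_eps u x)).
apply: eq_bigr => F FF; congr (_ * _); apply: eq_Rintegral => s _.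
have [k Fk] := face_owner hmesh F.
have e0 : 0 <= Defs.eta P alpha F.
  apply: le_trans (eta_ge Fk); have ke := faces_e_owner hgeo hmesh FF Fk.
  rewrite mulr_ge0 ?(ltW alpha0)// divr_ge0 ?(ltW (diam_gt0 hmesh k))//.
  by rewrite mulr_ge0 ?sqr_ge0.
by rewrite fnorm_sqr frobZr frobC frobZr mulrA -expr2 sqr_sqrtr// [RHS]frobC frobZr.
Qed.

Lemma Ae_coercive u : 4 * trace_const n cT <= alpha -> X u ->
  2^-1 * dGe P D alpha u ^+ 2 <= Ae P D alpha u u <= 3 / 2 * dGe P D alpha u ^+ 2.
Proof.
move=> ha Xu; rewrite (dGe_sqr Xu).
apply: (sip_coercive hmesh hreg N0 Xlin (deg := @pe _ _ D) (w := @Cbar R n P D) (g := g) alpha0) Xu ha.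
- exact: Cbar_gt0.
- exact: pe_ge1 hmesh.
- by move=> F k FF Fk; exact: (faces_e_owner hgeo hmesh FF Fk).
- by move=> F k _; exact: eta_ge.
- by move=> k i j; exact: sigma_cop.
- by move=> k i j; exact: tapply_cop.
- by move=> F; exact: vjump_mbop.
- by move=> k v x ke _; exact: sigma_sqrt.
- by move=> F k v s; exact: flux_le.
Qed.

End elastic_form.

Section acoustic_form.
Context (R : realType) (n : nat) (P : problem R n) (D : discretization R n).
Hypotheses (hgeo : geometry P) (hmat : materials P) (hmesh : is_mesh P D).
Variable cT : R.
Hypotheses (hreg : mesh_regular D cT) (helw : elementwise_constant P D).
Variable beta : R.
Hypothesis beta0 : 0 < beta.
Implicit Types (k : cells D) (F : faces D).
Notation V := 'rV[R]_n.+1.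
Notation X := (broken_a P D).
Notation N := (L2norm (Oma P)).
Notation phi F := (fun s : 'rV[R]_n => vtx F ord0 + s *m edges (vtx F)).
Notation rS := (@ref_simplex R n).
Notation g := (fun k (u : V -> R^o) x => Num.sqrt (rhobar P k) *: sgrad u x).

Let N0 (u : V -> R^o) : X u -> 0 <= N u. Proof. by move=> _; exact: L2norm_ge0. Qed.
Let Xlin := broken_a_lin hgeo (D := D).

Lemma value_cop k : acoustic P k -> cop X N k (pa k) (fun u x => u x).
Proof.
move=> ka; apply: (cop_base hmesh) => //.
- by move=> u [_ up]; exact: up.
- move=> u [uL _]; have mO := measurable_Oma hgeo.
  apply: L2norm_subset => //; first exact: measurable_cell hmesh k.
  by move=> x kx; exact: (acoustic_sub hgeo hmesh ka kx).
Qed.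

Lemma sgrad_cop k i j : acoustic P k -> cop X N k (pa k) (fun u x => sgrad u x i j).
Proof.
move=> ka; apply: (eq_cop Xlin _ (cop_derive hmesh j (value_cop ka))).
by move=> u x _ _; rewrite mxE.
Qed.

Lemma sgradZ_cop k a i j : acoustic P k -> cop X N k (pa k) (fun u x => (a *: sgrad u x) i j).
Proof.
move=> ka; apply: (eq_cop Xlin _ (cop_sum (fun _ : 'I_1 => a) (fun=> sgrad_cop i j ka))).
by move=> u x _ _; rewrite big_ord1 [RHS]mxE.
Qed.

Lemma rhoa_cell k x : acoustic P k -> cell k x -> rhoa P x = rhobar P k.
Proof. by move=> ka kx; apply: helw.2 ka _ _ kx _; exact: cell_xget hmesh k. Qed.

Lemma sflux_cop k i j : acoustic P k -> cop X N k (pa k) (fun u x => sflux P u x i j).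
Proof.
move=> ka; apply: (eq_cop Xlin _ (sgradZ_cop (rhobar P k) i j ka)).
by move=> u x _ kx; rewrite /sflux (rhoa_cell ka kx).
Qed.

Lemma sjump_mbop F : faces_a P F -> mbop X N rS (fun u s => sjump F u (phi F s)).
Proof.
move=> FF; apply: mbop_sum => // k Fk; have ka := faces_a_owner hgeo hmesh FF Fk.
apply: mbop_sop => // i j.
have H : sop X N rS (fun u s => strc k u (phi F s)).
  apply: (cop_trace_sop hmesh _ (measurable_face_param F)) (value_cop ka).
    exact: measurable_ref_simplex.
  by move=> s Ss; apply: owner_closure Fk _; exact: face_param.
apply: eq_sop (sop_sum (Q := xpredT) (fun l : 'I_1 => nrm k F i j) (fun _ _ => H)).
  exact: Xlin.
by move=> u s _ _; rewrite big_ord1 mxE mulrC.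
Qed.

(** The density is bounded below only almost everywhere; being constant on an open element, of
    positive measure, it satisfies the bound at every point of it. *)
Lemma rhobar_gt0 k : acoustic P k -> 0 < rhobar P k.
Proof.
move=> ka; have [_ [lo [hi [lo0 ae]]]] := rhoa_density hmat.
have oc : open (cell k) by exact: cell_open hmesh k.
apply: (lt_le_trans lo0); rewrite leNgt; apply/negP => rlo.
have := leb_open_gt0 oc (cell_neq0 hmesh k).
suff -> : leb R n.+1 (cell k) = 0%E by rewrite ltxx.
apply/negligibleP; first exact: measurable_cell hmesh k.
apply: negligibleS ae => x kx /= H.
have /andP[+ _] := H (acoustic_sub hgeo hmesh ka kx).
by rewrite (rhoa_cell ka kx) leNgt rlo.
Qed.

Lemma chi_ge F k : owner F k ->
  beta * (rhobar P k * (pa k)%:R ^+ 2 / diam (cell k)) <= chi P beta F.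
Proof.
move=> Fk; rewrite /chi ler_wpM2l ?(ltW beta0)//.
exact: (le_bigmax_cond _ (fun k => rhobar P k * (pa k)%:R ^+ 2 / diam (cell k)) Fk).
Qed.

Lemma sflux_sqrt k (u : V -> R^o) x : acoustic P k -> cell k x ->
  frob (sflux P u x) (sgrad u x) = frob (g k u x) (g k u x).
Proof.
move=> ka kx; rewrite /sflux (rhoa_cell ka kx) frobZr frobC frobZr.
rewrite [in RHS]frobC frobZr mulrA -expr2 sqr_sqrtr// ltW//; exact: rhobar_gt0.
Qed.

Lemma sflux_le F k (u : V -> R^o) s : faces_a P F -> owner F k -> X u -> rS s ->
  frob (mtrc k (sflux P u) (phi F s)) (mtrc k (sflux P u) (phi F s)) <=
  rhobar P k * frob (mtrc k (g k u) (phi F s)) (mtrc k (g k u) (phi F s)).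
Proof.
move=> FF Fk Xu Ss; have ka := faces_a_owner hgeo hmesh FF Fk.
have ky : closure (cell k) (phi F s) by apply: owner_closure Fk _; exact: face_param.
set y := phi F s in ky *.
have tr a (L : (V -> R^o) -> V -> 'rV[R]_n.+1) :
    (forall x, cell k x -> L u x = a *: sgrad u x) -> mtrc k (L u) y = a *: mtrc k (sgrad u) y.
  move=> LE; apply/matrixP => i j; rewrite !mxE.
  rewrite (strc_comb (p := pa k) (I := 'I_1) (a := fun=> a)
    (l := fun _ x => sgrad u x i j)) ?big_ord1//.
    by move=> _; exact: cop_cell_poly (sgrad_cop i j ka) Xu.
  by move=> x kx; rewrite LE// big_ord1 [LHS]mxE.
rewrite (tr (rhobar P k) (sflux P)) => [|x kx]; last by rewrite /sflux (rhoa_cell ka kx).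
rewrite (tr (Num.sqrt (rhobar P k)) (g k))//.
rewrite !frobZr ![frob (_ *: _) _]frobC !frobZr [X in _ <= _ * X]mulrA -expr2.
by rewrite sqr_sqrtr// ltW//; exact: rhobar_gt0.
Qed.

Lemma Aa_bform : bform X N (Aa P D beta).
Proof.
apply: (sip_bform hmesh N0 Xlin (chi P beta) (deg := @pa _ _ D)).
- by move=> F k FF Fk; exact: (faces_a_owner hgeo hmesh FF Fk).
- by move=> k i j; exact: sflux_cop.
- by move=> k i j; exact: sgrad_cop.
- by move=> F; exact: sjump_mbop.
Qed.

Lemma Aa_sym u v : X u -> X v -> Aa P D beta u v = Aa P D beta v u.
Proof.
apply: sip_sym => k u' v' x ka _ _ kx.
by rewrite /sflux frobC frobZr [RHS]frobC frobZr frobC.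
Qed.

Lemma dGa_sqr u : X u -> dGa P D beta u ^+ 2 =
  sip_norm2 (acoustic P (D := D)) (faces_a P (D := D)) (chi P beta) (sflux P) (@sgrad R n)
    (@sjump R n D) u.
Proof.
move=> Xu.
have nn : 0 <= sip_norm2 (acoustic P (D := D)) (faces_a P (D := D)) (chi P beta) (sflux P)
    (@sgrad R n) (@sjump R n D) u.
  apply: (sip_norm2_ge0 (X := X) (deg := @pa _ _ D) (w := @rhobar R n P D) hmesh (g := g) _ beta0)
    => //.
  - exact: rhobar_gt0.
  - exact: pa_ge1 hmesh.
  - by move=> F k FF Fk; exact: (faces_a_owner hgeo hmesh FF Fk).
  - by move=> F k _; exact: chi_ge.
  - by move=> k v x ka _; exact: sflux_sqrt.
rewrite -[RHS](sqr_sqrtr nn); congr (Num.sqrt _ ^+ 2); congr (_ + _).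
  apply: eq_bigr => k ka; rewrite L2norm_sqr; apply: eq_Rintegral => x /set_mem kx.
  by rewrite fnorm_sqr (sflux_sqrt u ka kx) (rhoa_cell ka kx).
apply: eq_bigr => F FF; congr (_ * _); apply: eq_Rintegral => s _.
have [k Fk] := face_owner hmesh F.
have e0 : 0 <= chi P beta F.
  apply: le_trans (chi_ge Fk); have ka := faces_a_owner hgeo hmesh FF Fk.
  rewrite mulr_ge0 ?(ltW beta0)// divr_ge0 ?(ltW (diam_gt0 hmesh k))//.
  by rewrite mulr_ge0 ?sqr_ge0// (ltW (rhobar_gt0 ka)).
by rewrite fnorm_sqr frobZr frobC frobZr mulrA -expr2 sqr_sqrtr// [RHS]frobC frobZr.
Qed.

Lemma Aa_coercive u : 4 * trace_const n cT <= beta -> X u ->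
  2^-1 * dGa P D beta u ^+ 2 <= Aa P D beta u u <= 3 / 2 * dGa P D beta u ^+ 2.
Proof.
move=> hb Xu; rewrite (dGa_sqr Xu).
apply: (sip_coercive hmesh hreg N0 Xlin (deg := @pa _ _ D) (w := @rhobar R n P D) (g := g) beta0) Xu hb.
- exact: rhobar_gt0.
- exact: pa_ge1 hmesh.
- by move=> F k FF Fk; exact: (faces_a_owner hgeo hmesh FF Fk).
- by move=> F k _; exact: chi_ge.
- by move=> k i j; exact: sflux_cop.
- by move=> k i j; exact: sgradZ_cop.
- by move=> F; exact: sjump_mbop.
- by move=> k v x ka _; exact: sflux_sqrt.
- by move=> F k v s; exact: sflux_le.
Qed.

End acoustic_form.

(** * Energy of the semidiscrete problem *)

Section weighted_forms.
Context (R : realType) (n : nat) (P : problem R n) (D : discretization R n).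
Hypotheses (hgeo : geometry P) (hmat : materials P).
Notation V := 'rV[R]_n.+1.
Notation mu := (leb R n.+1).

Definition weighted_e (w : V -> R) (u v : V -> V) : R :=
  \int[mu]_(x in Ome P) (w x * frob (u x) (v x)).

Definition weighted_a (w : V -> R) (f g : V -> R^o) : R :=
  \int[mu]_(x in Oma P) (w x * (f x * g x)).

Lemma weighted_e_bform (w : V -> R) M : measurable_fun (Ome P) w ->
  {ae mu, forall x, Ome P x -> `|w x| <= M} ->
  bform (broken_e P D) (L2vnorm (Ome P)) (weighted_e w).
Proof.
move=> mw wM; have mO := measurable_Ome hgeo.
apply: (weighted_bform mO (m := fun u v x => frob (u x) (v x)) mw wM).
- by move=> a u v z _ _ _ x _; rewrite frobC /flin frobDr frobZr !(frobC (z x)).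
- by move=> a u v z _ _ _ x _; rewrite /flin frobDr frobZr.
- by move=> u v [uL _] [vL _]; have [] := Rintegral_frobE mO uL vL.
- by move=> u v [uL _] [vL _]; exact: L2v_CauchySchwarz.
Qed.

Lemma weighted_a_bform (w : V -> R) M : measurable_fun (Oma P) w ->
  {ae mu, forall x, Oma P x -> `|w x| <= M} ->
  bform (broken_a P D) (L2norm (Oma P)) (weighted_a w).
Proof.
move=> mw wM; have mO := measurable_Oma hgeo.
apply: (weighted_bform mO (m := fun (f g : V -> R^o) x => f x * g x) mw wM).
- by move=> a u v z _ _ _ x _; rewrite mulrDl mulrA.
- by move=> a u v z _ _ _ x _; rewrite mulrDr mulrCA.
- by move=> u v [uL _] [vL _]; exact: inL2M_integrable.
- by move=> u v [uL _] [vL _]; exact: L2_CauchySchwarz_norm.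
Qed.

Lemma weighted_eC w u v : weighted_e w u v = weighted_e w v u.
Proof. by apply: eq_Rintegral => x _; rewrite frobC. Qed.

Lemma weighted_aC w f g : weighted_a w f g = weighted_a w g f.
Proof. by apply: eq_Rintegral => x _; rewrite [f x * _]mulrC. Qed.

Lemma L2vnorm_weight (s w : V -> R) (v : V -> V) : measurable_fun (Ome P) s -> measurable_fun (Ome P) w ->
  {ae mu, forall x, Ome P x -> s x ^+ 2 = w x} -> inL2v (Ome P) v ->
  L2vnorm (Ome P) (fun x => s x *: v x) ^+ 2 = weighted_e w v v.
Proof.
move=> ms mw sw vL; have mO := measurable_Ome hgeo.
have mv : measurable_fun (Ome P) (fun x => frob (v x) (v x)).
  have [/integrableP[+ _] _] := Rintegral_frobE mO vL vL.
  by move/measurable_EFinP.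
rewrite L2norm_sqr; transitivity (\int[mu]_(x in Ome P) (s x ^+ 2 * frob (v x) (v x))).
  by apply: eq_Rintegral => x _; rewrite fnorm_sqr frobZr frobC frobZr mulrA.
apply: ae_eq_Rintegral => //.
- by apply: measurable_funM => //; exact: measurable_funX.
- exact: measurable_funM.
by apply: filterS sw => x sw Ox; rewrite sw.
Qed.

Lemma L2norm_weight (s w : V -> R) (f : V -> R) : measurable_fun (Oma P) s -> measurable_fun (Oma P) w ->
  {ae mu, forall x, Oma P x -> s x ^+ 2 = w x} -> inL2 (Oma P) f ->
  L2norm (Oma P) (fun x => s x * f x) ^+ 2 = weighted_a w f f.
Proof.
move=> ms mw sw [mf fL]; have mO := measurable_Oma hgeo.
rewrite L2norm_sqr; transitivity (\int[mu]_(x in Oma P) (s x ^+ 2 * (f x * f x))).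
  by apply: eq_Rintegral => x _; rewrite exprMn.
have mff : measurable_fun (Oma P) (fun x => f x * f x) by exact: measurable_funM.
apply: ae_eq_Rintegral => //.
- by apply: measurable_funM => //; exact: measurable_funX.
- exact: measurable_funM.
by apply: filterS sw => x sw Ox; rewrite sw.
Qed.

Lemma measurable_sqrt (A : set V) (w : V -> R) : measurable A -> measurable_fun A w ->
  measurable_fun A (fun x => Num.sqrt (w x)).
Proof.
move=> mA mw; apply: (measurable_comp (F := setT)) => //.
by apply: continuous_measurable_fun; exact: sqrt_continuous.
Qed.

End weighted_forms.

(** * Cancellation of the coupling terms *)

Section interface.
Context (R : realType) (n : nat) (P : problem R n) (D : discretization R n).
Hypotheses (n0 : (0 < n)%N) (hgeo : geometry P) (hmesh : is_mesh P D).
Variable cT : R.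
Hypothesis hreg : mesh_regular D cT.

(** True for every function: the sign exchanges positive and negative parts, and infinite values are
    sent to 0 on both sides. The coupling terms are thus handled without integrability of the
    traces. *)
Lemma RintegralN m (A : set 'rV[R]_m) (f : 'rV[R]_m -> R) :
  \int[leb R m]_(x in A) (- f x) = - \int[leb R m]_(x in A) f x.
Proof.
rewrite /Rintegral [in LHS]integralE [in RHS]integralE.
rewrite (_ : (fun x => (- f x)%:E) = (\- (fun x => (f x)%:E))%E) ?funeposN ?funenegN//.
by case: (\int[_]_(_ in A) _)%E => [a| |]; case: (\int[_]_(_ in A) _)%E => [b| |] //=;
  rewrite ?oppr0// opprB.
Qed.

Lemma interface_cancel psi v : Ie P D psi v + Ia P D v psi = 0.
Proof.
rewrite /Ie /Ia -big_split/= big1// => F _; rewrite -big_split/= big1// => ke /andP[Fke eke].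
rewrite -big_split/= big1// => ka /andP[Fka aka].
have kk : ke != ka.
  by apply/eqP => kk; move: aka; rewrite -kk; exact: (elastic_acoustic hgeo hmesh eke).
rewrite (nrm_opposite n0 hmesh hreg kk Fke Fka) /face_int -mulrDr.
rewrite [X in _ * (_ + X)](_ : _ = - \int[leb R n]_(s in @ref_simplex R n)
    frob ((strc ka (rhoa P) (vtx F ord0 + s *m edges (vtx F)) *
       strc ka psi (vtx F ord0 + s *m edges (vtx F))) *: nrm ke F)
       (mtrc ke v (vtx F ord0 + s *m edges (vtx F)))); first by rewrite subrr mulr0.
rewrite -RintegralN; apply: eq_Rintegral => s _.
by rewrite [in RHS]frobC -scaleN1r !frobZr; ring.
Qed.

End interface.

Section energy.
Context (R : realType) (n : nat) (P : problem R n) (D : discretization R n).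
Hypotheses (n0 : (0 < n)%N) (hgeo : geometry P) (hmat : materials P) (hmesh : is_mesh P D).
Variable cT : R.
Hypotheses (hreg : mesh_regular D cT) (helw : elementwise_constant P D).
Variables alpha beta : R.
Hypotheses (alpha0 : 0 < alpha) (beta0 : 0 < beta).
Hypotheses (alphaT : 4 * trace_const n cT <= alpha) (betaT : 4 * trace_const n cT <= beta).
Variables (le he la ha : R).
Notation V := 'rV[R]_n.+1.
Notation mu := (leb R n.+1).
Hypotheses (le0 : 0 < le) (la0 : 0 < la)
  (rhoe_ae : {ae mu, forall x, Ome P x -> le <= rhoe P x <= he})
  (rhoa_ae : {ae mu, forall x, Oma P x -> la <= rhoa P x <= ha}).
Implicit Types (u v : V -> V) (f g : V -> R^o).
Notation Xe := (broken_e P D).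
Notation Xa := (broken_a P D).

Definition wz x := rhoe P x * zeta P x ^+ 2.
Definition wd x := 2 * rhoe P x * zeta P x.
Definition wc x := (cs P) ^- 2 * rhoa P x.

Let mOe := measurable_Ome hgeo.
Let mOa := measurable_Oma hgeo.
Let mrhoe : measurable_fun (Ome P) (rhoe P). Proof. by have [] := rhoe_density hmat. Qed.
Let mrhoa : measurable_fun (Oma P) (rhoa P). Proof. by have [] := rhoa_density hmat. Qed.
Let mzeta : measurable_fun (Ome P) (zeta P).
Proof.
have [mz _] := zeta_Linfty hmat; have [oO _ _ _] := Om_convex hgeo.
exact: measurable_funS (open_measurable_rV oO) (Ome_sub hgeo) mz.
Qed.
Let mwz : measurable_fun (Ome P) wz.
Proof. by apply: measurable_funM => //; exact: measurable_funX. Qed.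
Let mwd : measurable_fun (Ome P) wd.
Proof. by apply: measurable_funM => //; exact: measurable_funM. Qed.
Let mwc : measurable_fun (Oma P) wc.
Proof. exact: measurable_funM. Qed.
Let c0 : 0 < cs P := cs_gt0 hmat.

Let rhoe_bound : {ae mu, forall x, Ome P x -> `|rhoe P x| <= `|he|}.
Proof.
apply: filterS rhoe_ae => x H Ox; have /andP[l h] := H Ox.
by rewrite ger0_norm ?(le_trans (ltW le0))// (le_trans h)// ler_norm.
Qed.

Let rhoa_bound : {ae mu, forall x, Oma P x -> `|rhoa P x| <= `|ha|}.
Proof.
apply: filterS rhoa_ae => x H Ox; have /andP[l h] := H Ox.
by rewrite ger0_norm ?(le_trans (ltW la0))// (le_trans h)// ler_norm.
Qed.

Let zeta_bound : exists B : R, {ae mu, forall x, Ome P x -> `|zeta P x| <= B}.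
Proof.
have [_ [B zB]] := zeta_Linfty hmat; exists B; apply: filterS zB => x zB Ox.
exact/zB/(Ome_sub hgeo).
Qed.

Let wz_bound : exists M : R, {ae mu, forall x, Ome P x -> `|wz x| <= M}.
Proof.
have [B zB] := zeta_bound; exists (`|he| * B ^+ 2); apply: filterS2 rhoe_bound zB => x r z Ox.
rewrite /wz normrM normrX ler_pM ?r// lerXn2r ?nnegrE ?z//.
by rewrite (le_trans (normr_ge0 _) (z Ox)).
Qed.

Let wc_bound : {ae mu, forall x, Oma P x -> `|wc x| <= (cs P) ^- 2 * `|ha|}.
Proof.
apply: filterS rhoa_bound => x r Ox; rewrite /wc normrM ger0_norm ?invr_ge0 ?sqr_ge0//.
by rewrite ler_wpM2l ?r// invr_ge0 sqr_ge0.
Qed.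

Let rhoe_ge0 : {ae mu, forall x, Ome P x -> 0 <= rhoe P x}.
Proof.
by apply: filterS rhoe_ae => x H Ox; have /andP[l _] := H Ox; exact: le_trans (ltW le0) l.
Qed.

Definition energy u u1 f f1 : R :=
  weighted_e P (rhoe P) u1 u1 + weighted_e P wz u u + Ae P D alpha u u +
  weighted_a P wc f1 f1 + Aa P D beta f f.

Lemma weighted_e_ge0 (w : V -> R) u : measurable_fun (Ome P) w ->
  {ae mu, forall x, Ome P x -> 0 <= w x} -> Xe u -> 0 <= weighted_e P w u u.
Proof.
move=> mw w0 [uL _]; apply: ae_Rintegral_ge0 => //.
  apply: measurable_funM => //; have [/integrableP[+ _] _] := Rintegral_frobE mOe uL uL.
  by move/measurable_EFinP.
by apply: filterS w0 => x w0 Ox; rewrite mulr_ge0 ?w0// frob_ge0.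
Qed.

Lemma Enorm_sqr u u1 f f1 : Xe u -> Xe u1 -> Xa f1 ->
  Enorm P D alpha beta u u1 f f1 ^+ 2 =
  weighted_e P (rhoe P) u1 u1 + weighted_e P wz u u + dGe P D alpha u ^+ 2 +
  weighted_a P wc f1 f1 + dGa P D beta f ^+ 2.
Proof.
move=> [uL _] [u1L _] [f1L _]; rewrite sqr_sqrtr; last by rewrite !addr_ge0// sqr_ge0.
have ms := measurable_sqrt mOe mrhoe; have msa := measurable_sqrt mOa mrhoa.
rewrite (L2vnorm_weight hgeo (s := fun x => Num.sqrt (rhoe P x)) (w := rhoe P))//; last first.
  by apply: filterS rhoe_ge0 => x r Ox; rewrite sqr_sqrtr ?r.
rewrite (L2vnorm_weight hgeo (s := fun x => Num.sqrt (rhoe P x) * zeta P x) (w := wz))//.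
- rewrite (L2norm_weight hgeo (s := fun x => (cs P)^-1 * Num.sqrt (rhoa P x)) (w := wc))//.
    exact: measurable_funM.
  apply: filterS rhoa_ae => x r Ox; have /andP[l _] := r Ox.
  by rewrite exprMn sqr_sqrtr ?exprVn// (le_trans (ltW la0)).
- exact: measurable_funM.
- by apply: filterS rhoe_ge0 => x r Ox; rewrite exprMn sqr_sqrtr ?r.
Qed.

Lemma wc_ge : {ae mu, forall x, Oma P x -> (cs P) ^- 2 * la <= wc x}.
Proof.
apply: filterS rhoa_ae => x r Ox; have /andP[l _] := r Ox.
by rewrite ler_wpM2l// invr_ge0 sqr_ge0.
Qed.

Lemma weighted_a_lower f : Xa f ->
  (cs P) ^- 2 * la * L2norm (Oma P) f ^+ 2 <= weighted_a P wc f f.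
Proof.
move=> [fL _]; rewrite L2norm_sqr.
have -> : \int[mu]_(x in Oma P) (f x ^+ 2) = \int[mu]_(x in Oma P) (f x * f x) by [].
apply: (Rintegral_weight_ge mOa mwc wc_bound wc_ge); first exact: inL2M_integrable.
by move=> x _; rewrite -expr2 sqr_ge0.
Qed.

Lemma weighted_e_lower u : Xe u ->
  le * L2vnorm (Ome P) u ^+ 2 <= weighted_e P (rhoe P) u u.
Proof.
move=> [uL _]; rewrite L2norm_sqr.
have -> : \int[mu]_(x in Ome P) (fnorm (u x) ^+ 2) = \int[mu]_(x in Ome P) (frob (u x) (u x)).
  by apply: eq_Rintegral => x _; rewrite fnorm_sqr.
apply: (Rintegral_weight_ge mOe mrhoe rhoe_bound).
- by apply: filterS rhoe_ae => x r Ox; have /andP[] := r Ox.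
- by have [] := Rintegral_frobE mOe uL uL.
- by move=> x _; exact: frob_ge0.
Qed.

Lemma energy_terms_ge0 u u1 f f1 : Xe u -> Xe u1 -> Xa f -> Xa f1 ->
  [/\ 0 <= weighted_e P (rhoe P) u1 u1, 0 <= weighted_e P wz u u, 0 <= Ae P D alpha u u,
      0 <= weighted_a P wc f1 f1 & 0 <= Aa P D beta f f].
Proof.
move=> Xu Xu1 Xf Xf1; split.
- exact: weighted_e_ge0.
- apply: weighted_e_ge0 => //; apply: filterS rhoe_ge0 => x r Ox.
  by rewrite mulr_ge0 ?r// sqr_ge0.
- have /andP[+ _] := Ae_coercive hgeo hmat hmesh hreg helw alpha0 alphaT Xu.
  by apply: le_trans; rewrite mulr_ge0// sqr_ge0.
- apply: le_trans (weighted_a_lower Xf1).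
  by rewrite mulr_ge0 ?sqr_ge0// mulr_ge0 ?invr_ge0 ?sqr_ge0// ltW.
- have /andP[+ _] := Aa_coercive hgeo hmat hmesh hreg helw beta0 betaT Xf.
  by apply: le_trans; rewrite mulr_ge0// sqr_ge0.
Qed.

(** The mass terms coincide; the constants come from the coercivity of the two penalized forms. *)
Lemma energy_Enorm u u1 f f1 : Xe u -> Xe u1 -> Xa f -> Xa f1 ->
  2^-1 * Enorm P D alpha beta u u1 f f1 ^+ 2 <= energy u u1 f f1 <=
  3 / 2 * Enorm P D alpha beta u u1 f f1 ^+ 2.
Proof.
move=> Xu Xu1 Xf Xf1; rewrite Enorm_sqr// /energy.
have [m1 m2 _ m4 _] := energy_terms_ge0 Xu Xu1 Xf Xf1.
have /andP[a1 a2] := Ae_coercive hgeo hmat hmesh hreg helw alpha0 alphaT Xu.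
have /andP[b1 b2] := Aa_coercive hgeo hmat hmesh hreg helw beta0 betaT Xf.
by apply/andP; split; lra.
Qed.

(** Half the time derivative of [energy], by symmetry of its five forms. *)
Definition power u u1 u2 f f1 f2 : R :=
  weighted_e P (rhoe P) u1 u2 + weighted_e P wz u u1 + Ae P D alpha u u1 +
  weighted_a P wc f1 f2 + Aa P D beta f f1.

Lemma energy_rate T (u u1 u2 : R -> V -> V) (f f1 f2 : R -> V -> R^o) t :
  isC1 Xe (L2vnorm (Ome P)) T u u1 -> isC1 Xe (L2vnorm (Ome P)) T u1 u2 ->
  isC1 Xa (L2norm (Oma P)) T f f1 -> isC1 Xa (L2norm (Oma P)) T f1 f2 -> 0 <= t <= T ->
  rate T (fun s => energy (u s) (u1 s) (f s) (f1 s))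
    (2 * power (u t) (u1 t) (u2 t) (f t) (f1 t) (f2 t)) t.
Proof.
move=> uC u1C fC f1C tT.
have re B w w1 : bform Xe (L2vnorm (Ome P)) B -> (forall v z, Xe v -> Xe z -> B v z = B z v) ->
    isC1 Xe (L2vnorm (Ome P)) T w w1 -> rate T (fun s => B (w s) (w s)) (2 * B (w t) (w1 t)) t.
  move=> BB Bs wC; refine (bform_rate _ (broken_e_lin hgeo (D := D)) _ BB Bs wC tT).
  - by move=> v _; exact: L2norm_ge0.
  - by move=> a v [vL _]; exact: L2vnormZ.
have ra B (w w1 : R -> V -> R^o) : bform Xa (L2norm (Oma P)) B ->
    (forall f' g', Xa f' -> Xa g' -> B f' g' = B g' f') ->
    isC1 Xa (L2norm (Oma P)) T w w1 -> rate T (fun s => B (w s) (w s)) (2 * B (w t) (w1 t)) t.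
  move=> BB Bs wC; refine (bform_rate _ (broken_a_lin hgeo (D := D)) _ BB Bs wC tT).
  - by move=> v _; exact: L2norm_ge0.
  - by move=> a v [vL _]; exact: L2normZ.
have [M wzM] := wz_bound.
rewrite /power 4!mulrDr; apply: rateD; [apply: rateD; [apply: rateD; [apply: rateD|]|]|].
- apply: re u1C; first exact: weighted_e_bform rhoe_bound.
  by move=> v z _ _; exact: weighted_eC.
- apply: re uC; first exact: weighted_e_bform wzM.
  by move=> v z _ _; exact: weighted_eC.
- apply: re uC; first exact: Ae_bform.
  exact: Ae_sym.
- apply: ra f1C; first exact: weighted_a_bform wc_bound.
  by move=> v z _ _; exact: weighted_aC.
- apply: ra fC; first exact: Aa_bform.
  exact: Aa_sym.
Qed.

(** The roots convert the energy into the L2 norms of the two velocities, and [ha] bounds the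
    density in front of the acoustic load; no discretization parameter enters. *)
Definition load_const : R := Num.sqrt le^-1 + `|ha| * Num.sqrt ((cs P) ^- 2 * la)^-1.

(* Testing the equation with the velocities makes the two interface terms cancel. *)
Lemma power_bound u u1 u2 f f1 f2 (fe : V -> V) (fa : V -> R) :
  Xe u -> Xe u1 -> Xa f -> Xa f1 -> inL2v (Ome P) fe -> inL2 (Oma P) fa ->
  semidiscrete_eq P D alpha beta u u1 u2 f f1 f2 fe fa u1 f1 ->
  power u u1 u2 f f1 f2 <=
  load_const * (L2vnorm (Ome P) fe + L2norm (Oma P) fa) * Num.sqrt (energy u u1 f f1).
Proof.
move=> Xu Xu1 Xf Xf1 feL faL; rewrite /semidiscrete_eq.
rewrite -[X in X = _]addrA (interface_cancel n0 hgeo hmesh hreg) addr0.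
have -> : \int[mu]_(x in Ome P) frob (rhoe P x *: u2 x) (u1 x) = weighted_e P (rhoe P) u1 u2.
  by apply: eq_Rintegral => x _; rewrite frobC frobZr.
have -> : \int[mu]_(x in Ome P) frob ((2 * rhoe P x * zeta P x) *: u1 x) (u1 x) =
    weighted_e P wd u1 u1 by apply: eq_Rintegral => x _; rewrite frobC frobZr.
have -> : \int[mu]_(x in Ome P) frob ((rhoe P x * zeta P x ^+ 2) *: u x) (u1 x) =
    weighted_e P wz u u1 by apply: eq_Rintegral => x _; rewrite frobC frobZr frobC.
have -> : \int[mu]_(x in Oma P) ((cs P) ^- 2 * rhoa P x * f2 x * f1 x) = weighted_a P wc f1 f2.
  by apply: eq_Rintegral => x _; rewrite /wc -mulrA [f2 x * _]mulrC.
have d0 : 0 <= weighted_e P wd u1 u1.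
  apply: weighted_e_ge0 => //.
  have z0 : {ae mu, forall x, Ome P x -> 0 <= zeta P x}.
    by apply: filterS (zeta_ge0 hmat) => x z Ox; exact/z/(Ome_sub hgeo).
  by apply: filterS2 rhoe_ge0 z0 => x r z Ox; rewrite !mulr_ge0 ?r ?z.
have [t1 t2 t3 t4 t5] := energy_terms_ge0 Xu Xu1 Xf Xf1.
set E := energy u u1 f f1.
have E0 : 0 <= E by rewrite /E /energy; lra.
have nu : L2vnorm (Ome P) u1 <= Num.sqrt le^-1 * Num.sqrt E.
  rewrite -sqrtrM ?invr_ge0 ?(ltW le0)// -[leLHS]ger0_norm ?L2norm_ge0// -sqrtr_sqr.
  rewrite ler_wsqrtr// mulrC ler_pdivlMr// mulrC (le_trans (weighted_e_lower Xu1))//.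
  by rewrite /E /energy; lra.
have k0 : 0 < (cs P) ^- 2 * la by rewrite mulr_gt0// invr_gt0 exprn_gt0.
have nf : L2norm (Oma P) f1 <= Num.sqrt ((cs P) ^- 2 * la)^-1 * Num.sqrt E.
  rewrite -sqrtrM ?invr_ge0 ?(ltW k0)// -[leLHS]ger0_norm ?L2norm_ge0// -sqrtr_sqr.
  rewrite ler_wsqrtr// mulrC ler_pdivlMr// mulrC (le_trans (weighted_a_lower Xf1))//.
  by rewrite /E /energy; lra.
have le1 : \int[mu]_(x in Ome P) frob (fe x) (u1 x) <= L2vnorm (Ome P) fe * L2vnorm (Ome P) u1.
  have [u1L _] := Xu1; have [ife _] := Rintegral_frobE mOe feL u1L.
  apply: le_trans (L2v_CauchySchwarz mOe feL u1L); apply: le_trans (ler_norm _) _.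
  exact: le_normr_Rintegral.
have le2 : \int[mu]_(x in Oma P) (rhoa P x * fa x * f1 x) <=
    `|ha| * (L2norm (Oma P) fa * L2norm (Oma P) f1).
  have [f1L _] := Xf1; have ifa := inL2M_integrable mOa faL f1L.
  rewrite -[`|ha|]normr_id.
  apply: le_trans (ler_wpM2l (normr_ge0 _) (L2_CauchySchwarz_norm mOa faL f1L)).
  apply: le_trans (norm_Rintegral_weight mOa mrhoa rhoa_bound ifa).
  apply: le_trans (ler_norm _); rewrite le_eqVlt; apply/orP; left; apply/eqP.
  by apply: eq_Rintegral => x _; rewrite mulrA.
have [ne na] : 0 <= L2vnorm (Ome P) fe /\ 0 <= L2norm (Oma P) fa by split; exact: L2norm_ge0.
move=> eq; have le3 := ler_wpM2l ne nu.
have le4 := ler_wpM2l (normr_ge0 ha) (ler_wpM2l na nf).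
have s0 : 0 <= Num.sqrt E by exact: sqrtr_ge0.
have c1 : 0 <= Num.sqrt le^-1 by exact: sqrtr_ge0.
have c2 : 0 <= `|ha| * Num.sqrt ((cs P) ^- 2 * la)^-1 by rewrite mulr_ge0 ?sqrtr_ge0.
(* The product of the sum of constants with the sum of load norms contains two cross terms beyond
   what Cauchy-Schwarz gives; they are nonnegative and are added. *)
have x1 : 0 <= Num.sqrt le^-1 * L2norm (Oma P) fa * Num.sqrt E by rewrite !mulr_ge0.
have x2 : 0 <= `|ha| * Num.sqrt ((cs P) ^- 2 * la)^-1 * L2vnorm (Ome P) fe * Num.sqrt E.
  by rewrite !mulr_ge0.
have -> : load_const * (L2vnorm (Ome P) fe + L2norm (Oma P) fa) * Num.sqrt E =
    L2vnorm (Ome P) fe * (Num.sqrt le^-1 * Num.sqrt E) +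
    `|ha| * (L2norm (Oma P) fa * (Num.sqrt ((cs P) ^- 2 * la)^-1 * Num.sqrt E)) +
    Num.sqrt le^-1 * L2norm (Oma P) fa * Num.sqrt E +
    `|ha| * Num.sqrt ((cs P) ^- 2 * la)^-1 * L2vnorm (Ome P) fe * Num.sqrt E.
  by rewrite /load_const; ring.
by rewrite /power; lra.
Qed.

End energy.

Lemma isC1_sub (R : realType) (n : nat) (W : lmodType R) (X Y : ('rV[R]_n -> W) -> Prop)
    (N : ('rV[R]_n -> W) -> R) (T : R) (u u1 : R -> 'rV[R]_n -> W) :
  (forall v, X v -> Y v) -> isC1 X N T u u1 -> isC1 Y N T u u1.
Proof.
by move=> XY uC t tT; have [Xu Xu1 c1 c2] := uC t tT; split => //; exact: XY.
Qed.

Section loads.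
Context (R : realType) (n : nat) (A : set 'rV[R]_n) (T : R).
Hypothesis mA : measurable A.

Lemma isC1_L2vnorm_continuous p q (f f' : R -> 'rV[R]_n -> 'M[R]_(p, q)) :
  isC1 (inL2v A) (L2vnorm A) T f f' -> {within `[0, T], continuous (fun t => L2vnorm A (f t))}.
Proof.
move=> fC; refine (isC1_norm_continuous _ _ _ _ fC).
- by move=> v _; exact: L2norm_ge0.
- by move=> a u v uL vL; apply: inL2vD => //; exact: inL2vZ.
- by move=> a v; exact: L2vnormZ.
- by move=> u v; exact: L2vnormD.
Qed.

Lemma isC1_L2norm_continuous (f f' : R -> 'rV[R]_n -> R^o) :
  isC1 (inL2 A) (L2norm A) T f f' -> {within `[0, T], continuous (fun t => L2norm A (f t))}.
Proof.
move=> fC; refine (isC1_norm_continuous _ _ _ _ fC).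
- by move=> v _; exact: L2norm_ge0.
- by move=> a u v uL vL; exact: inL2_lin.
- by move=> a v; exact: L2normZ.
- by move=> u v; exact: L2normD.
Qed.

End loads.

(** From [e <= 2 sqrt E] and [sqrt E0 <= 2 e0] follows [e <= 4 e0 + 2 C I], and both coefficients
    are at most [4 + 2 C]. *)
Lemma energy_to_norm (R : realType) (E E0 e e0 C I : R) : 0 <= C -> 0 <= I -> 0 <= e0 -> 0 <= e ->
  0 <= E -> 2^-1 * e ^+ 2 <= E -> E0 <= 3 / 2 * e0 ^+ 2 ->
  Num.sqrt E <= Num.sqrt E0 + C * I -> e <= (4 + 2 * C) * (e0 + I).
Proof.
move=> C0 I0 e00 e_ge0 E_ge0 eE E0e H.
have h1 : e <= 2 * Num.sqrt E.
  rewrite -[e]ger0_norm// -sqrtr_sqr -[2]ger0_norm// -sqrtr_sqr -sqrtrM ?sqr_ge0//.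
  by rewrite ler_wsqrtr//; lra.
have h2 : Num.sqrt E0 <= 2 * e0.
  rewrite -[e0]ger0_norm// -[2]ger0_norm// -normrM -sqrtr_sqr ler_wsqrtr//.
  by have := sqr_ge0 e0; rewrite exprMn; lra.
have x1 : 0 <= C * e0 by rewrite mulr_ge0.
by rewrite mulrDl !mulrDr; lra.
Qed.

(** The order of the quantifiers expresses the convention on hidden constants: thresholds and [C]
    are fixed from the material problem and [cT], before penalties, mesh, degrees, final time and
    data. *)
Theorem theorem4p2 (R : realType) (n : nat) (hd : n.+1 = 2%N \/ n.+1 = 3%N)
    (P : problem R n) (hgeo : geometry P) (hmat : materials P)
    (cT : R) (hcT : 0 < cT) :
  exists alpha0 beta0 C : R, [/\ 0 < alpha0, 0 < beta0, 0 < C &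
  forall (alpha beta : R), alpha0 < alpha -> beta0 < beta ->
  forall (D : discretization R n), is_mesh P D -> mesh_regular D cT ->
    elementwise_constant P D ->
  forall (T : R), 0 < T ->
  forall (fe fe' : R -> 'rV[R]_n.+1 -> 'rV[R]_n.+1)
         (fa fa' : R -> 'rV[R]_n.+1 -> R),
    isC1 (inL2v (Ome P)) (L2vnorm (Ome P)) T fe fe' ->
    isC1 (W := R^o) (inL2 (Oma P)) (L2norm (Oma P)) T fa fa' ->
  forall (u u1 u2 : R -> 'rV[R]_n.+1 -> 'rV[R]_n.+1)
         (phi phi1 phi2 : R -> 'rV[R]_n.+1 -> R),
    isC1 (Vhe P D) (L2vnorm (Ome P)) T u u1 ->
    isC1 (Vhe P D) (L2vnorm (Ome P)) T u1 u2 ->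
    isC1 (W := R^o) (Vha P D) (L2norm (Oma P)) T phi phi1 ->
    isC1 (W := R^o) (Vha P D) (L2norm (Oma P)) T phi1 phi2 ->
    (forall t : R, 0 < t <= T -> forall v psi, Vhe P D v -> Vha P D psi ->
      semidiscrete_eq P D alpha beta (u t) (u1 t) (u2 t)
        (phi t) (phi1 t) (phi2 t) (fe t) (fa t) v psi) ->
  forall t : R, 0 < t <= T ->
    Enorm P D alpha beta (u t) (u1 t) (phi t) (phi1 t) <=
    C * (Enorm P D alpha beta (u 0) (u1 0) (phi 0) (phi1 0)
         + \int[lebesgue_measure]_(tau in `[0, t])
             (L2vnorm (Ome P) (fe tau) + L2norm (Oma P) (fa tau)))].
Proof.
have n0 : (0 < n)%N by case: hd => -[->].
have [_ [le [he [le0 rhoe_ae]]]] := rhoe_density hmat.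
have [_ [la [ha [la0 rhoa_ae]]]] := rhoa_density hmat.
have tc0 : 0 <= trace_const n cT by exact: trace_const_ge0.
pose C0 := load_const P le la ha.
have C00 : 0 <= C0 by rewrite addr_ge0 ?sqrtr_ge0// mulr_ge0 ?sqrtr_ge0.
(* The absorption condition, increased by 1 so that the threshold is positive; the same value serves
   both penalties. *)
pose a0 := 4 * trace_const n cT + 1.
have a00 : 0 < a0 by rewrite ltr_wpDl// mulr_ge0.
exists a0, a0, (4 + 2 * C0); split => //; first by rewrite ltr_pwDl// mulr_ge0.
move=> alpha beta aa ab D hmesh hreg helw T T0 fe fe' fa fa' feC faC
  u u1 u2 phi phi1 phi2 uC u1C phiC phi1C eq t tT.
have alpha0 : 0 < alpha by exact: lt_trans aa.
have beta0 : 0 < beta by exact: lt_trans ab.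
have alphaT : 4 * trace_const n cT <= alpha by apply: le_trans (ltW aa); rewrite lerDl.
have betaT : 4 * trace_const n cT <= beta by apply: le_trans (ltW ab); rewrite lerDl.
have uB := isC1_sub (@Vhe_broken _ _ P D) uC; have u1B := isC1_sub (@Vhe_broken _ _ P D) u1C.
have pB := isC1_sub (@Vha_broken _ _ P D) phiC; have p1B := isC1_sub (@Vha_broken _ _ P D) phi1C.
pose E s := @energy R n P D alpha beta (u s) (u1 s) (phi s) (phi1 s).
pose En s := Enorm P D alpha beta (u s) (u1 s) (phi s) (phi1 s).
have En0 s : 0 <= En s by exact: sqrtr_ge0.
have EE s : 0 <= s <= T -> 2^-1 * En s ^+ 2 <= E s <= 3 / 2 * En s ^+ 2.
  move=> sT; have [Xu Xu1 _ _] := uB s sT; have [Xp Xp1 _ _] := pB s sT.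
  exact: (energy_Enorm hgeo hmat hmesh hreg helw alpha0 beta0 alphaT betaT le0 la0 rhoe_ae rhoa_ae).
have E0 s : 0 <= s <= T -> 0 <= E s.
  move=> sT; have /andP[h _] := EE s sT; apply: le_trans h.
  by rewrite mulr_ge0 ?sqr_ge0.
pose l s := L2vnorm (Ome P) (fe s) + L2norm (Oma P) (fa s).
have l0 s : 0 <= l s by rewrite addr_ge0 ?L2norm_ge0.
have lc : {within `[0, T], continuous l}.
  have c1 := isC1_L2vnorm_continuous (measurable_Ome hgeo) feC.
  have c2 := isC1_L2norm_continuous (measurable_Oma hgeo) faC.
  by move=> s; apply: cvgD; [exact: c1|exact: c2].
have rE s (sT : 0 <= s <= T) := energy_rate hgeo hmat hmesh helw alpha beta le0 la0 rhoe_ae rhoa_ae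
  uB u1B pB p1B sT.
have tT' : 0 <= t <= T by case/andP: tT => t0 ->; rewrite ltW.
have := energy_gronwall T0 C00 rE E0 lc (fun s _ => l0 s) _ tT'.
have -> : \int[lebesgue_measure]_(s in `[0, t]) l s = \int[lebesgue_measure]_(tau in `[0, t])
   (L2vnorm (Ome P) (fe tau) + L2norm (Oma P) (fa tau)) by [].
set I := \int[lebesgue_measure]_(tau in `[0, t]) _ => H.
have {}H : Num.sqrt (E t) <= Num.sqrt (E 0) + C0 * I.
  (* The velocities are admissible test functions because [isC1] places the derivative in the
     discrete space; the equation at positive times suffices, the inequality being required inside
     the interval only. *)
  apply: H => s /andP[s0 sT]; have sT' : 0 <= s <= T by rewrite !ltW.
  have [Vu Vu1 _ _] := uC s sT'; have [Vp Vp1 _ _] := phiC s sT'.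
  have [feL _ _ _] := feC s sT'; have [faL _ _ _] := faC s sT'.
  have sT2 : 0 < s <= T by rewrite s0 ltW.
  rewrite -!mulrA ler_wpM2l//.
  have := power_bound n0 hgeo hmat hmesh hreg helw alpha0 beta0 alphaT betaT le0 la0 rhoe_ae rhoa_ae
    (Vhe_broken Vu) (Vhe_broken Vu1) (Vha_broken Vp) (Vha_broken Vp1) feL faL
    (eq s sT2 _ _ Vu1 Vp1).
  by rewrite -mulrA.
have I0 : 0 <= I by apply: Rintegral_ge0 => s _; exact: l0.
have z0 : 0 <= (0 : R) <= T by rewrite lexx ltW.
have /andP[Et _] := EE t tT'; have /andP[_ Ez] := EE 0 z0.
exact: energy_to_norm C00 I0 (En0 0) (En0 t) (E0 t tT') Et Ez H.
Qed.
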